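(* There is an algorithm that, given an $n$-vertex plane $st$-graph $G$ such that every internal face of $G$ is either a generalized triangle or a rhombus, decides in $O(n)$ time whether $G$ admits an embedding-preserving 2UBE, and which computes such a 2UBE in the positive case.
   Context: Digraphs are finite, without loops and without multiple edges. A planar $st$-graph is a directed acyclic graph with a single source $s$ and a single sink $t$ that admits a planar embedding with $s$ and $t$ on the outer face; together with such an embedding it is called a plane $st$-graph. The left (right) face of an edge $e=(u,v)$ is the face to the left (right) of $e$ when moving from $u$ to $v$. The boundary of every internal face $f$ of a plane $st$-graph consists of two directed paths from a common source $s_f$ to a common sink $t_f$: the left path of $f$ consists of the boundary edges whose right face is $f$, and the right path of $f$ consists of the boundary edges whose left face is $f$. An internal face is a generalized triangle if its left path or its right path is a single edge; it is a rhombus if each of its left path and right path consists of exactly two edges. A 2UBE (upward 2-page book embedding) of a digraph $G=(V,E)$ is a pair $\langle\pi,\sigma\rangle$, where $\pi:V\to\{1,\dots,|V|\}$ is a bijection with $\pi(u)<\pi(v)$ for every directed edge $(u,v)$, and $\sigma:E\to\{L,R\}$ assigns edges to the left or right page so that no two edges $(a,b),(c,d)$ in the same page satisfy $\pi(a)<\pi(c)<\pi(b)<\pi(d)$. Its canonical drawing $\Gamma(\pi,\sigma)$ in the plane places each vertex $v$ on a vertical line (the spine) at $y$-coordinate $\pi(v)$ and draws each edge as a circular arc in the half-plane to the left (if $\sigma(e)=L$) or to the right (if $\sigma(e)=R$) of the spine; this is a planar drawing. For a plane $st$-graph $G$, a 2UBE $\langle\pi,\sigma\rangle$ is embedding-preserving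 if $\Gamma(\pi,\sigma)$ has the given planar embedding of $G$ (same internal and external faces). *)

(* Defs.v *)
(* World: Mathematical Components. *)
From mathcomp Require Import all_boot all_fingroup.

Set Implicit Arguments.
Unset Strict Implicit.
Unset Printing Implicit Defensive.

(** * Plane st-graphs *)

(* An edge e = (u, v) gives two darts: (e, true) leaves u and (e, false)
   leaves v. *)
Definition dart (m : nat) : finType := ('I_m * bool)%type.

Definition opp m (d : dart m) : dart m := (d.1, ~~ d.2).

(* A digraph with vertices 'I_n and edges 'I_m, embedded in the plane with
   faces 'I_p, as a combinatorial map: [rot d] is the dart that follows d in
   the counterclockwise order around the origin of d. *)
Record embedded_digraph (n m p : nat) := EmbeddedDigraph {
  tail : 'I_m -> 'I_n;
  head : 'I_m -> 'I_n;
  rot : dart m -> dart m;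
  left_face : 'I_m -> 'I_p;
  right_face : 'I_m -> 'I_p;
  outer : 'I_p;
  src : 'I_n;
  snk : 'I_n }.

Section EmbeddedDigraph.
Variables (n m p : nat) (G : embedded_digraph n m p).

Definition orig (d : dart m) : 'I_n := if d.2 then tail G d.1 else head G d.1.

(* The face to the left when moving along d away from its origin; equivalently,
   the face in the angle from d counterclockwise to [rot G d]. *)
Definition dart_face (d : dart m) : 'I_p :=
  if d.2 then left_face G d.1 else right_face G d.1.

Definition adj : rel 'I_n :=
  fun u v => [exists e, (tail G e == u) && (head G e == v)].

Definition simple_digraph : Prop :=
  (forall e, tail G e <> head G e) /\
  injective (fun e => (tail G e, head G e)).

Definition acyclic : Prop := forall e, ~~ connect adj (head G e) (tail G e).

Definition single_source_sink : Prop :=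
  (forall v, (forall e, head G e <> v) <-> v = src G) /\
  (forall v, (forall e, tail G e <> v) <-> v = snk G).

(* The last clause is Euler's formula for genus 0; it is the right one because
   an acyclic digraph with a single source is connected.  The step
   [d |-> opp (rot G d)] walks along the boundary of the face of d. The case
   m = 0 is the one-vertex graph, whose only face has no incident dart. *)
Definition planar_embedding : Prop :=
  [/\ injective (rot G),
      forall d d', fconnect (rot G) d d' = (orig d == orig d'),
      forall d d', fconnect (fun x => opp (rot G x)) d d' =
                   (dart_face d == dart_face d'),
      forall f, m = 0 \/ exists d, dart_face d = f
    & n + p = m + 2].

Definition on_face (v : 'I_n) (f : 'I_p) : Prop :=
  m = 0 \/ exists d, orig d = v /\ dart_face d = f.

Definition plane_st_graph : Prop :=
  [/\ simple_digraph, acyclic, single_source_sink, planar_embedding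
    & on_face (src G) (outer G) /\ on_face (snk G) (outer G)].

Definition left_path (f : 'I_p) : {set 'I_m} := [set e | right_face G e == f].
Definition right_path (f : 'I_p) : {set 'I_m} := [set e | left_face G e == f].

Definition generalized_triangle (f : 'I_p) : Prop :=
  #|left_path f| = 1 \/ #|right_path f| = 1.

Definition rhombus (f : 'I_p) : Prop :=
  #|left_path f| = 2 /\ #|right_path f| = 2.

(** * Upward 2-page book embeddings *)

(* Vertex v has position pi v + 1 on the spine; e is on the right page if
   sigma e is true, and on the left page otherwise. *)
Definition is_2UBE (pi : {perm 'I_n}) (sigma : 'I_m -> bool) : Prop :=
  (forall e, pi (tail G e) < pi (head G e)) /\
  (forall e e', sigma e = sigma e' ->
     ~~ [&& pi (tail G e) < pi (tail G e'), pi (tail G e') < pi (head G e)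
          & pi (head G e) < pi (head G e')]).

(* The darts at v on page pg, outgoing edges if out and incoming edges
   otherwise, by increasing position of the other endpoint. *)
Definition page_darts (pi : {perm 'I_n}) (sigma : 'I_m -> bool) (v : 'I_n)
    (pg out : bool) : seq (dart m) :=
  sort (fun d d' => pi (orig (opp d)) <= pi (orig (opp d')))
    [seq d <- enum (dart m) |
      [&& orig d == v, sigma d.1 == pg & d.2 == out]].

(* The darts at v in counterclockwise order in the canonical drawing, starting
   from the downward direction of the spine.  All arcs at v are tangent to the
   horizontal line through v, and an arc with a nearer other endpoint bends
   more towards the spine.  So on the right side, bottom to top, one meets
   the incoming arcs from the nearest to the farthest tail, then the outgoing
   arcs from the farthest to the nearest head; on the left side, top to
   bottom, the outgoing arcs from the nearest to the farthest head, then the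
   incoming arcs from the farthest to the nearest tail. *)
Definition drawing_rot (pi : {perm 'I_n}) (sigma : 'I_m -> bool) (v : 'I_n) :
    seq (dart m) :=
  rev (page_darts pi sigma v true false) ++
  rev (page_darts pi sigma v true true) ++
  page_darts pi sigma v false true ++
  page_darts pi sigma v false false.

(* The canonical drawing and G have the same rotation system and the same
   outer face.  The source is the lowest vertex of the drawing, so the
   unbounded face is the one containing the downward direction at the source,
   i.e. the angle that follows the last dart of [drawing_rot]. *)
Definition embedding_preserving (pi : {perm 'I_n}) (sigma : 'I_m -> bool) :
    Prop :=
  (forall d, rot G d = next (drawing_rot pi sigma (orig d)) d) /\
  (forall d, orig d = src G ->
     dart_face (last d (drawing_rot pi sigma (src G))) = outer G).

End EmbeddedDigraph.

(** * Machine model: a unit-cost RAM whose words are numbers at most w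

   The memory has registers and arrays, each indexed by nat; a program can only
   name finitely many of them.  Expressions have no side effects, and every
   operator, test and assignment costs one step. *)

Inductive expr :=
  | Const of nat
  | Reg of nat
  | Read of nat & expr        (* Read a i : entry i of array a *)
  | Add of expr & expr
  | Sub of expr & expr        (* truncated *)
  | Lt of expr & expr
  | Eq of expr & expr.

Inductive cmd :=
  | Skip
  | Set_ of nat & expr            (* Set_ x e : register x := e *)
  | Write of nat & expr & expr    (* Write a i e : entry i of array a := e *)
  | Seq of cmd & cmd
  | If of expr & cmd & cmd        (* nonzero means true *)
  | While of expr & cmd.

Record state := State { reg : nat -> nat; arr : nat -> nat -> nat }.

Definition upd (T : Type) (f : nat -> T) (i : nat) (x : T) : nat -> T :=
  fun j => if j == i then x else f j.

Definition set_reg (s : state) (x k : nat) : state :=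
  State (upd (reg s) x k) (arr s).

Definition set_arr (s : state) (a i k : nat) : state :=
  State (reg s) (upd (arr s) a (upd (arr s a) i k)).

Fixpoint eval (s : state) (e : expr) : nat :=
  match e with
  | Const k => k
  | Reg x => reg s x
  | Read a i => arr s a (eval s i)
  | Add e1 e2 => eval s e1 + eval s e2
  | Sub e1 e2 => eval s e1 - eval s e2
  | Lt e1 e2 => eval s e1 < eval s e2
  | Eq e1 e2 => eval s e1 == eval s e2
  end.

Fixpoint expr_cost (e : expr) : nat :=
  match e with
  | Const _ | Reg _ => 1
  | Read _ i => (expr_cost i).+1
  | Add e1 e2 | Sub e1 e2 | Lt e1 e2 | Eq e1 e2 =>
      (expr_cost e1 + expr_cost e2).+1
  end.

(* [exec w c s t s']: started in s, the command c halts in s' after t steps.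
   Execution is deterministic, and it is stuck if a stored value or a written
   address exceeds w.  Intermediate values exceed w and the constants of the
   program by at most a factor that depends only on the program. *)
Inductive exec (w : nat) : cmd -> state -> nat -> state -> Prop :=
  | ExecSkip s : exec w Skip s 1 s
  | ExecSet x e s :
      eval s e <= w ->
      exec w (Set_ x e) s (expr_cost e).+1 (set_reg s x (eval s e))
  | ExecWrite a i e s :
      eval s i <= w -> eval s e <= w ->
      exec w (Write a i e) s (expr_cost i + expr_cost e).+1
        (set_arr s a (eval s i) (eval s e))
  | ExecSeq c1 c2 s1 s2 s3 t1 t2 :
      exec w c1 s1 t1 s2 -> exec w c2 s2 t2 s3 ->
      exec w (Seq c1 c2) s1 (t1 + t2) s3
  | ExecIfTrue e c1 c2 s s' t :
      eval s e != 0 -> exec w c1 s t s' ->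
      exec w (If e c1 c2) s (expr_cost e + t).+1 s'
  | ExecIfFalse e c1 c2 s s' t :
      eval s e = 0 -> exec w c2 s t s' ->
      exec w (If e c1 c2) s (expr_cost e + t).+1 s'
  | ExecWhileTrue e c s1 s2 s3 t1 t2 :
      eval s1 e != 0 -> exec w c s1 t1 s2 -> exec w (While e c) s2 t2 s3 ->
      exec w (While e c) s1 (expr_cost e + t1 + t2).+1 s3
  | ExecWhileFalse e c s :
      eval s e = 0 -> exec w (While e c) s (expr_cost e).+1 s.

(** * Input and output conventions *)

(* Dart (e, true) has number e, and dart (e, false) has number m + e. *)
Definition darts (m : nat) : seq (dart m) :=
  [seq (e, true) | e <- enum 'I_m] ++ [seq (e, false) | e <- enum 'I_m].

Definition dart_code m (d : dart m) : nat := if d.2 then d.1 : nat else m + d.1.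

(* Registers 0 to 5 hold n, m, p, the outer face, the source and the sink;
   arrays 0, 1 and 2 give the origin, the face and the rotation successor of
   each dart.  The rest of the memory is 0. *)
Definition input n m p (G : embedded_digraph n m p) : state :=
  State
    (nth 0 [:: n; m; p; val (outer G); val (src G); val (snk G)])
    (nth (fun=> 0)
      [:: nth 0 [seq val (orig G d) | d <- darts m];
          nth 0 [seq val (dart_face G d) | d <- darts m];
          nth 0 [seq dart_code (rot G d) | d <- darts m]]).

(* Register 0 is the answer (1 for yes, 0 for no); arrays 3 and 4 hold the
   spine positions 1, ..., n and the pages (0 for left, 1 for right). *)
Definition answer (s : state) : nat := reg s 0.

Definition outputs n m (s : state) (pi : {perm 'I_n}) (sigma : 'I_m -> bool) :
    Prop :=
  (forall v : 'I_n, arr s 3 v = (pi v).+1) /\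
  (forall e : 'I_m, arr s 4 e = sigma e).

(* Main.v *)
(** The diagonal between the two middle vertices of a rhombus can be inserted in
    two directions; either one splits the rhombus into two triangles.  After
    the insertion every internal face has exactly one edge that forms a whole
    side of it; call this edge marked by the face.  An edge marked from both
    sides separates two incomparable vertices, so an embedding-preserving 2UBE
    exists if and only if the diagonals can be directed in such a way that no
    edge is marked twice.  In that case the unmarked edges and the diagonals
    form a Hamiltonian path, which is the spine; an edge marked from its left
    goes to the right page.

    The choice of directions is a 2-SAT instance of linear size.  The
    generalized triangles yield its unit clauses.  Once these are propagated,
    the undecided rhombi never conflict: every decided region reaches the outer
    face, so by a parity argument (exactness over F_2 of the chain complex of
    the sphere) the vertices of the undecided rhombi have a 2-coloring that
    alternates along their edges, and this coloring and its complement give two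
    solutions.  Hence greedy propagation with a queue decides the instance. *)

Require Import Defs.
From mathcomp Require Import all_boot all_order all_fingroup all_algebra zify.
Import Defs.

Set Implicit Arguments.
Unset Strict Implicit.
Unset Printing Implicit Defensive.

(** * Darts, corners and faces *)

Lemma connect_ind (T : finType) (e : rel T) (P : T -> Prop) x y :
  P x -> (forall z t, P z -> e z t -> P t) -> connect e x y -> P y.
Proof.
move=> Px ind /connectP[q]; elim: q x Px => /= [|z q IHq] x Px; first by move=> _ ->.
by case/andP=> exz; apply: IHq; apply: ind exz.
Qed.

Lemma fconnect_ind (T : finType) (f : T -> T) (P : T -> Prop) x y :
  P x -> (forall z, P z -> P (f z)) -> fconnect f x y -> P y.
Proof. by move=> Px ind; apply: connect_ind => // z t Pz /eqP <-; apply: ind. Qed.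

Lemma fconnect_switch (T : finType) (f : T -> T) (P : pred T) x y :
  fconnect f x y -> P x -> ~~ P y -> exists z, [/\ fconnect f x z, P z & ~~ P (f z)].
Proof.
move=> fxy Px Py; case: (boolP [exists z, [&& fconnect f x z, P z & ~~ P (f z)]]).
  by case/existsP=> z /and3P[*]; exists z.
move=> /existsPn nz; case/negP: Py.
suff: fconnect f x y /\ P y by case.
apply: (fconnect_ind (P := fun z => fconnect f x z /\ P z) _ _ fxy) => [//|z [fxz Pz]].
split; first exact: connect_trans fxz (fconnect1 _ _).
by have := nz z; rewrite fxz Pz /= negbK.
Qed.

Lemma fconnect_conj (T : finType) (g f : T -> T) : involutive g ->
  forall x y, fconnect (fun z => g (f (g z))) x y = fconnect f (g x) (g y).
Proof.
move=> gK x y; apply/idP/idP => h.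
  apply: (fconnect_ind (P := fun z => fconnect f (g x) (g z)) _ _ h) => // z fz.
  by rewrite gK; apply: connect_trans fz (fconnect1 _ _).
rewrite -[y]gK; apply: (fconnect_ind (P := fun z => fconnect _ x (g z)) _ _ h) => [|z fz].
  by rewrite gK.
by apply: connect_trans fz (connect1 _); rewrite /= gK.
Qed.

Section Darts.
Variable m : nat.
Implicit Type d : dart m.

Lemma oppK : involutive (@opp m). Proof. by case=> e b; rewrite /opp /= negbK. Qed.

Lemma opp_inj : injective (@opp m). Proof. exact: inv_inj oppK. Qed.

Lemma card_dart : #|dart m| = m.*2.
Proof. by rewrite card_prod card_ord card_bool muln2. Qed.

End Darts.

Section PlaneGraph.
Variables (n m p : nat) (G : embedded_digraph n m p).
Notation orig := (orig G).
Notation face := (dart_face G).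
Notation rot := (rot G).
Notation tail := (tail G).
Notation head := (head G).
Implicit Types (d x y : dart m) (f g : 'I_p) (u v w : 'I_n) (e : 'I_m).

Definition phi d := opp (rot d).

Lemma opp_phi d : opp (phi d) = rot d. Proof. exact: oppK. Qed.

Lemma bit_phi d : (phi d).2 = ~~ (rot d).2. Proof. by []. Qed.

Hypothesis plane : plane_st_graph G.

Lemma rotation_inj : injective rot. Proof. by case: plane => _ _ _ []. Qed.

Lemma phi_inj : injective phi. Proof. by move=> x y /opp_inj/rotation_inj. Qed.

Lemma fconnect_rot x y : fconnect rot x y = (orig x == orig y).
Proof. by case: plane => _ _ _ []. Qed.

Lemma fconnect_phi x y : fconnect phi x y = (face x == face y).
Proof. by case: plane => _ _ _ []. Qed.

Lemma orig_rot d : orig (rot d) = orig d.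
Proof. by apply/esym/eqP; rewrite -fconnect_rot fconnect1. Qed.

Lemma face_phi d : face (phi d) = face d.
Proof. by apply/esym/eqP; rewrite -fconnect_phi fconnect1. Qed.

Lemma face_opp_rot d : face (opp (rot d)) = face d. Proof. exact: face_phi. Qed.

Lemma orig_opp_phi d : orig (opp (phi d)) = orig d.
Proof. by rewrite opp_phi orig_rot. Qed.

Lemma adj_edge e : adj G (tail e) (head e).
Proof. by apply/existsP; exists e; rewrite !eqxx. Qed.

Lemma edge_inj e e' : tail e = tail e' -> head e = head e' -> e = e'.
Proof. by case: plane => -[_ h] _ _ _ _ t1 t2; apply: h; rewrite /= t1 t2. Qed.

Lemma acyclicP e : ~~ connect (adj G) (head e) (tail e).
Proof. by case: plane => _ h _ _ _; apply: h. Qed.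

Lemma head_src e : head e != src G.
Proof. by case: plane => _ _ [h _] _ _; apply/eqP; apply: (h _).2. Qed.

Lemma tail_snk e : tail e != snk G.
Proof. by case: plane => _ _ [_ h] _ _; apply/eqP; apply: (h _).2. Qed.

Lemma in_edge v : v != src G -> exists e, head e = v.
Proof.
move=> /eqP vs; case: (boolP [exists e, head e == v]) => [/existsP[e /eqP]|/existsPn h].
  by exists e.
by case: plane => _ _ [hs _] _ _; case: vs; apply/hs => e /eqP; rewrite (negbTE (h e)).
Qed.

Lemma out_edge v : v != snk G -> exists e, tail e = v.
Proof.
move=> /eqP vs; case: (boolP [exists e, tail e == v]) => [/existsP[e /eqP]|/existsPn h].
  by exists e.
by case: plane => _ _ [_ hs] _ _; case: vs; apply/hs => e /eqP; rewrite (negbTE (h e)).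
Qed.

Lemma connect_src v : connect (adj G) (src G) v.
Proof.
have [k] := ubnP #|[pred u | connect (adj G) u v]|.
elim: k v => // k IHk v; rewrite ltnS => lek.
have [->|/in_edge[e ev]] := eqVneq v (src G); first exact: connect0.
apply: (@connect_trans _ _ (tail e)); last by rewrite -ev connect1 ?adj_edge.
apply: IHk; apply: leq_trans lek; apply: proper_card; apply/properP; split.
  apply/subsetP=> u; rewrite !inE => h; apply: connect_trans h _.
  by rewrite -ev connect1 ?adj_edge.
by exists v; rewrite !inE ?connect0 // -ev acyclicP.
Qed.

Lemma in_dart_src d : orig d = src G -> d.2.
Proof.
case: d => e [] //= /eqP; rewrite /Defs.orig /=.
by rewrite (negbTE (head_src e)).
Qed.

Lemma out_dart_snk d : orig d = snk G -> ~~ d.2.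
Proof.
case: d => e [] //= /eqP; rewrite /Defs.orig /=.
by rewrite (negbTE (tail_snk e)).
Qed.

Lemma face_dart : 0 < m -> forall f, exists d, face d = f.
Proof.
case: plane => _ _ _ [_ _ _ h _] _ m0 f.
by case: (h f) => // m_0; rewrite m_0 in m0.
Qed.

Lemma face_out_dart d : exists2 x, face x = face d & x.2.
Proof.
case: (boolP [exists x, (face x == face d) && x.2]) => [/existsP[x /andP[/eqP]]|].
  by exists x.
move=> /existsPn allF.
have bitF x : face x = face d -> x.2 = false.
  by move=> fx; apply/negbTE; have := allF x; rewrite fx eqxx.
have step x y : fconnect phi x y -> face x = face d -> connect (adj G) (orig x) (orig y).
  move=> xy fx; suff [] : face y = face d /\ connect (adj G) (orig x) (orig y) by [].
  apply: (fconnect_ind (P := fun y => face y = face d /\ connect (adj G) (orig x) (orig y)) _ _ xy).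
    by [].
  move=> z [fz cz]; split; first by rewrite face_phi.
  have := orig_opp_phi z; have := bitF (phi z); rewrite face_phi => /(_ fz).
  case: (phi z) => e b /= -> /= oe; apply: connect_trans cz _.
  by rewrite -oe connect1 ?adj_edge.
have /negP[] := acyclicP (phi d).1.
have := step (phi d) d; rewrite fconnect_phi face_phi eqxx => /(_ isT erefl).
have := orig_opp_phi d; have := bitF (phi d); rewrite face_phi => /(_ erefl).
by case: (phi d) => e b /= -> <-.
Qed.

End PlaneGraph.

(* The rotation of the plane by 180 degrees followed by the reversal of all
   edges.  It exchanges the two darts of every edge. *)
Definition rotG n m p (G : embedded_digraph n m p) : embedded_digraph n m p :=
  EmbeddedDigraph (head G) (tail G) (fun d => opp (rot G (opp d)))
    (right_face G) (left_face G) (outer G) (snk G) (src G).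

Section Rotation.
Variables (n m p : nat) (G : embedded_digraph n m p).

Lemma orig_rotG d : orig (rotG G) d = orig G (opp d).
Proof. by case: d => e []. Qed.

Lemma face_rotG d : dart_face (rotG G) d = dart_face G (opp d).
Proof. by case: d => e []. Qed.

Lemma phi_rotG d : phi (rotG G) d = opp (phi G (opp d)).
Proof. by []. Qed.

Lemma connect_adj_rotG u v : connect (adj (rotG G)) u v = connect (adj G) v u.
Proof.
have /= <- := connect_rev (adj G) u v.
by apply: eq_connect => x y; apply: eq_existsb => e; rewrite andbC.
Qed.

Hypothesis plane : plane_st_graph G.

Lemma plane_rotG : plane_st_graph (rotG G).
Proof.
case: plane => -[h1 h2] h3 [h4 h5] [h6 h7 h8 h9 h10] [h11 h12].
split=> //.
- split; first by move=> e /esym/h1.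
  by move=> e e' [] t1 t2; apply: h2; rewrite t1 t2.
- by move=> e; rewrite connect_adj_rotG; apply: h3.
- split=> //.
  + by move=> x y /opp_inj/h6/opp_inj.
  + by move=> x y; rewrite !orig_rotG -h7 -fconnect_conj //; apply: oppK.
  + move=> x y; rewrite !face_rotG -h8 -fconnect_conj; last exact: oppK.
    by apply: eq_fconnect => z; rewrite -phi_rotG.
  + by move=> f; case: (h9 f) => [|[d fd]]; [left | right; exists (opp d); rewrite face_rotG oppK].
- split.
  + by case: h12 => [|[d [od fd]]]; [left | right; exists (opp d); rewrite face_rotG orig_rotG oppK].
  + by case: h11 => [|[d [od fd]]]; [left | right; exists (opp d); rewrite face_rotG orig_rotG oppK].
Qed.

End Rotation.

Section Corners.
Variables (n m p : nat) (G : embedded_digraph n m p).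
Hypothesis plane : plane_st_graph G.
Notation orig := (orig G).
Notation face := (dart_face G).
Notation rot := (rot G).
Notation phi := (phi G).
Implicit Types (d x y : dart m) (f g : 'I_p) (u v w : 'I_n).

Lemma connect_snk v : connect (adj G) v (snk G).
Proof. by rewrite -connect_adj_rotG; apply: (connect_src (plane_rotG plane)). Qed.

Lemma src_neq_snk : 0 < m -> src G != snk G.
Proof.
move=> m0; apply/eqP=> st; pose e := Ordinal m0.
have /negP[] := acyclicP plane e; apply: connect_trans (connect_snk _) _.
by rewrite -st; apply: connect_src.
Qed.

Lemma face_in_dart d : exists2 x, face x = face d & ~~ x.2.
Proof.
have [x] := face_out_dart (plane_rotG plane) (opp d).
by rewrite !face_rotG oppK => fx bx; exists (opp x); rewrite //= bx.
Qed.

(* A corner is named by the dart d such that it lies between d and rot d. *)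
Definition corners (b b' : bool) : {set dart m} := [set d | (d.2 == b) && ((rot d).2 == b')].

Lemma face_corner b : 0 < m -> [set: 'I_p] \subset face @: corners b b.
Proof.
move=> m0; apply/subsetP=> f _; have [d <-] := face_dart plane m0 f.
have [x fx bx] := face_out_dart plane d; have [y fy by_] := face_in_dart d.
pose z b := if b then x else y.
have [t] : exists t, [/\ fconnect phi (z b) t, t.2 == b & ~~ ((phi t).2 == b)].
  apply: (@fconnect_switch _ phi (fun t => t.2 == b) (z b) (z (~~ b))).
  - by rewrite fconnect_phi //; case: b; rewrite /= fx fy.
  - by case: b; rewrite /= ?bx ?(negbTE by_).
  - by case: b; rewrite /= ?bx ?(negbTE by_).
case=> zt tb ptb; apply/imsetP; exists t.
  by rewrite inE tb; move: ptb; rewrite bit_phi; case: (b); case: (rot t).2.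
by move: zt; rewrite fconnect_phi // => /eqP <-; case: (b); rewrite /= ?fx ?fy.
Qed.

Lemma vertex_corner b : [set~ src G] :\ snk G \subset orig @: corners b (~~ b).
Proof.
apply/subsetP=> v; rewrite !inE => /andP[vt vs].
have [e ev] := in_edge plane vs; have [e' ev'] := out_edge plane vt.
pose z b : dart m := if b then (e', true) else (e, false).
have oz c : orig (z c) = v by case: c.
have zb c : (z c).2 = c by case: c.
have [t] : exists t, [/\ fconnect rot (z b) t, t.2 == b & ~~ ((rot t).2 == b)].
  apply: (@fconnect_switch _ rot (fun t => t.2 == b) (z b) (z (~~ b))).
  - by rewrite fconnect_rot // !oz.
  - by rewrite zb.
  - by rewrite zb; case: (b).
case=> zt tb ptb; apply/imsetP; exists t.
  by rewrite inE tb; move: ptb; case: (b); case: (rot t).2.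
by move: zt; rewrite fconnect_rot // oz => /eqP.
Qed.

(* Euler's formula leaves no room for more corners than those of
   [face_corner] and [vertex_corner]. *)
Lemma corner_inj : [/\ forall b, {in corners b b &, injective face}
  & forall b, {in corners b (~~ b) &, injective orig}].
Proof.
case: (posnP m) => [m_0|m0].
  by split=> b [i c]; have := ltn_ord i; rewrite [X in _ < X]m_0.
have tot : \sum_(c : bool * bool) #|corners c.1 c.2| = m.*2.
  rewrite -card_dart -sum1_card (partition_big (fun d => (d.2, (rot d).2)) xpredT) //=.
  apply: eq_bigr => -[b b'] _; rewrite -sum1_card; apply: eq_bigl => d.
  by rewrite inE xpair_eqE.
have sum4 : #|corners true true| + #|corners true false| + #|corners false true| + #|corners false false| = m.*2.
  rewrite -tot -(pair_bigA _ (fun b b' => #|corners b b'|)) /= !big_bool /=; lia.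
have hf b : p <= #|face @: corners b b|.
  by rewrite -[p in p <= _]card_ord -cardsT subset_leq_card ?face_corner.
have hv b : n - 2 <= #|orig @: corners b (~~ b)|.
  apply: leq_trans (subset_leq_card (vertex_corner b)).
  have := cardsC1 (src G); rewrite (cardsD1 (snk G)) !inE eq_sym src_neq_snk // card_ord; lia.
have euler : n + p = m + 2 by case: plane => _ _ _ [].
have hf1 b : #|face @: corners b b| <= #|corners b b| by apply: leq_imset_card.
have hv1 b : #|orig @: corners b (~~ b)| <= #|corners b (~~ b)| by apply: leq_imset_card.
have n2 : 1 < n.
  by have := max_card [set src G; snk G]; rewrite cards2 src_neq_snk // card_ord.
have := (hf true, hf false, hv true, hv false, hf1 true, hf1 false, hv1 true, hv1 false).
case=> -[] [] [] [] [] [] a1 a2 a3 a4 a5 a6 a7 a8.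
have [e1 e2 e3 e4] : [/\ #|corners true true| <= p, #|corners false false| <= p,
  #|corners true (~~ true)| <= n - 2 & #|corners false (~~ false)| <= n - 2].
  move: a1 a2 a3 a4 a5 a6 a7 a8 sum4 euler n2 => /=.
  set x1 := #|corners _ _|; set x2 := #|corners _ _|; set x3 := #|corners _ _|.
  set x4 := #|corners _ _|; move: x1 x2 x3 x4 => x1 x2 x3 x4.
  by split; lia.
split=> b; apply/imset_injP; rewrite eqn_leq leq_imset_card /=; case: b.
- exact: leq_trans a1.
- exact: leq_trans a2.
- exact: leq_trans a3.
- exact: leq_trans a4.
Qed.

Lemma same_face_corner b x y : x.2 = b -> (rot x).2 = b -> y.2 = b -> (rot y).2 = b ->
  face x = face y -> x = y.
Proof.
move=> h1 h2 h3 h4; case: corner_inj => + _ => /(_ b); apply; by rewrite inE ?h1 ?h2 ?h3 ?h4 eqxx.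
Qed.

Lemma same_vertex_corner b x y : x.2 = b -> (rot x).2 = ~~ b -> y.2 = b -> (rot y).2 = ~~ b ->
  orig x = orig y -> x = y.
Proof.
move=> h1 h2 h3 h4; case: corner_inj => _ => /(_ b); apply; by rewrite inE ?h1 ?h2 ?h3 ?h4 !eqxx.
Qed.

End Corners.

Section Faces.
Variables (n m p : nat) (G : embedded_digraph n m p).
Hypothesis plane : plane_st_graph G.
Notation orig := (orig G).
Notation face := (dart_face G).
Notation rot := (rot G).
Notation phi := (phi G).
Implicit Types (d x y z : dart m) (f g : 'I_p) (u v w : 'I_n).

Lemma face_path_ind b a (P : dart m -> Prop) : a.2 = ~~ b -> (phi a).2 = b ->
  P (phi a) ->
  (forall z, face z = face a -> z.2 = b -> (phi z).2 = b -> P z -> P (phi z)) ->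
  forall x, face x = face a -> x.2 = b -> P x.
Proof.
move=> ab pab Pa step x /esym/eqP; rewrite -fconnect_phi //; rewrite (same_fconnect1 (phi_inj plane)) => ax.
suff [] : face x = face a /\ (x.2 = b -> P x) by [].
apply: (fconnect_ind (P := fun x => face x = face a /\ (x.2 = b -> P x)) _ _ ax).
  by split=> //; apply: face_phi.
move=> z [fz Pz]; split; first by rewrite face_phi.
move=> pzb; have [zb|zb] := eqVneq z.2 b; first exact: step (Pz zb).
suff -> : z = a by [].
have {}zb : z.2 = ~~ b by move: zb; case: (z.2) (b) => -[].
by apply: (same_face_corner plane (b := ~~ b)) => //; rewrite -[LHS]negbK -bit_phi ?pab ?pzb.
Qed.

Lemma corner_of_face b d : exists a, [/\ face a = face d, a.2 = b & (phi a).2 = ~~ b].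
Proof.
have m0 : 0 < m by case: d => -[i hi] _; apply: leq_ltn_trans hi.
have /subsetP/(_ (face d)) := face_corner plane b m0.
rewrite inE => /(_ isT)/imsetP[a]; rewrite inE => /andP[/eqP ab /eqP rab] ->.
by exists a; split=> //; rewrite bit_phi rab.
Qed.

Lemma outer_src d : face d = outer G -> d.2 -> (rot d).2 -> orig d = src G.
Proof.
move=> fd bd rbd; case: (plane) => _ _ _ _ [[m_0|[x [ox fx]]] _].
  by have := ltn_ord d.1; rewrite [X in _ < X]m_0.
suff -> : d = x by [].
apply: (same_face_corner plane (b := true)) => //; rewrite ?fd ?fx //.
  exact: in_dart_src ox.
by apply: in_dart_src plane _ _; rewrite orig_rot.
Qed.

Definition single d := [forall x, (face x == face d) && (x.2 == d.2) ==> (x == d)].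

Lemma singleP d : reflect (forall x, face x = face d -> x.2 = d.2 -> x = d) (single d).
Proof.
apply: (iffP forallP) => h x; last by apply/implyP=> /andP[/eqP fx /eqP bx]; apply/eqP/h.
by move=> fx bx; apply/eqP; have := h x; rewrite fx bx !eqxx.
Qed.

Lemma phi_neq d : phi d <> d.
Proof.
move=> pd; have [a [fa ab pab]] := corner_of_face (~~ d.2) d.
have : fconnect phi d a by rewrite fconnect_phi // fa.
suff: forall x, fconnect phi d x -> x = d.
  by move=> h /h ad; move: ab; rewrite ad; case: (d.2).
by move=> x dx; apply: (fconnect_ind (P := fun z => z = d) _ _ dx) => // z ->.
Qed.

Lemma single_bit d : single d -> (phi d).2 = ~~ d.2.
Proof.
move=> /singleP/(_ (phi d)); rewrite face_phi // => /(_ erefl) h.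
by case: (boolP ((phi d).2 == d.2)) => [/eqP/h/phi_neq//|]; case: (d.2); case: (phi d).2.
Qed.

Lemma single_phi d :
  single (phi d) = ((phi d).2 != d.2) && ((phi (phi d)).2 != (phi d).2).
Proof.
apply/idP/andP => [sd|[h1 h2]].
  split; last by rewrite single_bit //; case: (phi d).2.
  apply/eqP=> /esym bd; have := singleP _ sd d; rewrite face_phi // => /(_ erefl bd).
  by move/esym/phi_neq.
apply/singleP=> x; rewrite face_phi // => fx bx.
apply: (face_path_ind (P := fun x => x = phi d) (b := (phi d).2) (a := d)) fx bx => //.
  by move: h1; case: (phi d).2; case: (d.2).
by move=> z _ bz pbz zd; move: h2; rewrite -zd pbz zd eqxx.
Qed.

Lemma rot_fix_outer x : x.2 -> rot x = x -> face x = outer G.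
Proof.
move=> bx rx; have all_x z : orig x = orig z -> z = x.
  move/eqP; rewrite -fconnect_rot // => xz.
  by apply: (fconnect_ind (P := fun z => z = x) _ _ xz) => // t ->.
have xs : orig x = src G.
  apply/eqP; case: eqVneq => // /(in_edge plane)[e ev].
  by have := all_x (e, false) (esym ev) => xe; move: bx; rewrite -xe.
case: (plane) => _ _ _ _ [[m_0|[z [oz fz]]] _].
  by have := ltn_ord x.1; rewrite [X in _ < X]m_0.
by rewrite -fz (all_x z) // oz.
Qed.

(* A face bounded by two single edges would yield parallel edges. *)
Lemma no_digon d : single d -> single (phi d) -> face d = outer G.
Proof.
wlog: d / d.2.
  move=> wl; case: (boolP d.2) => [|bd]; first exact: wl.
  move=> sd spd; rewrite -face_phi //; apply: wl => //; first by rewrite single_bit.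
  suff -> : phi (phi d) = d by [].
  have := single_bit spd; rewrite (single_bit sd) negbK => bppd.
  by apply: (singleP _ sd); rewrite // !face_phi.
move=> bd sd spd; have bpd := single_bit sd; have bppd := single_bit spd.
have ppd : phi (phi d) = d.
  by apply: (singleP _ sd); rewrite ?face_phi // bppd bpd negbK.
have eq_e : d.1 = (phi d).1.
  have o1 := orig_opp_phi plane d; have o2 := orig_opp_phi plane (phi d); rewrite ppd in o2.
  rewrite bd in bpd; move: o1 o2 bd bpd.
  case: (phi d) => e [] //=; case: d {sd spd bppd ppd} => e' [] //=.
  by rewrite /opp /Defs.orig /= => t h _ _; apply: edge_inj plane _ _ _ _.
apply: rot_fix_outer => //; rewrite -opp_phi /opp -eq_e bpd negbK.
by case: (d).
Qed.

Definition has_single f := [exists y, (face y == f) && single y].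

Lemma single_alt d : face d <> outer G -> has_single (face d) -> (phi d).2 <> d.2 ->
  single (phi d) = ~~ single d.
Proof.
move=> fd /existsP[y /andP[/eqP fy sy]] bd.
have [sd|sd] := boolP (single d); first by apply/negP => spd; case: fd; apply: no_digon.
have byd : y.2 != d.2.
  apply/eqP => by_; case/negP: sd; suff <- : y = d by [].
  apply: (same_face_corner plane (b := d.2)) => //.
    by have := single_bit sy; rewrite bit_phi => /negb_inj ->.
  by move: bd; rewrite bit_phi; case: (d.2); case: (rot d).2.
suff -> : phi d = y by [].
apply: (singleP _ sy); first by rewrite face_phi.
by move: bd byd; case: (phi d).2 (d.2) (y.2) => -[] [].
Qed.

Lemma internal_face_card f : f <> outer G -> 0 < m -> 2 < #|[set d | face d == f]|.
Proof.
move=> fo m0; have [d fd] := face_dart plane m0 f.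
have [a [fa ab pab]] := corner_of_face true d; rewrite fd in fa.
have apa : [set a; phi a] \subset [set d | face d == f].
  by apply/subsetP=> x; rewrite !inE => /orP[] /eqP ->; rewrite ?face_phi // fa.
have c2 : #|[set a; phi a]| = 2.
  by rewrite cards2; case: eqP => // /esym/phi_neq.
rewrite ltnNge; apply/negP => le2; case: fo.
have /eqP eqf : [set a; phi a] == [set d | face d == f].
  by rewrite eqEcard apa c2 le2.
have inf x : face x = f -> x = a \/ x = phi a.
  move=> fx; have : x \in [set d | face d == f] by rewrite inE fx.
  by rewrite -eqf !inE => /orP[] /eqP; [left | right].
rewrite -fa; apply: no_digon; apply/singleP => x; rewrite ?face_phi // fa => /inf[] -> //.
  by rewrite pab ab.
by rewrite pab ab.
Qed.

Lemma edge_bound : m + 3 <= 3 * n.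
Proof.
have n0 : 0 < n by apply: leq_ltn_trans (ltn_ord (src G)).
case: (posnP m) => [->|m0]; first by lia.
have euler : n + p = m + 2 by case: plane => _ _ _ [].
have : \sum_(f < p) #|[set d | face d == f]| = m.*2.
  rewrite -card_dart -sum1_card (partition_big face xpredT) //=.
  by apply: eq_bigr => f _; rewrite -sum1_card; apply: eq_bigl => d; rewrite inE.
rewrite (bigD1 (outer G)) //=.
have : \sum_(i < p | i != outer G) 3 <= \sum_(i < p | i != outer G) #|[set d | face d == i]|.
  by apply: leq_sum => f /eqP fo; apply: internal_face_card.
rewrite sum_nat_const cardC1 card_ord; have := ltn_ord (outer G).
set S := \sum_(_ < _ | _) _; move: S => S; set o := #|_|; move: o => o; lia.
Qed.

Lemma face_bound : p <= 3 * n.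
Proof.
have euler : n + p = m + 2 by case: plane => _ _ _ [].
have n0 : 0 < n by apply: leq_ltn_trans (ltn_ord (src G)).
have := edge_bound; lia.
Qed.

Hypothesis faceP : forall f : 'I_p, f <> outer G -> generalized_triangle G f \/ rhombus G f.

Lemma card_face_bit b d :
  #|if b then right_path G (face d) else left_path G (face d)|
  = #|[set x | (face x == face d) && (x.2 == b)]|.
Proof.
rewrite -(card_imset (f := fun e => (e, b)) _); last by move=> e e' [].
apply: eq_card => -[e c]; rewrite inE /= andbC; apply/imsetP/andP => [[e' h [-> ->]]|[/eqP -> h]].
  by split=> //; case: b h; rewrite inE.
by exists e => //; case: b h; rewrite inE.
Qed.

Lemma rhombus_no_single d : face d <> outer G -> ~~ has_single (face d) -> rhombus G (face d).
Proof.
move=> fo ns; have nsd x : face x = face d -> ~~ single x.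
  move=> fx; apply/negP => sx; case/negP: ns; apply/existsP; exists x.
  by rewrite fx eqxx.
have [tri|//] := faceP fo.
have [b cb] : exists b, #|[set x | (face x == face d) && (x.2 == b)]| = 1.
  by case: tri => <-; [exists false | exists true]; rewrite -card_face_bit.
case/eqP/cards1P: cb => x ex.
have /andP[/eqP fx /eqP bx] : (face x == face d) && (x.2 == b).
  by have := set11 x; rewrite -ex inE.
suff sx : single x by have := nsd x fx; rewrite sx.
apply/singleP => y; rewrite fx bx => fy by_.
by apply/eqP; rewrite -(in_set1 y) -ex inE fy by_ !eqxx.
Qed.

Lemma rhombus_phi d : face d <> outer G -> ~~ has_single (face d) ->
  phi (phi (phi (phi d))) = d /\ (phi (phi d)).2 = ~~ d.2.
Proof.
move=> fo ns; have nsd x : face x = face d -> ~~ single x.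
  move=> fx; apply/negP => sx; case/negP: ns; apply/existsP; exists x.
  by rewrite fx eqxx.
have [cl cr] := rhombus_no_single fo ns.
have card2 b : #|[set x | (face x == face d) && (x.2 == b)]| = 2.
  by rewrite -card_face_bit; case: b.
have mem3 b x y z : face x = face d -> face y = face d -> face z = face d ->
    x.2 = b -> y.2 = b -> z.2 = b -> x <> y -> x <> z -> y <> z -> False.
  move=> fx fy fz bx by_ bz xy xz yz.
  have : [set x; y; z] \subset [set x | (face x == face d) && (x.2 == b)].
    apply/subsetP=> t; rewrite !inE => /orP[/orP[]|] /eqP ->;
    by rewrite ?fx ?fy ?fz ?bx ?by_ ?bz !eqxx.
  move/subset_leq_card; rewrite card2 -setUA cardsU1 cards2 !inE.
  by do 3 case: eqP => //.
have [a [fa ab pab]] := corner_of_face true d.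
have inj := @phi_inj _ _ _ _ plane.
have b2 : (phi (phi a)).2 = false.
  case h: (phi (phi a)).2 => //; have := nsd (phi a); rewrite face_phi // single_phi // pab ab h => /(_ fa).
  by [].
have b3 : (phi (phi (phi a))).2.
  case h: (phi (phi (phi a))).2 => //; exfalso.
  apply: (@mem3 false (phi a) (phi (phi a)) (phi (phi (phi a)))) => //; rewrite ?face_phi //.
  - by move/esym/phi_neq.
  - by move/inj => e; move: ab; rewrite {1}e b2.
  - by move/esym/phi_neq.
have b4 : (phi (phi (phi (phi a)))).2.
  case h: (phi (phi (phi (phi a)))).2 => //; have := nsd (phi (phi (phi a))); rewrite !face_phi // single_phi // b3 b2 h => /(_ fa).
  by [].
have pa : phi (phi (phi (phi a))) = a.
  apply/eqP; case: eqP => // h; exfalso.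
  apply: (@mem3 true a (phi (phi (phi a))) (phi (phi (phi (phi a))))) => //; rewrite ?face_phi //.
  - by move=> e; move: pab; rewrite e b4.
  - by move/esym.
  - by move/esym/phi_neq.
have : fconnect phi a d by rewrite fconnect_phi // fa.
suff h x : fconnect phi a x -> [\/ x = a, x = phi a, x = phi (phi a) | x = phi (phi (phi a))].
  by case/h => ->; rewrite ?pa ?ab ?b2 ?b3 ?pab.
move=> ax; apply: (fconnect_ind (P := fun x => [\/ x = a, x = phi a, x = phi (phi a) | x = phi (phi (phi a))]) _ _ ax).
  by constructor 1.
by move=> z [] ->; rewrite ?pa; [constructor 2 | constructor 3 | constructor 4 | constructor 1].
Qed.

Lemma rhombus_card f : rhombus G f -> #|[set x | face x == f]| = 4.
Proof.
move=> [cl cr]; have m0 : 0 < m.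
  rewrite lt0n; apply/eqP => m_0; have := max_card (left_path G f); rewrite cl card_ord.
  by rewrite [X in _ <= X]m_0.
have [d fd] := face_dart plane m0 f.
have -> : [set x | face x == f] = [set x | (face x == face d) && (x.2 == true)]
    :|: [set x | (face x == face d) && (x.2 == false)].
  by apply/setP=> x; rewrite !inE fd; case: (x.2); rewrite ?andbT ?andbF ?orbF.
rewrite cardsU -!card_face_bit fd cl cr (_ : _ :&: _ = set0) ?cards0 //.
by apply/setP=> x; rewrite !inE; case: (x.2); rewrite !andbF.
Qed.

End Faces.

Section Rot180.
Variables (n m p : nat) (G : embedded_digraph n m p).

Lemma single_rotG d : single (rotG G) d = single G (opp d).
Proof.
apply/singleP/singleP => h x; rewrite ?face_rotG => fx bx.
  rewrite -[x]oppK; congr opp; apply: h; first by rewrite !face_rotG oppK.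
  by rewrite /= bx /= negbK.
by apply: opp_inj; apply: h; rewrite /= ?bx.
Qed.

Lemma has_single_rotG f : has_single (rotG G) f = has_single G f.
Proof.
apply/existsP/existsP => -[y]; rewrite ?face_rotG ?single_rotG => h; exists (opp y) => //.
by rewrite face_rotG single_rotG oppK.
Qed.

Lemma faceP_rotG :
  (forall f : 'I_p, f <> outer G -> generalized_triangle G f \/ rhombus G f) ->
  forall f : 'I_p, f <> outer (rotG G) -> generalized_triangle (rotG G) f \/ rhombus (rotG G) f.
Proof.
by move=> h f /h [[]|[]]; [left; right | left; left | right; split].
Qed.

End Rot180.

(** * Homology of the sphere and the dual graph *)

Section Exactness.
Import GRing.Theory.
Variables (n m p : nat) (G : embedded_digraph n m p) (F : fieldType).
Hypothesis plane : plane_st_graph G.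
Notation orig := (orig G).
Notation face := (dart_face G).
Notation rot := (rot G).
Notation phi := (phi G).
Local Open Scope ring_scope.

Lemma sum_delta k (y : 'I_k -> F) a : \sum_i y i * (a == i)%:R = y a.
Proof.
rewrite (bigD1 a) //= eqxx mulr1 big1 ?addr0 // => i; rewrite eq_sym => /negbTE ->.
exact: mulr0.
Qed.

Lemma sum_edge_darts (c : dart m -> F) : \sum_d c d = \sum_e (c (e, true) + c (e, false)).
Proof.
rewrite (eq_bigr (fun d => c (d.1, d.2))); last by case.
by rewrite -(pair_bigA _ (fun e b => c (e, b))) /=; apply: eq_bigr => e _; rewrite big_bool.
Qed.

Definition vertex_bdry : 'M[F]_(n, m) :=
  \matrix_(v, e) ((head G e == v)%:R - (tail G e == v)%:R).
Definition face_bdry : 'M[F]_(m, p) :=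
  \matrix_(e, f) ((right_face G e == f)%:R - (left_face G e == f)%:R).

Lemma vertex_bdry_face_bdry : vertex_bdry *m face_bdry = 0.
Proof.
apply/matrixP=> v f; rewrite mxE [RHS]mxE.
transitivity (\sum_d (orig d == v)%:R * ((face d == f)%:R - (face (opp d) == f)%:R) : F).
  rewrite sum_edge_darts; apply: eq_bigr => e _; rewrite !mxE /=.
  rewrite /Defs.orig /dart_face /= mulrBl addrC; congr (_ + _).
  by rewrite -mulrN opprB.
rewrite (eq_bigr _ (fun d _ => mulrBr _ _ _)) sumrB.
rewrite [X in _ - X](reindex_inj (@rotation_inj _ _ _ _ plane)) /=.
rewrite -sumrB big1 // => d _; rewrite orig_rot // face_opp_rot //; exact: subrr.
Qed.

Lemma rank_bdry k l (A : 'M[F]_(k, l)) :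
  (forall y : 'rV_k, y *m A = 0 -> forall i j, y 0 i = y 0 j) -> (k <= (\rank A).+1)%N.
Proof.
move=> h; suff: (\rank (kermx A) <= 1)%N by rewrite mxrank_ker; lia.
apply: leq_trans (rank_leq_row (const_mx 1 : 'rV[F]_k)).
apply/mxrankS/row_subP=> i; have /h hi : row i (kermx A) *m A = 0.
  by rewrite -row_mul mulmx_ker row0.
have -> : row i (kermx A) = (row i (kermx A)) 0 i *: const_mx 1.
  by apply/rowP=> j; rewrite [RHS]mxE [const_mx _ _ _]mxE mulr1; apply: hi.
exact: scalemx_sub (submx_refl _).
Qed.

Lemma rank_vertex_bdry : (n <= (\rank vertex_bdry).+1)%N.
Proof.
apply: rank_bdry => y yA.
have yE e : y 0 (head G e) = y 0 (tail G e).
  move/matrixP/(_ 0 e): yA; rewrite !mxE.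
  under eq_bigr do rewrite mxE mulrBr.
  by rewrite sumrB !sum_delta => /eqP; rewrite subr_eq0 => /eqP.
suff h i : y 0 i = y 0 (src G) by move=> i j; rewrite !h.
apply: (connect_ind (P := fun i => y 0 i = y 0 (src G)) _ _ (connect_src plane i)) => //.
by move=> z t <- /existsP[e /andP[/eqP <- /eqP <-]].
Qed.

Lemma rank_face_bdry : (0 < m -> p <= (\rank face_bdry).+1)%N.
Proof.
move=> m0; rewrite -mxrank_tr; apply: rank_bdry => y yB.
have yE e : y 0 (right_face G e) = y 0 (left_face G e).
  move/matrixP/(_ 0 e): yB; rewrite !mxE.
  under eq_bigr do rewrite !mxE mulrBr.
  by rewrite sumrB !sum_delta => /eqP; rewrite subr_eq0 => /eqP.
have yopp d : y 0 (face (opp d)) = y 0 (face d) by case: d => e []; rewrite /dart_face /= yE.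
have yrot d d' : orig d = orig d' -> y 0 (face d) = y 0 (face d').
  move=> /eqP; rewrite -fconnect_rot // => dd'.
  apply: (fconnect_ind (P := fun z => y 0 (face d) = y 0 (face z)) _ _ dd') => // z ->.
  by rewrite -[in RHS]yopp face_opp_rot.
have [e es] : exists e, tail G e = src G by apply: (out_edge plane); apply: src_neq_snk.
suff h i : y 0 i = y 0 (face (e, true)) by move=> i j; rewrite !h.
have [d <-] := face_dart plane m0 i.
pose P v := forall d, orig d = v -> y 0 (face d) = y 0 (face (e, true)).
suff: P (orig d) by apply.
apply: (connect_ind (P := P) _ _ (connect_src plane _)).
  by move=> {}d ds; apply: yrot; rewrite ds.
move=> z t Pz /existsP[e' /andP[/eqP tz /eqP ht]] {}d dt.
by rewrite (yrot d (e', false)) ?dt // -yopp; apply: Pz.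
Qed.

Lemma face_bdry_exact (c : 'I_m -> F) :
  (forall f, \sum_e c e * ((right_face G e == f)%:R - (left_face G e == f)%:R) = 0) ->
  exists y : 'I_n -> F, forall e, c e = y (head G e) - y (tail G e).
Proof.
move=> cB; case: (posnP m) => [m_0|m0].
  by exists (fun=> 0) => e; have := ltn_ord e; rewrite [X in (_ < X)%N]m_0.
pose C : 'rV[F]_m := \row_e c e.
have CB : C *m face_bdry = 0.
  apply/rowP => f; rewrite !mxE -[RHS](cB f); apply: eq_bigr => e _; by rewrite !mxE.
have euler : (n + p = m + 2)%N by case: plane => _ _ _ [].
have sAB : (vertex_bdry <= kermx face_bdry)%MS by apply/sub_kermxP/vertex_bdry_face_bdry.
have sBA : (kermx face_bdry <= vertex_bdry)%MS.
  rewrite -(mxrank_leqif_sup sAB) eqn_leq mxrankS //= mxrank_ker.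
  have := rank_vertex_bdry; have := rank_face_bdry m0; have := rank_leq_row face_bdry; lia.
have /submxP[y Cy] : (C <= vertex_bdry)%MS.
  by apply: submx_trans sBA; apply/sub_kermxP.
exists (fun v => y 0 v) => e.
have -> : c e = C 0 e by rewrite mxE.
rewrite Cy mxE; under eq_bigr do rewrite mxE mulrBr.
by rewrite sumrB !sum_delta.
Qed.

End Exactness.

Section DualGraph.
Import Order.TTheory GRing.Theory Num.Theory.
Variables (n m p : nat) (G : embedded_digraph n m p).
Hypothesis plane : plane_st_graph G.
Notation orig := (orig G).
Notation face := (dart_face G).
Notation phi := (phi G).
Local Open Scope ring_scope.

Definition crossing (R : pred (dart m)) : rel 'I_p :=
  fun f g => [exists d, [&& R d, face d == f & face (opp d) == g]].

Lemma crossing_chain (F : fieldType) (R : pred (dart m)) f g :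
  connect (crossing R) f g ->
  exists2 k : dart m -> nat, (forall d, (0 < k d)%N -> R d) &
    forall h, \sum_e ((k (e, true))%:R - (k (e, false))%:R) *
      ((right_face G e == h)%:R - (left_face G e == h)%:R) = (g == h)%:R - (f == h)%:R :> F.
Proof.
pose bd k h : F := \sum_e ((k (e, true))%:R - (k (e, false))%:R) *
      ((right_face G e == h)%:R - (left_face G e == h)%:R).
have bdE k h : bd k h = \sum_d (k d)%:R * ((face (opp d) == h)%:R - (face d == h)%:R).
  rewrite sum_edge_darts; apply: eq_bigr => e _.
  by rewrite /dart_face /= mulrBl -mulrN opprB.
apply: (connect_ind (P := fun g => exists2 k : dart m -> nat, (forall d, (0 < k d)%N -> R d)
  & forall h, bd k h = (g == h)%:R - (f == h)%:R)).
  exists (fun=> 0%N) => // h; rewrite bdE subrr big1 // => d _; exact: mul0r.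
move=> z t [k kR kb] /existsP[d /and3P[Rd /eqP fd /eqP fod]].
exists (fun x => k x + (d == x)%N)%N.
  by move=> x; case: eqP => [<- //|_]; rewrite addn0; apply: kR.
move=> h; rewrite bdE; under eq_bigr do rewrite natrD mulrDl.
rewrite big_split /= -bdE kb (bigD1 d) //= eqxx mul1r big1 ?addr0; last first.
  by move=> x; rewrite eq_sym => /negbTE ->; exact: mul0r.
by rewrite fd fod addrC subrKA.
Qed.

Definition internal_right : pred (dart m) :=
  fun d => [&& d.2, face d != outer G & face (opp d) != outer G].

(* A directed cycle of the dual that avoids the outer face would be a positive
   gradient which vanishes along the boundary of the outer face, from the
   source to the sink. *)
Lemma dual_acyclic e : internal_right (e, true) ->
  ~~ connect (crossing internal_right) (right_face G e) (left_face G e).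
Proof.
move=> ie; apply/negP => /(crossing_chain rat)[k kR kb].
pose c e' := (k (e', true) + (e == e'))%N.
have k0 e' : k (e', false) = 0%N by move: (kR (e', false)); case: (k _) => // ? /(_ isT).
have [|y yE] := @face_bdry_exact _ _ _ _ rat plane (fun e' => (c e')%:R).
  move=> h; rewrite /c; under eq_bigr do rewrite natrD mulrDl.
  rewrite big_split /= (_ : \sum__ _ = (left_face G e == h)%:R - (right_face G e == h)%:R).
    rewrite (bigD1 e) //= eqxx mul1r big1 ?addr0; first by rewrite addrC subrKA subrr.
    by move=> x; rewrite eq_sym => /negbTE ->; exact: mul0r.
  by rewrite -kb; apply: eq_bigr => e' _; rewrite k0 subr0.
have mono u v : connect (adj G) u v -> y u <= y v.
  apply: (connect_ind (P := fun v => y u <= y v)) => // z t uz /existsP[e' /andP[/eqP tz /eqP ht]].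
  apply: le_trans uz _; rewrite -subr_ge0 -ht -tz -yE; exact: ler0n.
have outE d : face d = outer G -> y (orig (opp d)) = y (orig d).
  move=> fd; suff c0 : y (head G d.1) = y (tail G d.1).
    by case: d {fd} c0 => e' [] /= h; rewrite /Defs.orig /= h.
  apply/eqP; rewrite -subr_eq0 -yE pnatr_eq0 /c.
  have nR : ~~ internal_right (d.1, true).
    by rewrite /internal_right /=; case: d fd => e' [] /= ->; rewrite eqxx ?andbF.
  have -> : (e == d.1) = false by apply/eqP => ed; rewrite -ed ie in nR.
  by move: (kR (d.1, true)); case: (k _) => // k' /(_ isT) R'; rewrite R' in nR.
have outC d d' : face d = outer G -> face d' = outer G -> y (orig d) = y (orig d').
  move=> fd fd'; have : fconnect phi d d' by rewrite fconnect_phi // fd fd'.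
  move=> dd'; suff [] : face d' = outer G /\ y (orig d) = y (orig d') by [].
  apply: (fconnect_ind (P := fun d' => face d' = outer G /\ y (orig d) = y (orig d')) _ _ dd').
    by [].
  move=> z [fz yz]; rewrite face_phi //; split=> //.
  by rewrite yz -[in RHS]outE ?face_phi // opp_phi orig_rot.
have m0 : (0 < m)%N by apply: leq_ltn_trans (ltn_ord e).
case: plane => _ _ _ _ [[m_0|[d [os fs]]] [m_1|[d' [ot ft]]]];
  try by move: m0; rewrite ?m_0 ?m_1 ltnn.
have := outC d d' fs ft; rewrite os ot => yst.
have : y (tail G e) < y (head G e).
  by rewrite -subr_gt0 -yE ltr0n /c eqxx addn1.
have := mono _ _ (connect_src plane (tail G e)); rewrite yst => h1.
have := mono _ _ (connect_snk plane (head G e)) => h2.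
by rewrite ltNge (le_trans h2 h1).
Qed.

Definition face_rank f := #|[pred g | connect (crossing internal_right) g f]|.

Lemma face_rank_lt e : left_face G e <> outer G -> right_face G e <> outer G ->
  (face_rank (left_face G e) < face_rank (right_face G e))%N.
Proof.
move=> /eqP lo /eqP ro; have ie : internal_right (e, true) by rewrite /internal_right /= lo.
have lr : connect (crossing internal_right) (left_face G e) (right_face G e).
  by apply/connect1/existsP; exists (e, true); rewrite ie /dart_face /= !eqxx.
apply: proper_card; apply/properP; split.
  by apply/subsetP=> g; rewrite !inE => h; apply: connect_trans h lr.
by exists (right_face G e); rewrite !inE ?connect0 // dual_acyclic.
Qed.

Lemma face_rank_le f : (face_rank f <= p)%N.
Proof. by rewrite -[p in (_ <= p)%N]card_ord max_card. Qed.

Lemma F2_succ (x : 'F_2) : (x + 1 == 0) = ~~ (x == 0).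
Proof. by case: x => -[|[|x]] hx. Qed.

Lemma F2_even k : ~~ odd k -> k%:R = 0 :> 'F_2.
Proof. by move=> /even_halfK <-; rewrite -muln2 natrM (_ : 2%:R = 0) ?mulr0 //; apply/val_inj. Qed.

Lemma F2_opp (x : 'F_2) : - x = x.
Proof. by apply/eqP; rewrite -subr_eq0 -opprD oppr_eq0 -mulr2n -mulr_natr F2_even ?mulr0. Qed.

(* Edges around S count 1; the parity defect of every face outside S is moved
   to the outer face along a dual path that avoids S. *)
Lemma alternating_coloring (S : pred 'I_p) :
  (forall f, S f -> ~~ odd #|[set d | face d == f]|) -> ~~ S (outer G) ->
  (forall f, ~~ S f ->
     connect (crossing (fun d => ~~ S (face d) && ~~ S (face (opp d)))) f (outer G)) ->
  exists A : 'I_n -> bool, forall d, S (face d) -> A (head G d.1) = ~~ A (tail G d.1).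
Proof.
move=> Sev So Sc; set R := fun d => _ in Sc.
pose B e f : 'F_2 := (right_face G e == f)%:R - (left_face G e == f)%:R.
pose c0 e : 'F_2 := (S (left_face G e) || S (right_face G e))%:R.
pose dl f : 'F_2 := \sum_e c0 e * B e f.
have dlS f : S f -> dl f = 0.
  move=> Sf; rewrite -(F2_even (Sev f Sf)) -sum1_card big_mkcond /= natr_sum sum_edge_darts.
  apply: eq_bigr => e _; rewrite !inE /dart_face /= /B F2_opp /c0.
  rewrite [RHS]addrC; have [->|_] := eqVneq (right_face G e) f.
    by rewrite Sf orbT mul1r; case: eqP.
  by have [->|_] := eqVneq (left_face G e) f; rewrite ?Sf ?mul1r // addr0 mulr0.
have /fin_all_exists[c cP] f : exists c : 'I_m -> 'F_2, ~~ S f ->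
    (forall e, S (left_face G e) || S (right_face G e) -> c e = 0) /\
    forall h, \sum_e c e * B e h = (outer G == h)%:R - (f == h)%:R.
  have [Sf|Sf] := boolP (S f); first by exists (fun=> 0).
  have [k kR kb] := crossing_chain [the fieldType of 'F_2] (Sc f Sf).
  exists (fun e => (k (e, true))%:R - (k (e, false))%:R) => _; split=> // e he.
  have k0 b : k (e, b) = 0%N.
    move: (kR (e, b)); case: (k (e, b)) => [//|k'] /(_ isT); rewrite /R /dart_face.
    by case: b => /=; move: he; do 2 case: (S _).
  by rewrite !k0 subrr.
pose C e := c0 e + \sum_(f | ~~ S f) dl f * c f e.
have CB h : \sum_e C e * B e h = dl h + \sum_(f | ~~ S f) dl f * ((outer G == h)%:R - (f == h)%:R).
  rewrite /C; under eq_bigr do rewrite mulrDl mulr_suml.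
  rewrite big_split /= exchange_big /=; congr (_ + _); apply: eq_bigr => f Sf.
  by rewrite -(cP f Sf).2 mulr_sumr; apply: eq_bigr => e _; rewrite mulrA.
have CBi h : h != outer G -> \sum_e C e * B e h = 0.
  move=> ho; rewrite CB eq_sym (negbTE ho).
  have [Sh|Sh] := boolP (S h).
    rewrite dlS // add0r big1 // => f Sf; case: eqP => [fh|]; first by rewrite fh Sh in Sf.
    by rewrite subrr mulr0.
  rewrite (bigD1 h) //= eqxx sub0r mulrN mulr1 big1 ?addr0 ?subrr //.
  by move=> f /andP[_ /negbTE ->]; rewrite subrr mulr0.
have CB0 h : \sum_e C e * B e h = 0.
  have [->|/CBi//] := eqVneq h (outer G).
  have : \sum_h \sum_e C e * B e h = 0.
    rewrite exchange_big big1 // => e _; rewrite -mulr_sumr sumrB.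
    have d1 (a : 'I_p) : \sum_i (a == i)%:R = 1 :> 'F_2.
      by rewrite -[RHS](sum_delta (fun=> 1) a); apply: eq_bigr => i _; rewrite mul1r.
    by rewrite !d1 subrr mulr0.
  by rewrite (bigD1 (outer G)) //= [X in _ + X]big1 ?addr0.
have [y yE] := face_bdry_exact plane CB0.
exists (fun v => y v == 0) => d Sd.
have : C d.1 = 1.
  have Sd1 : S (left_face G d.1) || S (right_face G d.1).
    by case: d Sd => e []; rewrite /dart_face /= => ->; rewrite ?orbT.
  rewrite /C /c0 Sd1 big1 ?addr0 // => f Sf; rewrite (cP f Sf).1 //; exact: mulr0.
by rewrite yE => /eqP; rewrite subr_eq addrC => /eqP ->; rewrite F2_succ.
Qed.

End DualGraph.

(** * Markings and the spine *)

Section Markings.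
Variables (n m p : nat) (G : embedded_digraph n m p) (M : pred (dart m)).
Notation orig := (orig G).
Notation face := (dart_face G).
Notation phi := (phi G).

(* The dart d is marked when, after the insertion of the diagonals of the
   rhombi, d.1 is alone on its side of the face that contains d and lies in
   [face d]. *)
Definition face_marking : Prop :=
  [/\ forall d, face d = outer G -> ~~ M d,
      forall d, face d <> outer G -> ~~ has_single G (face d) -> M (phi d) = ~~ M d
    & forall d, face d <> outer G -> has_single G (face d) -> M d = single G d].

Definition valid_marking : Prop :=
  face_marking /\ forall d, M d -> ~~ M (opp d).

Definition diagonal_from (d : dart m) : bool :=
  ((phi d).2 == d.2) && M (if d.2 then d else phi d).

Definition spine_step : rel 'I_n := fun u v =>
  [exists e, [&& tail G e == u, head G e == v, ~~ M (e, true) & ~~ M (e, false)]]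
  || [exists d, [&& diagonal_from d, orig d == u & orig (phi (phi d)) == v]].

Definition spine_path u v : Prop := exists2 w, spine_step u w & connect spine_step w v.

Lemma spine_step1 u v : spine_step u v -> spine_path u v.
Proof. by move=> uv; exists v. Qed.

Lemma spine_path_trans u v w : spine_path u v -> spine_path v w -> spine_path u w.
Proof.
move=> [u' uu' u'v] [v' vv' v'w]; exists u' => //.
by apply: connect_trans u'v _; apply: connect_trans v'w; apply: connect1.
Qed.

Lemma spine_path_connect u v : spine_path u v -> connect spine_step u v.
Proof. by move=> [w /connect1]; apply: connect_trans. Qed.

End Markings.

Section FaceMarkings.
Variables (n m p : nat) (G : embedded_digraph n m p) (M : pred (dart m)).
Notation orig := (orig G).
Notation face := (dart_face G).
Notation phi := (phi G).
Hypothesis plane : plane_st_graph G.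
Hypothesis faceP : forall f : 'I_p, f <> outer G -> generalized_triangle G f \/ rhombus G f.
Hypothesis marking : face_marking G M.
Implicit Types (d x y z : dart m).

Lemma mark_internal d : M d -> face d <> outer G.
Proof. by case: marking => h _ _ Md /h; rewrite Md. Qed.

Lemma mark_corner d : face d <> outer G -> (phi d).2 <> d.2 -> M (phi d) = ~~ M d.
Proof.
case: marking => _ vr vt fd bd; case: (boolP (has_single G (face d))) => hs; last exact: vr.
by rewrite !vt ?face_phi //; apply: single_alt.
Qed.

Lemma mark_single d : M d -> has_single G (face d) -> single G d.
Proof. by case: marking => _ _ vt Md hs; rewrite -vt //; apply: mark_internal. Qed.

Lemma mark_flat d : (phi d).2 = d.2 -> M d || M (phi d) -> ~~ has_single G (face d).
Proof.
move=> bd /orP[] Md; apply/negP => hs.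
  by have := single_bit plane (mark_single Md hs); rewrite bd; case: (d.2).
have := @mark_single (phi d) Md; rewrite face_phi // => /(_ hs).
by rewrite single_phi // bd eqxx.
Qed.

Lemma mark_rhombus d : face d <> outer G -> ~~ has_single G (face d) ->
  [/\ phi (phi (phi (phi d))) = d, (phi (phi d)).2 = ~~ d.2,
      (phi (phi (phi d))).2 = ~~ (phi d).2,
      M (phi d) = ~~ M d & M (phi (phi d)) = M d /\ M (phi (phi (phi d))) = ~~ M d].
Proof.
move=> fd hs; have [p4 b2] := rhombus_phi plane faceP fd hs.
have [||_ b3] := @rhombus_phi _ _ _ _ plane faceP (phi d); rewrite ?face_phi //.
case: marking => _ vr _.
have vr' x : face x = face d -> M (phi x) = ~~ M x by move=> fx; apply: vr; rewrite fx.
by rewrite !vr' ?face_phi ?face_phi //; split=> //; rewrite !negbK.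
Qed.

Lemma opp_phi4 d : phi (phi (phi (phi d))) = d -> orig (phi (phi (phi d))) = orig (opp d).
Proof. by move=> e; rewrite -[in RHS]e orig_opp_phi. Qed.

Lemma single_pred d : single G d -> exists b, [/\ phi b = d, face b = face d & b.2 = ~~ d.2].
Proof.
move=> sd; have inj := phi_inj plane; exists (finv phi d).
have pb : phi (finv phi d) = d by apply: f_finv.
split=> //; first by rewrite -{2}pb face_phi.
by move: sd; rewrite -{1}pb single_phi // pb => /andP[]; case: (d.2); case: (_.2).
Qed.

Lemma mark_single_unique d x : M d -> M x -> has_single G (face d) -> face x = face d -> x = d.
Proof.
move=> Md Mx hs fx; have sd := mark_single Md hs.
have sx : single G x by apply: mark_single; rewrite ?fx.
have [b [pb fb bb]] := single_pred sd.
have [bx|bx] := eqVneq x.2 d.2; first exact: (singleP _ _ sd).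
have xb : b = x.
  by apply: (singleP _ _ sx); rewrite ?fb ?fx // bb; case: (x.2) (d.2) bx => -[].
by case: (mark_internal Mx); apply: no_digon plane _ _ _; rewrite -?xb ?pb // xb.
Qed.

(* Replace a marked edge by the other side of the face that marks it; this
   moves to the left, and the dual graph is acyclic. *)
Lemma unmarked_spine_path z : ~~ z.2 -> ~~ M z -> spine_path G M (orig (opp z)) (orig z).
Proof.
have [k] := ubnP (face_rank G (face (opp z))).
elim: k z => // k IHk z; rewrite ltnS => lek zb Mz.
have [Moz|Moz] := boolP (M (opp z)); last first.
  apply/spine_step1/orP; left; apply/existsP; exists z.1.
  by case: z zb Mz Moz {lek} => e [] //= _ -> ->; rewrite /Defs.orig /= !eqxx.
set d := opp z in lek Moz *; have db : d.2 by rewrite /d /= zb.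
have fd := mark_internal Moz.
have {}IH x : ~~ x.2 -> face x = face d -> ~~ M x -> spine_path G M (orig (opp x)) (orig x).
  move=> xb fx Mx; have [Mox|Mox] := boolP (M (opp x)).
    apply: IHk => //; apply: leq_trans lek; have fox := mark_internal Mox.
    rewrite -fx in fd *; case: x xb fd fox {fx Mx Mox} => e [] //= _ h1 h2.
    exact: (face_rank_lt plane h2 h1).
  apply/spine_step1/orP; left; apply/existsP; exists x.1.
  by case: x xb Mx Mox {fx} => e [] //= _ -> ->; rewrite /Defs.orig /= !eqxx.
have -> : z = opp d by rewrite oppK.
have [hs|hs] := boolP (has_single G (face d)).
  have [b [pb fb bb]] := single_pred (mark_single Moz hs).
  have Mf x : face x = face d -> ~~ x.2 -> ~~ M x.
    move=> fx xb; apply/negP => Mx; have xd := mark_single_unique Moz Mx hs fx.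
    by rewrite xd db in xb.
  have pdb : (phi d).2 = false by rewrite (single_bit plane (mark_single Moz hs)) db.
  have -> : orig (opp d) = orig b by rewrite -pb orig_opp_phi.
  have step x : face x = face d -> ~~ x.2 -> spine_path G M (orig (opp x)) (orig x).
    by move=> fx xb; apply: IH => //; apply: Mf.
  apply: (face_path_ind plane (b := false) (a := d) (P := fun x => spine_path G M (orig d) (orig x))) => //.
  - by rewrite -(orig_opp_phi plane d); apply: step; rewrite ?face_phi // pdb.
  - move=> x fx xb pxb dx; apply: spine_path_trans dx _.
    by rewrite -(orig_opp_phi plane x); apply: step; rewrite ?face_phi // pxb.
  - by rewrite bb db.
have [p4 b2 b3 M1 [M2 M3]] := mark_rhombus fd hs; rewrite Moz /= in M1 M2 M3.
rewrite db in b2; rewrite -(opp_phi4 p4).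
have [pdb|pdb] := boolP (phi d).2.
  apply: (@spine_path_trans _ _ _ _ _ _ (orig (phi (phi d)))).
    apply/spine_step1/orP; right; apply/existsP; exists d.
    by rewrite /diagonal_from pdb db Moz !eqxx.
  rewrite -(orig_opp_phi plane (phi (phi d))); by apply: IH; rewrite ?face_phi ?face_phi ?face_phi ?M3 ?b3 ?pdb.
apply: (@spine_path_trans _ _ _ _ _ _ (orig (phi d))).
  rewrite -(orig_opp_phi plane d); by apply: IH; rewrite ?face_phi ?M1.
apply/spine_step1/orP; right; apply/existsP; exists (phi d).
by rewrite /diagonal_from b2 (negbTE pdb) M2 !eqxx.
Qed.

End FaceMarkings.

Section MarkingRotation.
Variables (n m p : nat) (G : embedded_digraph n m p) (M : pred (dart m)).
Hypothesis plane : plane_st_graph G.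
Hypothesis faceP : forall f : 'I_p, f <> outer G -> generalized_triangle G f \/ rhombus G f.
Hypothesis marking : face_marking G M.

Lemma face_marking_rotG : face_marking (rotG G) (fun d => M (opp d)).
Proof.
case: marking => v1 v3 v4; split=> d; rewrite ?face_rotG ?single_rotG ?has_single_rotG.
- exact: v1.
- by move=> fd hs; rewrite phi_rotG oppK; apply: v3.
- exact: v4.
Qed.

Lemma spine_step_rotG u v :
  spine_step (rotG G) (fun d => M (opp d)) u v -> spine_step G M v u.
Proof.
case/orP=> [/existsP[e /and4P[/eqP te /eqP he m1 m2]]|/existsP[d' /and3P[]]].
  apply/orP; left; apply/existsP; exists e; move: te he m1 m2 => /= <- <-.
  by rewrite /opp /= => -> ->; rewrite !eqxx.
rewrite -[d']oppK; move: (opp d') => d; rewrite /diagonal_from !orig_rotG !phi_rotG !oppK.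
case/andP=> /eqP bd0 Md /eqP <- /eqP <-.
have bd : (phi G d).2 = d.2  by rewrite bit_phi bd0 /= negbK.
have {}Md : if d.2 then M (phi G d) else M d.
  by move: Md; rewrite /=; case: (d.2); rewrite /= ?oppK.
have hs : ~~ has_single G (dart_face G d).
  by apply: (mark_flat plane marking bd); move: Md; case: (d.2) => /= ->; rewrite ?orbT.
have fd : dart_face G d <> outer G.
  by move: Md; case: (d.2) => /= /(mark_internal marking); rewrite ?face_phi.
have [p4 b2 b3 M1 [M2 M3]] := mark_rhombus plane faceP marking fd hs.
apply/orP; right; apply/existsP; exists (phi G (phi G d)).
rewrite /diagonal_from p4 b3 bd b2 !eqxx /= andbT.
by move: Md; case: (d.2); rewrite /= ?M1 ?M2 ?M3.
Qed.

Lemma spine_path_rotG u v :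
  spine_path (rotG G) (fun d => M (opp d)) u v -> spine_path G M v u.
Proof.
move=> [w uw wv]; apply: (connect_ind (P := fun v => spine_path G M v u)) wv => [|z t zu zt].
  exact/spine_step1/spine_step_rotG.
by apply: spine_path_trans zu; apply/spine_step1/spine_step_rotG.
Qed.

End MarkingRotation.

Section SpineOrder.
Variables (n m p : nat) (G : embedded_digraph n m p) (M : pred (dart m)).
Hypothesis plane : plane_st_graph G.
Hypothesis faceP : forall f : 'I_p, f <> outer G -> generalized_triangle G f \/ rhombus G f.
Hypothesis valid : valid_marking G M.

Lemma edge_spine_path e : spine_path G M (tail G e) (head G e).
Proof.
have [Me|Me] := boolP (M (e, false)); last exact: (unmarked_spine_path plane faceP valid.1 (z := (e, false))).
apply: (spine_path_rotG plane faceP valid.1).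
apply: (unmarked_spine_path (plane_rotG plane) (faceP_rotG faceP) (face_marking_rotG valid.1) (z := (e, false))) => //.
by rewrite /opp /=; apply: (valid.2 _ Me).
Qed.

End SpineOrder.

Lemma fconnect_unbroken (T : finType) (f : T -> T) (P : pred T) x y :
  injective f -> fconnect f x y ->
  (forall z t, fconnect f x z -> fconnect f x t -> P z -> P t -> z = t) ->
  let r := [rel a b | (f a == b) && ~~ P a] in connect r x y \/ connect r y x.
Proof.
move=> inj xy uniqP r.
case: (boolP [exists b, fconnect f x b && P b]) => [/existsP[b /andP[xb Pb]]|/existsPn nP].
  pose z := f b.
  have zx t : fconnect f x t -> fconnect f z t.
    move=> xt; rewrite -same_fconnect1 //; apply: connect_trans xt.
    by rewrite fconnect_sym.
  have run i k : i + k < fingraph.order f z -> connect r (iter i f z) (iter (i + k) f z).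
    elim: k => [|k IHk]; first by rewrite addn0 connect0.
    rewrite addnS => lt; apply: connect_trans (IHk (ltnW lt)) (connect1 _).
    rewrite /= eqxx /=; apply/negP => Pk.
    have kb : iter (i + k) f z = b.
      apply: uniqP => //; apply: connect_trans xb _.
      by apply: connect_trans (fconnect1 _ _) (fconnect_iter _ _ _).
    have := findex_iter lt; rewrite iterS kb findex0; lia.
  have hx := zx x (connect0 _ _); have hy := zx y xy.
  have mx := findex_max hx; have my := findex_max hy.
  have ex := iter_findex hx; have ey := iter_findex hy.
  case: (leqP (findex f z x) (findex f z y)) => [/subnKC e|/ltnW/subnKC e].
    by left; have := @run (findex f z x) (findex f z y - findex f z x); rewrite e ex ey; apply.
  by right; have := @run (findex f z y) (findex f z x - findex f z y); rewrite e ex ey; apply.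
left; suff [] : fconnect f x y /\ connect r x y by [].
apply: (fconnect_ind (P := fun y => fconnect f x y /\ connect r x y) _ _ xy) => // z [xz rz].
split; first exact: connect_trans xz (fconnect1 _ _).
apply: connect_trans rz (connect1 _); rewrite /= eqxx /=.
by have := nP z; rewrite xz.
Qed.

Section OutRuns.
Variables (n m p : nat) (G : embedded_digraph n m p).
Notation orig := (orig G).
Notation face := (dart_face G).
Notation rot := (rot G).
Notation phi := (phi G).
Hypothesis plane : plane_st_graph G.
Implicit Types (d x y z : dart m).

(* The outgoing darts of a vertex from right to left end with a dart [d] such
   that [out_end d]. *)
Definition out_end d := d.2 && (~~ (rot d).2 || (face d == outer G)).

Definition out_run : rel (dart m) := [rel x y | (rot x == y) && ~~ out_end x].

Lemma out_end_unique x y : out_end x -> out_end y -> orig x = orig y -> x = y.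
Proof.
move=> /andP[xb ex] /andP[yb ey] oxy.
have srcP z t : orig z = orig t -> z.2 -> (rot z).2 -> face z = outer G -> (rot t).2.
  move=> zt zb rzb fz; apply: in_dart_src plane _ _.
  by rewrite orig_rot // -zt; apply: outer_src.
have [rx|rx] := boolP (rot x).2; last first.
  have [ry|ry] := boolP (rot y).2; last first.
    by apply: (same_vertex_corner plane (b := true)) => //; apply/negbTE.
  by move: ey rx; rewrite ry /= => /eqP /(srcP y x (esym oxy) yb ry) ->.
move: ex; rewrite rx /= => /eqP fx; have ry := srcP x y oxy xb rx fx.
by move: ey; rewrite ry /= => /eqP fy; apply: (same_face_corner plane (b := true)); rewrite ?fx.
Qed.

Lemma out_run_total x y : orig x = orig y -> connect out_run x y \/ connect out_run y x.
Proof.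
move=> oxy; apply: fconnect_unbroken; first exact: (rotation_inj plane).
  by rewrite fconnect_rot // oxy.
move=> z t; rewrite !fconnect_rot // => /eqP oz /eqP ot ez et.
by apply: out_end_unique; rewrite // -oz -ot.
Qed.

Lemma out_run_ind (P : dart m -> Prop) x y : x.2 -> P x ->
  (forall z, orig z = orig x -> z.2 -> (rot z).2 -> face z <> outer G -> P z -> P (rot z)) ->
  connect out_run x y -> [/\ y.2, orig y = orig x & P y].
Proof.
move=> xb Px step; apply: (connect_ind (P := fun y => [/\ y.2, orig y = orig x & P y])) => //.
move=> z t [zb oz Pz] /andP[/eqP <-]; rewrite /out_end zb negb_or negbK /= => /andP[rzb /eqP fz].
by split=> //; [rewrite orig_rot | apply: step].
Qed.

Lemma out_run_end x y : out_end x -> connect out_run x y -> y = x.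
Proof.
move=> ex; apply: (connect_ind (P := fun y => y = x)) => // z t ->.
by rewrite /out_run /= ex andbF.
Qed.

Lemma out_run_start b x : ~~ b.2 \/ out_end b -> x.2 -> connect out_run x (rot b) -> rot b = x.
Proof.
move=> sb xb.
suff: forall y, connect out_run x y -> y.2 /\ (y = rot b -> y = x).
  by move=> h /h [_]; apply.
move=> y; apply: (connect_ind (P := fun y => y.2 /\ (y = rot b -> y = x))) => //.
move=> z t [zb _] /andP[/eqP <- ez]; split.
  by move: ez; rewrite /out_end zb negb_or negbK /= => /andP[].
by move=> /(rotation_inj plane) zb'; move: sb; rewrite -zb' zb (negbTE ez) => -[].
Qed.

End OutRuns.

Section SpinePermutation.
Variables (n m p : nat) (G : embedded_digraph n m p) (M : pred (dart m)).
Notation orig := (orig G).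
Notation face := (dart_face G).
Notation rot := (rot G).
Notation phi := (phi G).
Hypothesis plane : plane_st_graph G.
Hypothesis faceP : forall f : 'I_p, f <> outer G -> generalized_triangle G f \/ rhombus G f.
Hypothesis valid : valid_marking G M.
Implicit Types (d x y z : dart m).

Lemma mark_rot z : z.2 -> (rot z).2 -> face z <> outer G -> M (opp (rot z)) = ~~ M z.
Proof. by move=> zb rzb fz; apply: (mark_corner plane valid.1 fz); rewrite bit_phi zb rzb. Qed.

Lemma unmarked_left x y : x.2 -> ~~ M x -> connect (out_run G) x y ->
  ~~ M y /\ (y = x \/ M (opp y)).
Proof.
move=> xb Mx xy.
suff [_ _ h] : [/\ y.2, orig y = orig x & ~~ M y /\ (y = x \/ M (opp y))] by [].
apply: (out_run_ind plane (P := fun y => ~~ M y /\ (y = x \/ M (opp y))) _ _ _ xy) => //.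
  by split=> //; left.
move=> z oz zb rzb fz [Mz _]; have Mr : M (opp (rot z)) by rewrite mark_rot.
by split; [have := valid.2 _ Mr; rewrite oppK | right].
Qed.

Variant spine_step_spec u v : Prop :=
  | StepEdge x of x.2 & ~~ M x & ~~ M (opp x) & orig x = u & orig (opp x) = v
  | StepLeft d of d.2 & ~~ (rot d).2 & M d & orig d = u & orig (phi (phi d)) = v
  | StepRight d of ~~ d.2 & (rot d).2 & M (phi d) & orig d = u & orig (phi (phi d)) = v.

Lemma spine_stepP u v : spine_step G M u v -> spine_step_spec u v.
Proof.
case/orP=> [/existsP[e /and4P[/eqP te /eqP he m1 m2]]|/existsP[d /and3P[/andP[bd Md] /eqP od /eqP pd]]].
  exact: (@StepEdge _ _ (e, true)).
move: bd Md; rewrite bit_phi; case db: (d.2) => /= rb Md.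
  by apply: (@StepLeft _ _ d); rewrite ?db //; case: (rot d).2 rb.
by apply: (@StepRight _ _ d); rewrite ?db //; case: (rot d).2 rb.
Qed.

Lemma spine_step_functional u v v' : spine_step G M u v -> spine_step G M u v' -> v = v'.
Proof.
have edge_left x d : x.2 -> ~~ M x -> orig x = orig d -> d.2 -> ~~ (rot d).2 -> M d -> False.
  move=> xb Mx ox db rdb Md; have ed : out_end G d by rewrite /out_end db rdb.
  have [xd|dx] := out_run_total plane ox.
    by have [] := unmarked_left xb Mx xd; rewrite Md.
  by move: Mx; rewrite (out_run_end ed dx) Md.
have right_edge x d : x.2 -> ~~ M (opp x) -> orig x = orig d -> ~~ d.2 -> (rot d).2 -> M (phi d) -> False.
  move=> xb Mox ox db rdb Mpd; have Mr : ~~ M (rot d) by rewrite -opp_phi; apply: valid.2.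
  have [|dx|xd] := @out_run_total _ _ _ _ plane (rot d) x; first by rewrite orig_rot.
    have [_ [xd|]] := unmarked_left rdb Mr dx; last by rewrite (negbTE Mox).
    by move: Mox; rewrite xd Mpd.
  have xd' := out_run_start plane (or_introl db) xb xd.
  by move: Mox; rewrite -xd' Mpd.
have right_left d d' : ~~ d.2 -> (rot d).2 -> M (phi d) -> d'.2 -> ~~ (rot d').2 -> M d' ->
    orig d = orig d' -> False.
  move=> db rdb Mpd db' rdb' Md' od; apply: (edge_left (rot d) d') => //; last by rewrite orig_rot.
  by rewrite -opp_phi; apply: valid.2.
move=> /spine_stepP[] x; [move=> xb Mx Mox ox px | move=> xb rb Mx ox px | move=> xb rb Mx ox px];
move=> /spine_stepP[] y;
  [ move=> yb My Moy oy py | move=> yb ryb My oy py | move=> yb ryb My oy py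
  | move=> yb My Moy oy py | move=> yb ryb My oy py | move=> yb ryb My oy py
  | move=> yb My Moy oy py | move=> yb ryb My oy py | move=> yb ryb My oy py].
- suff -> : v = v' by [].
  rewrite -px -py; congr (orig (opp _)).
  have [|xy|yx] := @out_run_total _ _ _ _ plane x y; first by rewrite ox oy.
    by have [_ [//|]] := unmarked_left xb Mx xy; rewrite (negbTE Moy).
  by have [_ [//|]] := unmarked_left yb My yx; rewrite (negbTE Mox).
- by case: (edge_left x y); rewrite // ox oy.
- by case: (right_edge x y); rewrite // ox oy.
- by case: (edge_left y x); rewrite // ox oy.
- rewrite -px -py; congr (orig (phi (phi _))).
  by apply: (out_end_unique plane); rewrite ?ox ?oy // /out_end ?xb ?yb ?rb ?ryb.
- by case: (right_left y x); rewrite // ox oy.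
- by case: (right_edge y x); rewrite // ox oy.
- by case: (right_left x y); rewrite // ox oy.
- rewrite -px -py; congr (orig (phi (phi _))).
  apply: (same_vertex_corner plane (b := false)) => //; try exact/negbTE.
  by rewrite ox oy.
Qed.

Lemma spine_step_snk v : spine_step G M (snk G) v -> False.
Proof.
case/spine_stepP=> x => [xb _ _ ox _|xb _ _ ox _|xb rb _ ox _].
- by have := out_dart_snk plane ox; rewrite xb.
- by have := out_dart_snk plane ox; rewrite xb.
- by have := @out_dart_snk _ _ _ _ plane (rot x); rewrite orig_rot // rb => /(_ ox).
Qed.

Lemma connect_spine_step v : connect (spine_step G M) (src G) v.
Proof.
apply: connect_sub (connect_src plane v) => u w /existsP[e /andP[/eqP <- /eqP <-]].
exact/spine_path_connect/edge_spine_path.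
Qed.

Lemma spine_permutation : exists pi : {perm 'I_n},
  pi (src G) = 0 :> nat /\ forall u v, spine_step G M u v -> pi v = (pi u).+1 :> nat.
Proof.
pose nx u := odflt u [pick w | spine_step G M u w].
have nxE u v : spine_step G M u v -> nx u = v.
  move=> uv; rewrite /nx; case: pickP => [w uw|/(_ v)]; last by rewrite uv.
  exact: spine_step_functional uw uv.
have all_nx v : fconnect nx (src G) v.
  apply: connect_sub (connect_spine_step v) => u w /nxE <-; exact: fconnect1.
have ord_n : fingraph.order nx (src G) = n.
  by rewrite /fingraph.order -[RHS]card_ord; apply: eq_card => v; rewrite !inE all_nx.
have lt_n v : findex nx (src G) v < n by rewrite -[X in _ < X]ord_n findex_max.
have inj : injective (fun v => Ordinal (lt_n v)).
  by move=> u v /(congr1 val) /= uv; rewrite -(iter_findex (all_nx u)) uv iter_findex.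
exists (perm inj); split=> [|u v uv]; first by rewrite permE /= findex0.
rewrite !permE /= -(nxE _ _ uv) -[in LHS](iter_findex (all_nx u)) -iterS.
apply: findex_iter; rewrite ord_n ltn_neqAle lt_n andbT; apply/eqP => un.
have fix_t : nx (snk G) = snk G.
  by rewrite /nx; case: pickP => // w /spine_step_snk.
have tn : (findex nx (src G) (snk G)).+1 = n.
  apply/eqP; rewrite eqn_leq lt_n /= leqNgt; apply/negP => lt.
  have := @findex_iter _ nx (src G) (findex nx (src G) (snk G)).+1; rewrite ord_n => /(_ lt).
  rewrite iterS iter_findex // fix_t; lia.
have : u = snk G.
  by rewrite -(iter_findex (all_nx u)) -(iter_findex (all_nx (snk G))); congr iter; lia.
by move=> us; apply: (@spine_step_snk v); rewrite -us.
Qed.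

End SpinePermutation.

Section Positions.
Variables (n m p : nat) (G : embedded_digraph n m p) (M : pred (dart m)).
Variable pi : 'I_n -> 'I_n.
Notation orig := (orig G).
Notation face := (dart_face G).
Notation rot := (rot G).
Notation phi := (phi G).
Hypothesis plane : plane_st_graph G.
Hypothesis faceP : forall f : 'I_p, f <> outer G -> generalized_triangle G f \/ rhombus G f.
Hypothesis marking : face_marking G M.
Hypothesis pi_inj : injective pi.
Hypothesis pi_edge : forall e, pi (tail G e) < pi (head G e).
Hypothesis pi_diagonal : forall d, diagonal_from G M d -> pi (orig d) < pi (orig (phi (phi d))).
Implicit Types (d x y z : dart m).

Lemma pi_dart d : d.2 -> pi (orig d) < pi (orig (opp d)).
Proof. by case: d => e [] // _; apply: pi_edge. Qed.

Lemma pi_phi d : ~~ (phi d).2 -> pi (orig d) < pi (orig (phi d)).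
Proof.
rewrite -(orig_opp_phi plane d); case: (phi d) => e [] // _; exact: pi_edge.
Qed.

Lemma corner_heads_neq d : d.2 -> (rot d).2 -> face d <> outer G -> orig (phi d) <> orig (opp d).
Proof.
move=> db rdb fd eo; apply: fd; apply: rot_fix_outer => //.
have eo2 := orig_rot plane d.
have: (rot d).1 = d.1.
  move: db rdb eo eo2; rewrite /phi; case: (rot d) => e [] //; case: (d) => e' [] // _ _.
  by rewrite /Defs.orig /= => *; apply: (edge_inj plane).
by move: db rdb; case: (rot d) => e []; case: (d) => e' [] //= _ _ ->.
Qed.

(* If the right edge of a source corner is marked from its left face, then
   that face has a longer left path, which starts with the left edge. *)
Lemma source_corner_left d : d.2 -> (rot d).2 -> M d -> pi (orig (phi d)) < pi (orig (opp d)).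
Proof.
move=> db rdb Md; have fd := mark_internal marking Md.
have pdb : (phi d).2 = false by rewrite bit_phi rdb.
have [hs|hs] := boolP (has_single G (face d)).
  rewrite ltn_neqAle; apply/andP; split.
    by apply/eqP => /val_inj/pi_inj; apply: corner_heads_neq.
  have [b [pb fb bb]] := single_pred plane (mark_single marking Md hs).
  have -> : orig (opp d) = orig b by rewrite -pb orig_opp_phi.
  apply: (face_path_ind plane (b := false) (a := d) (P := fun x => pi (orig (phi d)) <= pi (orig x))) => //.
    move=> x fx xb pxb le; apply: leq_trans le (ltnW _).
    by apply: pi_phi; rewrite pxb.
  by rewrite bb db.
have [p4 b2 b3 M1 [M2 M3]] := mark_rhombus plane faceP marking fd hs.
rewrite -(opp_phi4 plane p4); apply: pi_diagonal.
by rewrite /diagonal_from b2 pdb db M2 Md.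
Qed.

Lemma source_corner_right d : d.2 -> (rot d).2 -> M (phi d) -> pi (orig (opp d)) < pi (orig (phi d)).
Proof.
move=> db rdb Md; have := mark_internal marking Md; rewrite face_phi // => fd.
have pdb : (phi d).2 = false by rewrite bit_phi rdb.
have [hs|hs] := boolP (has_single G (face d)).
  rewrite ltn_neqAle; apply/andP; split.
    by apply/eqP => /val_inj/pi_inj/esym; apply: corner_heads_neq.
  have sd : single G (phi d) by apply: (mark_single marking); rewrite ?face_phi.
  have ppb := single_bit plane sd; rewrite pdb /= in ppb.
  apply: (face_path_ind plane (b := true) (a := phi d) (P := fun x => pi (orig (opp x)) <= pi (orig (phi d)))) => //.
  - by rewrite orig_opp_phi.
  - move=> x fx xb pxb le; apply: leq_trans le; rewrite orig_opp_phi //.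
    exact/ltnW/pi_dart.
  - by rewrite face_phi.
have [p4 b2 b3 M1 [M2 M3]] := mark_rhombus plane faceP marking fd hs.
have := pi_diagonal (d := phi (phi (phi d))); rewrite p4 opp_phi4 //; apply.
by rewrite /diagonal_from p4 b3 pdb db M3 -M1 Md.
Qed.

End Positions.

Section RotatedPositions.
Variables (n m p : nat) (G : embedded_digraph n m p) (M : pred (dart m)).
Variable pi : 'I_n -> 'I_n.
Notation orig := (orig G).
Notation face := (dart_face G).
Notation rot := (rot G).
Notation phi := (phi G).
Hypothesis plane : plane_st_graph G.
Hypothesis faceP : forall f : 'I_p, f <> outer G -> generalized_triangle G f \/ rhombus G f.
Hypothesis valid : valid_marking G M.
Hypothesis pi_inj : injective pi.
Hypothesis pi_edge : forall e, pi (tail G e) < pi (head G e).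
Hypothesis pi_step : forall u v, spine_step G M u v -> pi v = (pi u).+1 :> nat.
Implicit Types (d x y z : dart m).

Definition pi_rot v := rev_ord (pi v).

Lemma pi_rot_inj : injective pi_rot. Proof. by move=> u v /rev_ord_inj/pi_inj. Qed.

Lemma pi_rot_lt u v : (pi_rot u < pi_rot v) = (pi v < pi u).
Proof. by rewrite /pi_rot /=; have := ltn_ord (pi u); have := ltn_ord (pi v); lia. Qed.

Lemma pi_rot_le u v : (pi_rot u <= pi_rot v) = (pi v <= pi u).
Proof. by rewrite leqNgt pi_rot_lt -leqNgt. Qed.

Lemma pi_rot_edge e : pi_rot (tail (rotG G) e) < pi_rot (head (rotG G) e).
Proof. by rewrite pi_rot_lt; apply: pi_edge. Qed.

Lemma valid_marking_rotG : valid_marking (rotG G) (fun d => M (opp d)).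
Proof. by split=> [|d]; [apply/face_marking_rotG/valid.1 | apply: valid.2]. Qed.

Lemma pi_rot_step u v : spine_step (rotG G) (fun d => M (opp d)) u v -> pi_rot v = (pi_rot u).+1 :> nat.
Proof.
move/(spine_step_rotG plane faceP valid.1)/pi_step.
by rewrite /pi_rot /=; have := ltn_ord (pi u); lia.
Qed.

Lemma step_diagonal d : diagonal_from G M d -> pi (orig d) < pi (orig (phi (phi d))).
Proof.
move=> dd; suff /pi_step -> : spine_step G M (orig d) (orig (phi (phi d))) by [].
by apply/orP; right; apply/existsP; exists d; rewrite dd !eqxx.
Qed.

End RotatedPositions.

Section Nesting.
Variables (n m p : nat) (G : embedded_digraph n m p) (M : pred (dart m)).
Variable pi : 'I_n -> 'I_n.
Notation orig := (orig G).
Notation face := (dart_face G).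
Notation rot := (rot G).
Notation phi := (phi G).
Hypothesis plane : plane_st_graph G.
Hypothesis faceP : forall f : 'I_p, f <> outer G -> generalized_triangle G f \/ rhombus G f.
Hypothesis valid : valid_marking G M.
Hypothesis pi_inj : injective pi.
Hypothesis pi_edge : forall e, pi (tail G e) < pi (head G e).
Hypothesis pi_step : forall u v, spine_step G M u v -> pi v = (pi u).+1 :> nat.
Implicit Types (b d x y z : dart m).

Lemma sink_max b x : ~~ b.2 -> ~~ (rot b).2 -> face x = face b -> ~~ x.2 ->
  pi (orig x) <= pi (orig b).
Proof.
move=> bb rbb fx xb; pose P z := (face z == face b) && ~~ z.2.
have Pb : P b by rewrite /P eqxx.
case: (@arg_maxnP _ b P (fun z => pi (orig z)) Pb) => z /andP[/eqP fz zb] zmax.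
apply: leq_trans (zmax x _) _; first by rewrite /P fx eqxx.
have [rzb|rzb] := boolP (rot z).2.
  have := zmax (phi z); rewrite /P face_phi // fz eqxx bit_phi rzb => /(_ isT).
  have := @pi_phi _ _ _ _ pi plane pi_edge z; rewrite bit_phi rzb => /(_ isT) /=; lia.
suff -> : z = b by [].
by apply: (same_face_corner plane (b := false)) => //; apply/negbTE.
Qed.

Lemma out_heads_le z y : ~~ z.2 -> (rot z).2 -> y.2 -> orig y = orig z -> M y ->
  M (rot z) /\ pi (orig (opp y)) <= pi (orig (phi z)).
Proof.
move=> zb rzb yb oyz My.
have [|zy|yz] := @out_run_total _ _ _ _ plane (rot z) y; first by rewrite orig_rot.
  suff [_ _ h] : [/\ y.2, orig y = orig (rot z) &
      M y -> M (rot z) /\ pi (orig (opp y)) <= pi (orig (phi z))] by apply: h.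
  apply: (out_run_ind plane (P := fun y =>
      M y -> M (rot z) /\ pi (orig (opp y)) <= pi (orig (phi z))) _ _ _ zy) => //.
  move=> t ot tb rtb ft IHt Mr.
  have Mt : M t.
    have := mark_rot plane valid tb rtb ft; case: (M t) => //= /valid.2.
    by rewrite oppK Mr.
  have [Mz le] := IHt Mt; split=> //; apply: leq_trans le; apply: ltnW.
  by apply: (source_corner_left plane faceP valid.1 pi_inj pi_edge (step_diagonal pi_step)).
have e := out_run_start plane (or_introl zb) yb yz.
by rewrite e; split=> //; rewrite -e.
Qed.

Lemma left_marked_nested d y : d.2 -> M d -> y.2 -> M y ->
  pi (orig d) < pi (orig y) < pi (orig (opp d)) -> pi (orig (opp y)) <= pi (orig (opp d)).
Proof.
have [k] := ubnP (face_rank G (face d)).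
elim: k d => // k IHk d; rewrite ltnS => lek db Md yb My /andP[dy yd].
have fd := mark_internal valid.1 Md.
have inside x : ~~ x.2 -> face x = face d -> ~~ M x ->
    pi (orig (opp x)) < pi (orig y) < pi (orig x) -> pi (orig x) <= pi (orig (opp d)) ->
    pi (orig (opp y)) <= pi (orig (opp d)).
  move=> xb fx Mx xyx xd; apply: leq_trans xd; have [Mox|Mox] := boolP (M (opp x)).
    rewrite -[in X in _ <= X](oppK x); apply: IHk; rewrite ?oppK //=.
    apply: leq_trans lek; have fox := mark_internal valid.1 Mox.
    rewrite -fx in fd *; case: x xb fd fox {fx Mx Mox xyx} => e [] //= _ h1 h2.
    exact: (face_rank_lt plane h2 h1).
  have : spine_step G M (orig (opp x)) (orig x).
    apply/orP; left; apply/existsP; exists x.1.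
    by case: x xb Mx Mox {fx xyx} => e [] //= _ -> ->; rewrite /Defs.orig /= !eqxx.
  by move/pi_step; lia.
have at_vertex z : ~~ z.2 -> (rot z).2 -> pi (orig y) = pi (orig z) :> nat ->
    M (phi z) \/ pi (orig (phi z)) <= pi (orig (opp d)) -> pi (orig (opp y)) <= pi (orig (opp d)).
  move=> zb rzb /val_inj/pi_inj oyz; have [Mr le] := out_heads_le zb rzb yb oyz My.
  by case=> [/valid.2|]; [rewrite opp_phi Mr | apply: leq_trans].
have step := step_diagonal pi_step.
have [hs|hs] := boolP (has_single G (face d)).
  have sd := mark_single valid.1 Md hs; have [b [pb fb bb]] := single_pred plane sd.
  have pdb : (phi d).2 = false by rewrite (single_bit plane sd) db.
  have bbF : ~~ b.2 by rewrite bb db.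
  have od : orig (opp d) = orig b by rewrite -pb orig_opp_phi.
  have rbF : ~~ (rot b).2 by rewrite -opp_phi pb /= db.
  have top x : face x = face d -> ~~ x.2 -> pi (orig x) <= pi (orig (opp d)).
    by move=> fx xb; rewrite od; apply: sink_max; rewrite // fb.
  have Mf x : face x = face d -> ~~ x.2 -> ~~ M x.
    move=> fx xb; apply/negP => Mx; have xd := mark_single_unique plane valid.1 Md Mx hs fx.
    by rewrite xd db in xb.
  move: (yd); rewrite {1}od.
  apply: (face_path_ind plane (b := false) (a := d)
    (P := fun x => pi (orig y) < pi (orig x) -> pi (orig (opp y)) <= pi (orig (opp d)))) => //.
  - move=> yx; apply: (inside (phi d)); rewrite ?face_phi ?pdb // ?orig_opp_phi // ?dy //.
      by rewrite Mf ?face_phi ?pdb.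
    by rewrite top ?face_phi ?pdb.
  - move=> x fx xb pxb IHx yx; have fpx : face (phi x) = face d by rewrite face_phi.
    case: (ltngtP (pi (orig y)) (pi (orig x))) => // [xy|exy].
      apply: (inside (phi x)); rewrite ?fpx ?pxb // ?orig_opp_phi // ?xy //.
        by rewrite Mf ?fpx ?pxb.
      by rewrite top ?fpx ?pxb.
    apply: (at_vertex x) => //; first by rewrite xb.
      by rewrite -[(rot x).2]negbK -bit_phi pxb.
    by right; rewrite top ?fpx ?pxb.
  - exact/negbTE.
have [p4 b2 b3 M1 [M2 M3]] := mark_rhombus plane faceP valid.1 fd hs.
rewrite Md /= in M1 M2 M3; rewrite db in b2; have od := opp_phi4 plane p4.
have diag x : diagonal_from G M x -> pi (orig (phi (phi x))) = (pi (orig x)).+1 :> nat.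
  by move=> dx; apply: pi_step; apply/orP; right; apply/existsP; exists x; rewrite dx !eqxx.
have [pdb|pdb] := boolP (phi d).2.
  have := diag d; rewrite /diagonal_from pdb db Md => /(_ isT) pl.
  have p3b : (phi (phi (phi d))).2 = false by rewrite b3 pdb.
  have [yl|yl] := eqVneq (pi (orig y) : nat) (pi (orig (phi (phi d)))).
    apply: (at_vertex (phi (phi d))); rewrite ?b2 //; last by right; rewrite od.
    by rewrite -[(rot _).2]negbK -bit_phi p3b.
  apply: (inside (phi (phi (phi d)))); rewrite ?p3b ?M3 ?od ?(orig_opp_phi plane (phi (phi d))) //.
    by rewrite !face_phi.
  by rewrite yd andbT; move/eqP: yl; move: pl dy; lia.
have := diag (phi d); rewrite /diagonal_from b2 (negbTE pdb) M2 => /(_ isT); rewrite od => pl.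
have [yl|yl] := eqVneq (pi (orig y) : nat) (pi (orig (phi d))).
  apply: (at_vertex (phi d)); rewrite ?M2 //; last by left.
  by rewrite -[(rot _).2]negbK -bit_phi b2.
apply: (inside (phi d)); rewrite ?M1 ?face_phi ?orig_opp_phi ?dy //=.
  by move/eqP: yl; move: pl yd; lia.
by rewrite pl.
Qed.

End Nesting.

Section TwoPages.
Variables (n m p : nat) (G : embedded_digraph n m p) (M : pred (dart m)).
Variable pi : {perm 'I_n}.
Hypothesis plane : plane_st_graph G.
Hypothesis faceP : forall f : 'I_p, f <> outer G -> generalized_triangle G f \/ rhombus G f.
Hypothesis valid : valid_marking G M.
Hypothesis pi_step : forall u v, spine_step G M u v -> pi v = (pi u).+1 :> nat.

Lemma spine_edge_lt e : pi (tail G e) < pi (head G e).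
Proof.
have [w /pi_step <- wv] := edge_spine_path plane faceP valid e.
apply: (connect_ind (P := fun v => pi w <= pi v)) wv => // z t wz /pi_step ->.
exact: leq_trans wz (leqnSn _).
Qed.

Lemma spine_2UBE : is_2UBE G pi (fun e => M (e, true)).
Proof.
split=> [e|e e' se]; first exact: spine_edge_lt.
apply/negP => /and3P[h1 h2 h3]; have inj : injective pi := @perm_inj _ pi.
have [Me|Me] := boolP (M (e, true)).
  have := left_marked_nested plane faceP valid inj spine_edge_lt pi_step (d := (e, true)) (y := (e', true)).
  rewrite -se Me => /(_ isT isT isT isT); rewrite /Defs.orig /= h1 h2 => /(_ isT); lia.
have step x : ~~ M (x, true) -> ~~ M (x, false) -> pi (head G x) = (pi (tail G x)).+1 :> nat.
  move=> mt mf; apply: pi_step; apply/orP; left; apply/existsP; exists x.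
  by rewrite mt mf !eqxx.
have [Mf|Mf] := boolP (M (e, false)); last by have := step e Me Mf; lia.
have [Mf'|Mf'] := boolP (M (e', false)); last by have := step e'; rewrite -se => /(_ Me Mf'); lia.
have nest := left_marked_nested (plane_rotG plane) (faceP_rotG faceP) (valid_marking_rotG valid)
  (pi_rot_inj inj) (pi_rot_edge spine_edge_lt) (pi_rot_step plane faceP valid pi_step).
have := nest (e', true) (e, true); rewrite /opp /= Mf Mf' !orig_rotG !pi_rot_lt pi_rot_le.
by rewrite /Defs.orig /= h3 h2 => /(_ isT isT isT isT isT); lia.
Qed.

End TwoPages.

(** * The rotation system of the canonical drawing *)

Lemma pairwise_rev (T : Type) (r : rel T) s : pairwise r (rev s) = pairwise (fun x y => r y x) s.
Proof. by elim: s => //= x s IHs; rewrite rev_cons pairwise_rcons all_rev IHs. Qed.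

Lemma sorted_last_max (T : eqType) (f : T -> nat) (s : seq T) x y :
  sorted (relpre f ltn) s -> x \in s -> f x <= f (last y s).
Proof.
case: s => // z s srt xs; case/splitPl: xs srt => s1 s2 {1}<-.
rewrite /= cat_path last_cat => /andP[_].
by elim: s2 (last z s1) => //= t s2 IHs u /andP[/ltnW ut] /IHs; apply: leq_trans.
Qed.

Section DrawingOrder.
Variables (n m p : nat) (G : embedded_digraph n m p).
Variables (pi : {perm 'I_n}) (sigma : 'I_m -> bool).
Notation orig := (orig G).
Notation face := (dart_face G).
Notation rot := (rot G).
Hypothesis plane : plane_st_graph G.
Implicit Types (d x y : dart m) (v : 'I_n).

(* Along [drawing_rot], [angle] increases. *)
Definition angle d :=
  let q := pi (orig (opp d)) : nat in
  match sigma d.1, d.2 with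
  | true, false => n.-1 - q
  | true, true => n + (n.-1 - q)
  | false, true => 2 * n + q
  | false, false => 3 * n + q
  end.

Let by_angle : rel (dart m) := relpre angle ltn.

Lemma orig_opp_inj x y : x.2 = y.2 -> orig x = orig y -> orig (opp x) = orig (opp y) -> x = y.
Proof.
case: x y => e [] [e' []] //= _; rewrite /Defs.orig /= => h1 h2;
by congr (_, _); apply: (edge_inj plane).
Qed.

Lemma mem_page_darts v pg out d :
  (d \in page_darts G pi sigma v pg out) = [&& orig d == v, sigma d.1 == pg & d.2 == out].
Proof. by rewrite mem_sort mem_filter mem_enum andbT. Qed.

Lemma page_darts_pairwise v pg out :
  pairwise (fun x y => pi (orig (opp x)) < pi (orig (opp y))) (page_darts G pi sigma v pg out).
Proof.
set key := fun d => pi (orig (opp d)) : nat.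
set s := page_darts _ _ _ _ _ _.
have srt : sorted leq (map key s).
  by rewrite sorted_map; apply: sort_sorted => x y; apply: leq_total.
have uq : uniq (map key s).
  rewrite map_inj_in_uniq; first by rewrite sort_uniq; apply/filter_uniq/enum_uniq.
  move=> x y.
  rewrite !mem_page_darts => /and3P[/eqP ox _ /eqP bx] /and3P[/eqP oy _ /eqP by_].
  by move/val_inj/perm_inj; apply: orig_opp_inj; rewrite ?bx ?ox.
have : sorted ltn (map key s) by rewrite ltn_sorted_uniq_leq uq.
by rewrite sorted_map sorted_pairwise // => x y z; apply: ltn_trans.
Qed.

Lemma drawing_rotP v :
  sorted by_angle (drawing_rot G pi sigma v) /\ drawing_rot G pi sigma v =i [pred d | orig d == v].
Proof.
split; last first.
  move=> d; rewrite !mem_cat !mem_rev !mem_page_darts inE.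
  by case: (orig d == v); case: (sigma d.1); case: (d.2).
rewrite sorted_pairwise; last by move=> x y z; apply: ltn_trans.
have lt0 (i : 'I_n) : i <= n.-1 by have := ltn_ord i; lia.
have pw b out (r : rel (dart m)) :
    (forall x y, sigma x.1 = b -> sigma y.1 = b -> x.2 = out -> y.2 = out ->
      pi (orig (opp x)) < pi (orig (opp y)) -> r x y) ->
    pairwise r (page_darts G pi sigma v b out).
  move=> h; have := page_darts_pairwise v b out.
  apply: (sub_in_pairwise (P := [pred d | (sigma d.1 == b) && (d.2 == out)])).
    by move=> x y /andP[/eqP sx /eqP bx] /andP[/eqP sy /eqP by_]; apply: h.
  by apply/allP=> d; rewrite mem_page_darts => /and3P[_ sd bd]; apply/andP.
rewrite /drawing_rot !pairwise_cat; apply/and5P; split.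
- by apply/allrelP=> x y; rewrite !mem_cat !mem_rev !mem_page_darts /by_angle /angle /=
    => /and3P[_ /eqP -> /eqP ->] /or3P[] /and3P[_ /eqP -> /eqP ->]; have := ltn_ord (pi (orig (opp x))); lia.
- rewrite pairwise_rev; apply: pw => x y; rewrite /by_angle /angle /= => -> -> -> -> lt.
  by have := ltn_ord (pi (orig (opp y))); lia.
- by apply/allrelP=> x y; rewrite !mem_cat !mem_rev !mem_page_darts /by_angle /angle /=
    => /and3P[_ /eqP -> /eqP ->] /orP[] /and3P[_ /eqP -> /eqP ->]; have := ltn_ord (pi (orig (opp x))); lia.
- rewrite pairwise_rev; apply: pw => x y; rewrite /by_angle /angle /= => -> -> -> -> lt.
  by have := ltn_ord (pi (orig (opp y))); lia.
apply/and3P; split.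
- by apply/allrelP=> x y; rewrite !mem_page_darts /by_angle /angle /=
    => /and3P[_ /eqP -> /eqP ->] /and3P[_ /eqP -> /eqP ->]; have := ltn_ord (pi (orig (opp x))); lia.
- by apply: pw => x y; rewrite /by_angle /angle /= => -> -> -> -> lt; lia.
- by apply: pw => x y; rewrite /by_angle /angle /= => -> -> -> -> lt; lia.
Qed.

Lemma next_drawing_rot d (v := orig d) (s := drawing_rot G pi sigma v) :
  angle d < angle (next s d) \/
  (d = last d s) /\ forall x, orig x = v -> angle (next s d) <= angle x <= angle d.
Proof.
have [srt mem_s] := drawing_rotP v; rewrite -/s in srt mem_s.
have ds : d \in s by rewrite mem_s inE.
have tr : transitive by_angle by move=> x y z; apply: ltn_trans.
case: s mem_s srt ds => [//|x0 s] mem_s srt ds.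
pose e := [rel x y | by_angle x y || (x == last x0 s) && (y == x0)].
have cyc : path.cycle e (x0 :: s).
  rewrite /= rcons_path /= !eqxx orbT andbT; apply: sub_path srt => x y /= ->.
  by [].
have := next_cycle cyc ds; set y := next _ _ => /orP[lt|/andP[/eqP dl /eqP yx]]; [by left | right].
split=> // x xv; have xs : x \in x0 :: s by rewrite mem_s inE xv.
have leS z : z \in x0 :: s -> angle x0 <= angle z.
  rewrite inE => /orP[/eqP -> //|zs]; apply: ltnW.
  by move: srt => /(order_path_min tr) /allP /(_ z zs).
by rewrite yx leS //= dl; apply: (sorted_last_max x0 srt xs).
Qed.

Lemma next_drawing_rot_of d :
  (forall x y, orig x = orig d -> orig y = orig d ->
     angle (rot x) <= angle x -> angle (rot y) <= angle y -> x = y) ->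
  rot d = next (drawing_rot G pi sigma (orig d)) d.
Proof.
move=> uniqW; have [srt mem_s] := drawing_rotP (orig d).
have tr : transitive by_angle by move=> x y z; apply: ltn_trans.
have [b Pb bmax] : exists2 b, orig b = orig d & forall x, orig x = orig d -> angle x <= angle b.
  case: (@arg_maxnP _ d [pred x | orig x == orig d] angle (eqxx _)) => b /eqP ob bmax.
  by exists b => // x ox; apply: bmax; rewrite inE ox.
have inj := rotation_inj plane.
have zb : fconnect rot (rot b) d.
  by rewrite fconnect_rot // orig_rot // Pb.
suff -> : drawing_rot G pi sigma (orig d) = fingraph.orbit rot (rot b).
  by apply/eqP; apply: (next_cycle (cycle_orbit inj (rot b))); rewrite -fconnect_orbit.
apply: (irr_sorted_eq tr _ srt) => [x||x]; first exact: ltnn; last first.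
  by rewrite mem_s -fconnect_orbit inE fconnect_rot // orig_rot // Pb eq_sym.
rewrite /fingraph.orbit; apply/(sortedP (rot b)) => i; rewrite size_traject => lt.
rewrite !nth_traject ?(ltnW lt) //= /by_angle /=.
rewrite ltnNge; apply/negP => le.
have zE : iter i rot (rot b) = b.
  apply: uniqW => //; last by apply: bmax; rewrite orig_rot.
  apply/esym/eqP; rewrite -fconnect_rot //; apply: connect_trans (fconnect_iter _ _ _).
  by rewrite fconnect_rot // orig_rot // Pb.
have := findex_iter lt; rewrite iterS zE findex0; lia.
Qed.

End DrawingOrder.

Section Embedding.
Variables (n m p : nat) (G : embedded_digraph n m p) (M : pred (dart m)).
Variable pi : {perm 'I_n}.
Notation orig := (orig G).
Notation face := (dart_face G).
Notation rot := (rot G).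
Notation phi := (phi G).
Hypothesis plane : plane_st_graph G.
Hypothesis faceP : forall f : 'I_p, f <> outer G -> generalized_triangle G f \/ rhombus G f.
Hypothesis valid : valid_marking G M.
Hypothesis pi_step : forall u v, spine_step G M u v -> pi v = (pi u).+1 :> nat.
Implicit Types (b d x y z : dart m).

Let sigma e := M (e, true).
Notation angle := (angle G pi sigma).
Notation R := (rotG G).
Let M' d := M (opp d).

Let inj : injective pi := @perm_inj _ pi.
Let edge := spine_edge_lt plane faceP valid pi_step.

Lemma sigma_out d : d.2 -> sigma d.1 = M d. Proof. by case: d => e []. Qed.
Lemma sigma_in d : ~~ d.2 -> sigma d.1 = M (opp d). Proof. by case: d => e []. Qed.

Lemma sink_corner_left d : ~~ d.2 -> ~~ (rot d).2 -> M d -> pi (orig (opp d)) < pi (orig (phi d)).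
Proof.
move=> db rdb Md.
have := @source_corner_left _ _ _ _ _ _ (plane_rotG plane) (faceP_rotG faceP)
  (valid_marking_rotG valid).1 (pi_rot_inj inj) (pi_rot_edge edge)
  (step_diagonal (pi_rot_step plane faceP valid pi_step)) (opp d).
by rewrite phi_rotG !orig_rotG !oppK pi_rot_lt; apply; rewrite /= ?oppK.
Qed.

Lemma sink_corner_right d : ~~ d.2 -> ~~ (rot d).2 -> M (phi d) -> pi (orig (phi d)) < pi (orig (opp d)).
Proof.
move=> db rdb Md.
have := @source_corner_right _ _ _ _ _ _ (plane_rotG plane) (faceP_rotG faceP)
  (valid_marking_rotG valid).1 (pi_rot_inj inj) (pi_rot_edge edge)
  (step_diagonal (pi_rot_step plane faceP valid pi_step)) (opp d).
by rewrite phi_rotG !orig_rotG !oppK pi_rot_lt; apply; rewrite /= ?oppK.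
Qed.

Let angleE d : angle d = (if sigma d.1 then (if d.2 then n else 0) + (n.-1 - pi (orig (opp d)))
  else (if d.2 then 2 * n else 3 * n) + pi (orig (opp d))).
Proof. by rewrite /angle; case: (sigma _); case: (d.2). Qed.

(* A wrap is a corner that contains the downward direction. *)
Variant wrap_spec d : Prop :=
  | WrapIn of ~~ d.2 & ~~ (rot d).2 & face d <> outer G & ~~ sigma d.1 & sigma (rot d).1
  | WrapInOut of ~~ d.2 & (rot d).2 & ~~ sigma d.1
  | WrapOutIn of d.2 & ~~ (rot d).2 & sigma (rot d).1
  | WrapSnk of ~~ d.2 & ~~ (rot d).2 & face d = outer G & (sigma d.1 -> sigma (rot d).1)
  | WrapSrc of d.2 & (rot d).2 & face d = outer G.

Lemma wrapP d : angle (rot d) <= angle d -> wrap_spec d.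
Proof.
have bnd u := ltn_ord (pi u); have q1 := bnd (orig (opp d)); have q2 := bnd (orig (opp (rot d))).
rewrite leqNgt => /negP wr.
have [db|db] := boolP d.2; have [rb|rb] := boolP (rot d).2.
- have [fd|/eqP fd] := eqVneq (face d) (outer G); first exact: WrapSrc.
  case: wr; rewrite !angleE db rb !sigma_out //.
  have Mr := mark_rot plane valid db rb fd.
  have [Md|Md] := boolP (M d).
    have := source_corner_left plane faceP valid.1 inj edge (step_diagonal pi_step) db rb Md.
    by rewrite /phi; case: (M (rot d)); move: q1 q2; lia.
  rewrite Md in Mr; have := valid.2 _ Mr; rewrite oppK => /negbTE ->.
  have := source_corner_right plane faceP valid.1 inj edge (step_diagonal pi_step) db rb Mr.
  by rewrite /phi; move: q1 q2; lia.
- have [s|s] := boolP (sigma (rot d).1); first exact: WrapOutIn.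
  case: wr; rewrite !angleE db (negbTE rb) (negbTE s).
  by case: (sigma d.1); move: q1 q2; lia.
- have [s|s] := boolP (sigma d.1); last exact: WrapInOut.
  case: wr; rewrite !angleE (negbTE db) rb s.
  by case: (sigma (rot d).1); move: q1 q2; lia.
have [fd|/eqP fd] := eqVneq (face d) (outer G).
  apply: WrapSnk => // s; apply: contraT => s'; case: wr.
  by rewrite !angleE (negbTE db) (negbTE rb) s (negbTE s'); move: q1 q2; lia.
have Mp : M (phi d) = ~~ M d.
  by apply: (mark_corner plane valid.1 fd); rewrite bit_phi (negbTE db) (negbTE rb).
have s1 := sigma_in db; have s2 := sigma_in rb.
have [Md|Md] := boolP (M d).
  case: wr; rewrite !angleE (negbTE db) (negbTE rb) s1 s2 (negbTE (valid.2 _ Md)).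
  rewrite -/(phi d) Mp Md /=; have := sink_corner_left db rb Md.
  by rewrite /phi; move: q1 q2; lia.
rewrite Md in Mp; have [sd|sd] := boolP (sigma d.1); last by apply: WrapIn; rewrite // s2.
case: wr; rewrite !angleE (negbTE db) (negbTE rb) sd s2 -/(phi d) Mp.
have := sink_corner_right db rb Mp.
by rewrite /phi; move: q1 q2; lia.
Qed.

Definition in_run x y := connect (out_run R) (opp x) (opp y).

Lemma in_run_total x y : orig x = orig y -> in_run x y \/ in_run y x.
Proof. by move=> o; apply: (out_run_total (plane_rotG plane)); rewrite !orig_rotG !oppK. Qed.

Lemma in_run_sigma x y : ~~ x.2 -> sigma x.1 -> in_run x y -> sigma y.1.
Proof.
move=> xb sx xy.
rewrite sigma_in // in sx.
suff [yb _ My] : [/\ (opp y).2, Defs.orig R (opp y) = Defs.orig R (opp x) & M (opp y)].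
  by rewrite sigma_in.
apply: (out_run_ind (plane_rotG plane) (P := fun z => M z)) xy => //.
move=> z _ zb rzb; rewrite face_rotG => fz Mz.
have Moz : ~~ M (opp z) by apply: valid.2.
suff : M (phi (opp z)) = ~~ M (opp z) by move=> ->.
have {}rzb : ~~ (rot (opp z)).2 := rzb.
by apply: (mark_corner plane valid.1 fz); rewrite bit_phi rzb /= zb.
Qed.

Lemma in_run_next x y : x <> y -> in_run x y -> in_run (rot x) y.
Proof.
move=> xy /connectP[[|z q] pth last_y]; first by case: xy; apply: opp_inj; rewrite last_y.
case/andP: pth => /andP[/eqP rx _] pth; apply/connectP; exists q.
  by rewrite -rx /= oppK in pth.
by rewrite last_y -rx /= oppK.
Qed.

Lemma in_run_end x y : ~~ x.2 -> (rot x).2 || (face x == outer G) -> in_run x y -> y = x.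
Proof.
move=> xb ex /(out_run_end (G := R)) h; apply: opp_inj; apply: h.
by rewrite /out_end face_rotG /= oppK xb negbK.
Qed.

Lemma start_sigma b x : b.2 || (face b == outer G) -> ~~ (rot b).2 -> sigma (rot b).1 ->
  ~~ x.2 -> orig x = orig b -> sigma x.1.
Proof.
move=> hb rb sb xb ox.
have [|bx|xb'] := @in_run_total (rot b) x; first by rewrite orig_rot.
  exact: in_run_sigma bx.
suff -> : x = rot b by [].
apply: opp_inj; have := @out_run_start _ _ _ _ (plane_rotG plane) (opp b) (opp x).
rewrite /= oppK => h; rewrite -h //; case/orP: hb => hb; first by left; rewrite /= hb.
have [bb|bb] := boolP b.2; first by left.
by right; rewrite /out_end face_rotG oppK hb /= bb orbT.
Qed.

Lemma wrap_in_last x y : ~~ x.2 -> ~~ (rot x).2 -> face x <> outer G ->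
  ~~ sigma x.1 -> sigma (rot x).1 -> ~~ y.2 -> orig x = orig y ->
  ~~ sigma y.1 -> in_run x y \/ (rot y).2 || (face y == outer G) -> x = y.
Proof.
move=> xb rxb fx sx srx yb oxy sy h; apply/eqP; case: eqP => // xy.
have {h} [xy'|yx] : in_run x y \/ in_run y x /\ ((rot y).2 || (face y == outer G)).
- by case: h => [|hy]; [left | case: (in_run_total oxy); [left | right]].
- by case/negP: sy; apply: (@in_run_sigma (rot x)) => //; apply: in_run_next.
by case: yx => yx hy; case: xy; apply: in_run_end yx.
Qed.

Lemma wrap_unique x y : orig x = orig y ->
  angle (rot x) <= angle x -> angle (rot y) <= angle y -> x = y.
Proof.
move=> oxy /wrapP wx /wrapP wy.
have in_out a b : orig a = orig b -> ~~ a.2 -> ~~ (rot a).2 -> face a <> outer G ->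
    ~~ sigma a.1 -> sigma (rot a).1 -> wrap_spec b -> a = b.
  move=> oab ab rab fa sa sra [bb rbb fb sb srb|bb rbb sb|bb rbb sb|bb rbb fb sb|bb rbb fb].
  - case: (in_run_total oab) => h; first by apply: wrap_in_last => //; left.
    by apply/esym; apply: wrap_in_last => //; left.
  - by apply: wrap_in_last => //; right; rewrite rbb.
  - by case/negP: sa; apply: (@start_sigma b); rewrite ?bb.
  - case: (boolP (sigma b.1)) => sb'; last by apply: wrap_in_last => //; right; rewrite fb eqxx orbT.
    by case/negP: sa; apply: (@start_sigma b); rewrite ?fb ?eqxx ?orbT ?sb.
  - have := @in_dart_src _ _ _ _ plane a; rewrite (negbTE ab) oab (outer_src plane fb bb rbb).
    by move/(_ erefl).
have in_end a b : orig a = orig b -> ~~ a.2 -> (rot a).2 || (face a == outer G) ->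
    ~~ b.2 -> (rot b).2 || (face b == outer G) -> a = b.
  move=> oab ab ea bb eb; apply: opp_inj; apply: (out_end_unique (plane_rotG plane)).
  - by rewrite /out_end face_rotG /= oppK ab negbK.
  - by rewrite /out_end face_rotG /= oppK bb negbK.
  - by rewrite !orig_rotG !oppK.
have srcN a b : orig a = orig b -> a.2 -> (rot a).2 -> face a = outer G -> b.2 /\ (rot b).2.
  move=> oab ab rab fa; have oa := outer_src plane fa ab rab.
  by split; apply: (in_dart_src plane); rewrite ?orig_rot -?oab.
have snkN a b : orig a = orig b -> ~~ a.2 -> ~~ (rot a).2 -> face a = outer G -> ~~ b.2 /\ ~~ (rot b).2.
  move=> oab ab rab fa.
  have := @outer_src _ _ _ _ (plane_rotG plane) (opp a).
  rewrite face_rotG orig_rotG /= oppK => /(_ fa ab rab) oa.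
  by split; apply: (out_dart_snk plane); rewrite ?orig_rot -?oab.
case: (wx) => [xb rxb fx sx srx|xb rxb sx|xb rxb sx|xb rxb fx sx|xb rxb fx];
case: (wy) => [yb ryb fy sy sry|yb ryb sy|yb ryb sy|yb ryb fy sy|yb ryb fy];
  try (by apply: in_out); try (by apply/esym; apply: in_out);
  try (by apply: in_end; rewrite ?rxb ?ryb ?fx ?fy ?eqxx ?orbT);
  try (by have [] := srcN x y oxy xb rxb fx; rewrite ?(negbTE yb) ?(negbTE ryb));
  try (by have [] := srcN y x (esym oxy) yb ryb fy; rewrite ?(negbTE xb) ?(negbTE rxb));
  try (by have [] := snkN x y oxy xb rxb fx; rewrite ?yb ?ryb);
  try (by have [] := snkN y x (esym oxy) yb ryb fy; rewrite ?xb ?rxb).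
- by case/negP: sx; apply: (@start_sigma y); rewrite ?yb.
- by case/negP: sy; apply: (@start_sigma x); rewrite ?xb.
- by apply: (same_vertex_corner plane (b := true)) => //; apply/negbTE.
- by apply: (same_face_corner plane (b := true)); rewrite ?fx.
Qed.

Lemma spine_embedding : embedding_preserving G pi sigma.
Proof.
split=> [d|d ds].
  by apply: (next_drawing_rot_of plane) => x y ox oy; apply: wrap_unique; rewrite ox.
set s := drawing_rot _ _ _ _.
have [srt mem_s] := drawing_rotP pi sigma plane (src G).
have ls : orig (last d s) = src G.
  have : last d s \in d :: s := mem_last _ _.
  by rewrite inE => /orP[/eqP -> //|]; rewrite mem_s inE => /eqP.
have : angle (rot (last d s)) <= angle (last d s).
  by apply: (sorted_last_max d srt); rewrite mem_s inE orig_rot // ls.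
have lb := in_dart_src plane ls; have := in_dart_src plane (etrans (orig_rot plane _) ls).
by move=> rlb /wrapP[]; rewrite ?lb ?rlb.
Qed.

End Embedding.

(** * From a book embedding to a marking *)

Section Necessity.
Variables (n m p : nat) (G : embedded_digraph n m p).
Variables (pi : {perm 'I_n}) (sigma : 'I_m -> bool).
Notation orig := (orig G).
Notation face := (dart_face G).
Notation rot := (rot G).
Notation phi := (phi G).
Hypothesis plane : plane_st_graph G.
Hypothesis faceP : forall f : 'I_p, f <> outer G -> generalized_triangle G f \/ rhombus G f.
Hypothesis book : is_2UBE G pi sigma.
Hypothesis embed : embedding_preserving G pi sigma.
Implicit Types (b d x y z : dart m).

Let inj : injective pi := @perm_inj _ pi.
Let edge e : pi (tail G e) < pi (head G e) := book.1 e.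

Definition flat_mark d :=
  if d.2 then pi (orig d) < pi (orig (phi (phi d))) else pi (orig (phi (phi d))) < pi (orig d).

Definition book_marking d :=
  (face d != outer G) && (if has_single G (face d) then single G d
   else if (phi d).2 == d.2 then flat_mark d else ~~ flat_mark (phi d)).

Notation M := book_marking.

Lemma book_face_marking : face_marking G M.
Proof.
split=> [d|d|d]; rewrite /book_marking; first by move=> ->; rewrite eqxx.
  move=> fd hs; rewrite !face_phi // (negbTE hs); have [p4 b2] := rhombus_phi plane faceP fd hs.
  move/eqP: (fd) => ->; rewrite !andTb.
  have [bd|bd] := eqVneq (phi d).2 d.2.
    rewrite b2 bd; case: eqVneq => [h|_]; first by case: (d.2) h.
    congr (~~ _); rewrite /flat_mark p4 b2; by case: (d.2).
  rewrite negbK b2; case: eqVneq => // h.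
  by case: (phi d).2 (d.2) bd h => -[].
by move=> /eqP -> ->.
Qed.

Lemma book_diagonal d : diagonal_from G M d -> pi (orig d) < pi (orig (phi (phi d))).
Proof.
move=> /andP[/eqP bd Md].
have fd : face d <> outer G.
  by move: Md; case: ifP => _ /(mark_internal book_face_marking); rewrite ?face_phi.
have hs : ~~ has_single G (face d).
  by apply: (mark_flat plane book_face_marking bd); move: Md; case: ifP => _ ->; rewrite ?orbT.
have [p4 b2 b3 M1 _] := mark_rhombus plane faceP book_face_marking fd hs.
have Mf : M d = flat_mark d by rewrite /M bd eqxx (negbTE hs); move/eqP: fd => ->.
move: Md; have [db|db] := boolP d.2; rewrite ?M1 Mf /flat_mark ?db ?(negbTE db) //.
rewrite -leqNgt leq_eqVlt => /orP[/eqP/val_inj/inj od|//].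
have [] := @corner_heads_neq _ _ _ _ plane (phi (phi (phi d))).
- by rewrite b3 bd.
- by rewrite -[(rot _).2]negbK -bit_phi p4.
- by rewrite !face_phi.
by rewrite p4 orig_opp_phi.
Qed.

Lemma source_corner_angle d : d.2 -> (rot d).2 -> face d <> outer G ->
  angle G pi sigma d < angle G pi sigma (rot d).
Proof.
move=> db rdb fd; rewrite (embed.1 d).
have [//|[ld h]] := next_drawing_rot pi sigma plane d.
rewrite -(embed.1 d) in h; case: fd.
have [ods|ods] := eqVneq (orig d) (src G).
  by rewrite ld ods; apply: embed.2.
have [e he] := in_edge plane ods.
have := h (e, false) he; rewrite /angle /= db rdb.
have bnd u := ltn_ord (pi u); move: (bnd (orig (opp d))) (bnd (orig (opp (rot d)))) (bnd (orig (opp (e, false)))).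
by case: (sigma e); case: (sigma _); case: (sigma _); lia.
Qed.

Lemma right_page d : d.2 -> (rot d).2 -> M d -> sigma d.1.
Proof.
move=> db rdb Md; have fd := mark_internal book_face_marking Md.
have := source_corner_angle db rdb fd.
have := source_corner_left plane faceP book_face_marking inj edge book_diagonal db rdb Md.
have bnd u := ltn_ord (pi u); move: (bnd (orig (opp d))) (bnd (orig (opp (rot d)))).
by rewrite /angle db rdb /phi; case: (sigma d.1); case: (sigma _) => //; lia.
Qed.

Lemma left_page d : d.2 -> (rot d).2 -> M (phi d) -> ~~ sigma (phi d).1.
Proof.
move=> db rdb Md; have := mark_internal book_face_marking Md; rewrite face_phi // => fd.
have := source_corner_angle db rdb fd.
have := source_corner_right plane faceP book_face_marking inj edge book_diagonal db rdb Md.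
have bnd u := ltn_ord (pi u); move: (bnd (orig (opp d))) (bnd (orig (opp (rot d)))).
by rewrite /angle db rdb /phi /=; case: (sigma d.1); case: (sigma _) => //; lia.
Qed.

Lemma crossing_pages x y : x.2 -> y.2 -> pi (orig x) < pi (orig y) ->
  pi (orig y) < pi (orig (opp x)) -> pi (orig (opp x)) < pi (orig (opp y)) ->
  sigma x.1 != sigma y.1.
Proof.
case: x y => e [] // [e' []] // _ _ h1 h2 h3; apply/eqP => /(book.2 e e').
by rewrite h1 h2 h3.
Qed.

Lemma right_page_flat d : d.2 -> M d -> sigma d.1.
Proof.
move=> db Md; have [rb|rb] := boolP (rot d).2; first exact: right_page.
have bd : (phi d).2 = d.2 by rewrite bit_phi rb.
have fd := mark_internal book_face_marking Md.
have hs : ~~ has_single G (face d) by apply: (mark_flat plane book_face_marking bd); rewrite Md.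
have [p4 b2 b3 M1 [M2 M3]] := mark_rhombus plane faceP book_face_marking fd hs.
rewrite db in bd b2; rewrite bd in b3.
have lp : ~~ sigma (phi (phi d)).1.
  by apply: left_page => //; [rewrite -[(rot _).2]negbK -bit_phi b2 | rewrite M2].
have diag : pi (orig d) < pi (orig (phi (phi d))).
  by apply: book_diagonal; rewrite /diagonal_from bd db Md.
have o1 := orig_opp_phi plane d; have o2 := orig_opp_phi plane (phi d).
have := @crossing_pages (opp (phi (phi d))) d.
rewrite oppK o2 (negbTE lp) /= -bit_phi b2 => /(_ isT db).
have e1 := pi_dart edge bd; rewrite o1 in e1; move=> /(_ e1 diag).
have := @pi_phi _ _ _ _ pi plane edge (phi (phi d)); rewrite b3 (opp_phi4 plane p4) => /(_ isT) e2.
by move=> /(_ e2); case: (sigma d.1).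
Qed.

Lemma left_page_flat d : ~~ d.2 -> M d -> ~~ sigma d.1.
Proof.
move=> db Md; have pinj := phi_inj plane; pose x := finv phi d.
have px : phi x = d by apply: f_finv.
have [xb|xb] := boolP x.2.
  rewrite -px; apply: left_page => //; last by rewrite px.
  by rewrite -[(rot _).2]negbK -bit_phi px.
have bx : (phi x).2 = x.2 by rewrite px (negbTE db) (negbTE xb).
rewrite -px in Md db *.
have fx : face x <> outer G by have := mark_internal book_face_marking Md; rewrite face_phi.
have hs : ~~ has_single G (face x) by apply: (mark_flat plane book_face_marking bx); rewrite Md orbT.
have [p4 b2 b3 M1 [M2 M3]] := mark_rhombus plane faceP book_face_marking fx hs.
have od := opp_phi4 plane p4.
rewrite (negbTE db) in b3; rewrite (negbTE xb) in b2.
have rp : sigma (phi (phi (phi x))).1.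
  apply: right_page => //.
    by rewrite -[(rot _).2]negbK -bit_phi p4.
  by rewrite M3 -M1.
have diag : pi (orig x) < pi (orig (phi (phi x))).
  by apply: book_diagonal; rewrite /diagonal_from bx (negbTE xb) Md eqxx.
have := @crossing_pages (phi (phi (phi x))) (opp (phi x)).
rewrite [opp (opp (phi x))]oppK rp !orig_opp_phi // => h.
have e1 : pi (orig (phi (phi (phi x)))) < pi (orig x).
  have := @pi_dart _ _ _ _ pi edge (opp x); rewrite oppK od; apply; exact: xb.
have e2 : pi (orig (phi (phi x))) < pi (orig (phi x)).
  by have := @pi_dart _ _ _ _ pi edge (phi (phi x)); rewrite orig_opp_phi // b2; apply.
have hb : (phi (phi (phi x))).2 by rewrite b3.
by have := h hb db e1 diag e2; case: (sigma _).
Qed.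

Lemma book_valid_marking : valid_marking G M.
Proof.
split=> [|d Md]; first exact: book_face_marking.
apply/negP => Mod; have [db|db] := boolP d.2.
  by have := right_page_flat db Md; have := left_page_flat _ Mod; rewrite /= db => /(_ isT) /negbTE ->.
by have := left_page_flat db Md; have := right_page_flat _ Mod; rewrite /= db => /(_ isT) ->.
Qed.

End Necessity.

(** * Propagation of decisions *)

Section Propagation.
Variables (n m p : nat) (G : embedded_digraph n m p).
Notation orig := (orig G).
Notation face := (dart_face G).
Notation phi := (phi G).
Hypothesis plane : plane_st_graph G.
Hypothesis faceP : forall f : 'I_p, f <> outer G -> generalized_triangle G f \/ rhombus G f.
Implicit Types (d x y z q : dart m) (A : pred 'I_p) (Q : seq (dart m)) (M : pred (dart m)).

Section Flip.
Variables (M : pred (dart m)) (A : pred 'I_p).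
Hypothesis valid : valid_marking G M.
Hypothesis A_outer : A (outer G).
Hypothesis A_single : forall f, has_single G f -> A f.
Hypothesis A_closed : forall d, M d -> A (face d) -> A (face (opp d)).

Let both d := A (face d) && A (face (opp d)).

(* The far side of a marked edge is again marked on its far side, so following
   marked edges to one side stays in A until the outer face. *)
Lemma marked_to_outer d : M d -> A (face d) -> connect (crossing G both) (face d) (outer G).
Proof.
pose r b f := if b then p - face_rank G f else face_rank G f.
have [k] := ubnP (r d.2 (face d)); elim: k d => // k IHk d; rewrite ltnS => lek Md Ad.
have Aod := A_closed Md Ad; have fd := mark_internal valid.1 Md; have Mod := valid.2 _ Md.
apply: (@connect_trans _ _ (face (opp d))).
  by apply/connect1/existsP; exists d; rewrite /both Ad Aod !eqxx.
have [->|/eqP fod] := eqVneq (face (opp d)) (outer G); first exact: connect0.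
have [y [fy yb My]] : exists y, [/\ face y = face (opp d), y.2 = d.2 & M y].
  have [hs|hs] := boolP (has_single G (face (opp d))).
    have /existsP[y /andP[/eqP fy sy]] := hs.
    have My : M y by case: valid => -[_ _ v4] _; rewrite v4 ?fy.
    exists y; split=> //; apply/eqP; case: eqVneq => // yb.
    have yod : opp d = y by apply: (singleP _ _ sy) => //=; case: (d.2) (y.2) yb => -[].
    by rewrite yod My in Mod.
  have [_ _ b3 M1 [_ M3]] := mark_rhombus plane faceP valid.1 fod hs.
  rewrite Mod in M1 M3.
  have [b1|b1] := eqVneq (phi (opp d)).2 d.2; first by exists (phi (opp d)); rewrite face_phi.
  exists (phi (phi (phi (opp d)))); rewrite !face_phi // b3; split=> //.
  by case: (phi (opp d)).2 (d.2) b1 => -[].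
rewrite -fy; apply: IHk => //; last by rewrite fy.
apply: leq_trans lek; rewrite yb fy /r; have l1 := face_rank_le G (face d).
have l2 := face_rank_le G (face (opp d)).
case: d {Ad Aod Mod Md y fy yb My} fd fod l1 l2 => e [] /= h1 h2 l1 l2.
  by have := face_rank_lt plane h1 h2; move: l1 l2; rewrite /dart_face /=; lia.
exact: (face_rank_lt plane h2 h1).
Qed.

Lemma assigned_to_outer f : A f -> connect (crossing G both) f (outer G).
Proof.
move=> Af; have [->|/eqP fo] := eqVneq f (outer G); first exact: connect0.
have [d [fd Md]] : exists d, face d = f /\ M d.
  have m0 : 0 < m.
    rewrite lt0n; apply/eqP => m_0; case: fo; apply: val_inj.
    have euler : n + p = m + 2 by case: plane => _ _ _ [].
    have := ltn_ord f; have := ltn_ord (outer G); have := ltn_ord (src G); rewrite /=; lia.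
  have [d fd] := face_dart plane m0 f; rewrite -fd in fo *.
  case: valid => -[_ v3 v4] _; have [hs|hs] := boolP (has_single G (face d)).
    by have /existsP[y /andP[/eqP fy sy]] := hs; exists y; rewrite v4 ?fy.
  have [Md|Md] := boolP (M d); first by exists d.
  by exists (phi d); rewrite face_phi // v3.
by rewrite -fd; apply: marked_to_outer; rewrite ?fd.
Qed.

Lemma flip_marking q : ~~ A (face q) ->
  exists2 M', valid_marking G M' & ~~ M' q /\ forall d, A (face d) -> M' d = M d.
Proof.
move=> Aq; have A_int d : ~~ A (face d) -> face d <> outer G.
  by move=> Ad h; rewrite h A_outer in Ad.
have A_rh d : ~~ A (face d) -> ~~ has_single G (face d).
  by apply: contra; apply: A_single.
have m0 : 0 < m by apply: leq_ltn_trans (ltn_ord q.1).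
have [|||c cP] := @alternating_coloring _ _ _ G plane [pred f | ~~ A f].
- move=> f /= Af; have [d fd] := face_dart plane m0 f.
  rewrite (rhombus_card plane) // -fd; rewrite -fd in Af.
  by apply: rhombus_no_single; rewrite ?A_rh //; apply: A_int.
- by rewrite /= A_outer.
- move=> f /=; rewrite negbK => /assigned_to_outer.
  apply: connect_sub => g h gh; apply: connect1; move: gh.
  by case/existsP=> d hd; apply/existsP; exists d; rewrite /= !negbK.
have {}cP d : ~~ A (face d) -> c (orig (opp d)) = ~~ c (orig d).
  by move=> /cP; case: d => e []; rewrite /Defs.orig /= => // ->; rewrite negbK.
exists (fun d => if A (face d) then M d else c (orig d) != c (orig q)); last first.
  by rewrite (negbTE Aq) eqxx; split=> // d ->.
case: valid => -[v1 v3 v4] v2; split; first split=> d.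
- by move=> fd; rewrite fd A_outer v1.
- rewrite face_phi //; case: ifPn => [_|Ad] fd hs; first exact: v3.
  have := cP (phi d); rewrite orig_opp_phi // face_phi // => /(_ Ad) ->.
  by case: (c (orig (phi d))) (c (orig q)) => -[].
- by move=> fd hs; rewrite (A_single hs) v4.
move=> d; case: ifPn => Ad; case: ifPn => Aod.
- exact: v2.
- by move=> /A_closed/(_ Ad); rewrite (negbTE Aod).
- by move=> _; apply: contra Ad => /A_closed/(_ Aod); rewrite oppK.
by rewrite cP //; case: (c (orig d)) (c (orig q)) => -[].
Qed.

End Flip.

(* The faces in A have been decided, and Q lists their marked darts. *)
Record decided A Q : Prop := Decided {
  decided_uniq : uniq Q;
  decided_outer : A (outer G);
  decided_has_single : forall f, has_single G f -> A f;
  decided_mem : forall d, d \in Q -> A (face d) /\ face d <> outer G;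
  decided_rhombus : forall d, A (face d) -> face d <> outer G -> ~~ has_single G (face d) ->
    (phi d \in Q) = (d \notin Q);
  decided_single : forall d, face d <> outer G -> has_single G (face d) -> (d \in Q) = single G d;
  decided_extends : forall M, valid_marking G M ->
    exists2 M', valid_marking G M' & forall d, A (face d) -> M' d = (d \in Q) }.

Lemma decided_start Q : uniq Q ->
  (forall d, (d \in Q) = (face d != outer G) && single G d) ->
  decided [pred f | (f == outer G) || has_single G f] Q.
Proof.
move=> uQ memQ; split=> //=.
- by rewrite eqxx.
- by move=> f ->; rewrite orbT.
- move=> d; rewrite memQ => /andP[fd sd]; split; last exact/eqP.
  by apply/orP; right; apply/existsP; exists d; rewrite eqxx.
- by move=> d /orP[/eqP -> //|->].
- by move=> d /eqP fd _; rewrite memQ fd.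
move=> M vM; exists M => // d; rewrite memQ; case: eqVneq => [fd _|/eqP fd /= hs].
  by case: vM => -[v1 _ _] _; apply/negbTE/v1.
by case: vM => -[_ _ v4] _; rewrite v4.
Qed.

Lemma rhombus_orbit q x : face q <> outer G -> ~~ has_single G (face q) -> face x = face q ->
  [\/ x = q, x = phi q, x = phi (phi q) | x = phi (phi (phi q))].
Proof.
move=> fq hs fx; have [p4 _] := rhombus_phi plane faceP fq hs.
have qx : fconnect phi q x by rewrite fconnect_phi // fx.
apply: (fconnect_ind (P := fun x => [\/ x = q, x = phi q, x = phi (phi q) | x = phi (phi (phi q))]) _ _ qx).
  by constructor 1.
by move=> z [] ->; rewrite ?p4; [constructor 2 | constructor 3 | constructor 4 | constructor 1].
Qed.

Lemma decided_add A Q q : decided A Q -> ~~ A (face q) ->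
  opp q \in Q \/ (forall d, d \in Q -> A (face (opp d))) ->
  decided [pred f | (f == face q) || A f] (Q ++ [:: phi q; phi (phi (phi q))]).
Proof.
move=> dec Aq hq; have [uQ Ao As Am Ar Asi Ae] := dec.
have fq : face q <> outer G by move=> h; rewrite h Ao in Aq.
have hs : ~~ has_single G (face q) by apply: contra Aq; apply: As.
have [p4 b2] := rhombus_phi plane faceP fq hs.
have [_ b3] : phi (phi (phi (phi (phi q)))) = phi q /\ (phi (phi (phi q))).2 = ~~ (phi q).2.
  by apply: rhombus_phi; rewrite ?face_phi.
have inj := phi_inj plane; have pN := phi_neq plane.
have QA x : face x = face q -> x \notin Q.
  by move=> fx; apply: contra Aq => /Am[]; rewrite fx.
have p13 : (phi q == phi (phi (phi q))) = false.
  by apply/eqP => h; move: b3; rewrite -h; case: (phi q).2.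
have new x : face x = face q -> (x \in Q ++ [:: phi q; phi (phi (phi q))]) = (x == phi q) || (x == phi (phi (phi q))).
  by move=> /QA /negbTE xQ; rewrite mem_cat xQ !inE.
have p02 : (q == phi (phi q)) = false.
  by apply/eqP => h; move: b2; rewrite -h; case: (q.2).
have q13 x : face x = face q -> (x \in [:: phi q; phi (phi (phi q))]) = (x \notin [:: q; phi (phi q)]).
  move=> /(rhombus_orbit fq hs)[] ->; rewrite !inE.
  - have /negbTE -> : q != phi q by apply/eqP => /esym/pN.
    have /negbTE -> : q != phi (phi (phi q)) by apply/eqP => h; apply: (pN q); rewrite -[in RHS]p4 -h.
    by rewrite eqxx.
  - rewrite eqxx; have /negbTE -> : phi q != q by apply/eqP/pN.
    by have /negbTE -> : phi q != phi (phi q) by apply/eqP => /esym/pN.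
  - have /negbTE -> : phi (phi q) != phi q by apply/eqP/pN.
    by have /negbTE -> : phi (phi q) != phi (phi (phi q)); [apply/eqP => /esym/pN | rewrite eqxx orbT].
  rewrite eqxx orbT; have /negbTE -> : phi (phi (phi q)) != q.
    by apply/eqP => h; apply: (pN q); rewrite -[in RHS]p4 h.
  by have /negbTE -> : phi (phi (phi q)) != phi (phi q) by apply/eqP/pN.
split=> /=.
- rewrite cat_uniq uQ /= !inE p13 orbF !negb_or andbT.
  by rewrite !QA // !face_phi.
- by rewrite Ao orbT.
- by move=> f /As ->; rewrite orbT.
- move=> d; rewrite mem_cat => /orP[/Am[-> //]|]; first by rewrite orbT.
  by rewrite !inE => /orP[] /eqP ->; rewrite !face_phi // eqxx.
- move=> d; have [fd _ _ _|fd /= Ad fo hd] := eqVneq (face d) (face q).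
    rewrite !new ?face_phi // !(inj_eq inj).
    by have := q13 d fd; rewrite !inE => ->; rewrite negbK.
  have neq x y : face y = face q -> face x = face d -> (x == y) = false.
    by move=> fy fx; apply/negbTE; apply: contra fd => /eqP xy; rewrite -fx xy fy.
  by rewrite !mem_cat Ar // !inE !neq ?face_phi ?face_phi ?face_phi // !orbF.
- move=> d fo hd; rewrite mem_cat Asi // !inE.
  have neq y : face y = face q -> (d == y) = false.
    by move=> fy; apply/eqP => dy; move: hd; rewrite dy fy (negbTE hs).
  by rewrite !neq ?face_phi ?face_phi ?face_phi // !orbF.
move=> M vM.
have [M1 v1 [M1q M1A]] : exists2 M', valid_marking G M' &
    ~~ M' q /\ forall d, A (face d) -> M' d = (d \in Q).
  have [M' v' eqM'] := Ae M vM.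
  case: hq => [oq|cl].
    exists M' => //; split=> //; have [Aoq _] := Am _ oq.
    by rewrite -[q]oppK; apply: v'.2; rewrite eqM'.
  have [|M2 v2 [M2q M2A]] := @flip_marking M' A v' Ao As _ q Aq.
    by move=> d Md Ad; apply: cl; rewrite -eqM'.
  by exists M2 => //; split=> // d Ad; rewrite M2A ?eqM'.
exists M1 => // d /=; have [fd _|fd /= Ad] := eqVneq (face d) (face q).
  rewrite new //; have [_ _ _ m1 [m2 m3]] := mark_rhombus plane faceP v1.1 fq hs.
  have := q13 d fd; rewrite !inE; case/(rhombus_orbit fq hs): fd => ->; rewrite eqxx /= ?orbT /=.
  - by move=> ->; apply/negbTE.
  - by rewrite m1 M1q.
  - by move=> ->; rewrite m2; apply/negbTE.
  - by rewrite m3 M1q.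
rewrite M1A // mem_cat !inE; have neq y : face y = face q -> (d == y) = false.
  by move=> fy; apply/negbTE; apply: contra fd => /eqP ->; rewrite fy.
by rewrite !neq ?face_phi ?face_phi ?face_phi // !orbF.
Qed.

Lemma decided_face_marking A Q : decided A Q -> (forall f, A f) ->
  face_marking G (fun d => d \in Q).
Proof.
case=> _ _ _ Am Ar Asi _ Aall; split=> [d fd|d fd hs|d fd hs]; [|exact: Ar|exact: Asi].
by apply/negP => /Am[].
Qed.

Lemma decided_valid A Q M : decided A Q -> (forall f, A f) -> valid_marking G M ->
  valid_marking G (fun d => d \in Q).
Proof.
move=> dec Aall vM; split; first exact: decided_face_marking dec Aall.
have [M' vM' eqM'] := decided_extends dec vM.
by move=> d; rewrite -!eqM'; [apply: vM'.2 | apply: Aall..].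
Qed.

End Propagation.

(** * The program *)

Section LoopFree.
Variable w : nat.

(* [run] and [fits] are junk on loops, and the [cost] of a loop is that of one
   round. *)
Fixpoint run (c : cmd) (s : state) : state :=
  match c with
  | Skip => s
  | Set_ x e => set_reg s x (eval s e)
  | Write a i e => set_arr s a (eval s i) (eval s e)
  | Seq c1 c2 => run c2 (run c1 s)
  | If e c1 c2 => if eval s e == 0 then run c2 s else run c1 s
  | While _ _ => s
  end.

Fixpoint fits (c : cmd) (s : state) : bool :=
  match c with
  | Skip => true
  | Set_ x e => eval s e <= w
  | Write a i e => (eval s i <= w) && (eval s e <= w)
  | Seq c1 c2 => fits c1 s && fits c2 (run c1 s)
  | If e c1 c2 => if eval s e == 0 then fits c2 s else fits c1 s
  | While _ _ => false
  end.

Fixpoint cost (c : cmd) : nat :=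
  match c with
  | Skip => 1
  | Set_ x e => (expr_cost e).+1
  | Write a i e => (expr_cost i + expr_cost e).+1
  | Seq c1 c2 => cost c1 + cost c2
  | If e c1 c2 => (expr_cost e + (cost c1 + cost c2)).+1
  | While e c => (expr_cost e + cost c).+1
  end.

Definition halts c s t (Q : state -> Prop) : Prop :=
  exists t' s', [/\ exec w c s t' s', t' <= t & Q s'].

Lemma halts_weaken c s t t' (Q Q' : state -> Prop) : halts c s t Q -> t <= t' ->
  (forall s', Q s' -> Q' s') -> halts c s t' Q'.
Proof.
move=> [t0 [s0 [h1 h2 h3]]] le QQ'; exists t0, s0; split=> //; last exact: QQ'.
exact: leq_trans h2 le.
Qed.

Lemma halts_run c s (Q : state -> Prop) : fits c s -> Q (run c s) -> halts c s (cost c) Q.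
Proof.
move=> fc Qs; suff [t [h le]] : exists t, exec w c s t (run c s) /\ t <= cost c.
  by exists t, (run c s).
elim: c s fc {Qs} => [|x e|a i e|c1 IH1 c2 IH2|e c1 IH1 c2 IH2|//] s /=.
- by exists 1; split=> //; constructor.
- by move=> h; exists (expr_cost e).+1; split=> //; constructor.
- by move=> /andP[h1 h2]; exists (expr_cost i + expr_cost e).+1; split=> //; constructor.
- move=> /andP[/IH1[t1 [h1 l1]] /IH2[t2 [h2 l2]]]; exists (t1 + t2); split; last exact: leq_add.
  exact: ExecSeq h1 h2.
- case: eqP => [e0 /IH2[t [h l]]|/eqP e0 /IH1[t [h l]]].
    by exists (expr_cost e + t).+1; split; [apply: ExecIfFalse | lia].
  by exists (expr_cost e + t).+1; split; [apply: ExecIfTrue | lia].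
Qed.

Lemma halts_seq c1 c2 s t1 t2 (P Q : state -> Prop) : halts c1 s t1 P ->
  (forall s', P s' -> halts c2 s' t2 Q) -> halts (Seq c1 c2) s (t1 + t2) Q.
Proof.
move=> [t [s1 [h1 l1 Ps1]]] /(_ s1 Ps1) [t' [s2 [h2 l2 Qs2]]].
by exists (t + t'), s2; split; [apply: ExecSeq h1 h2 | apply: leq_add |].
Qed.

Lemma halts_if e c1 c2 s t (Q : state -> Prop) :
  (eval s e != 0 -> halts c1 s t Q) -> (eval s e = 0 -> halts c2 s t Q) ->
  halts (If e c1 c2) s (expr_cost e + t).+1 Q.
Proof.
move=> h1 h2; have [e0|e0] := eqVneq (eval s e) 0.
  have [t' [s' [h l Qs]]] := h2 e0; exists (expr_cost e + t').+1, s'.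
  by split=> //; [apply: ExecIfFalse | lia].
have [t' [s' [h l Qs]]] := h1 e0; exists (expr_cost e + t').+1, s'.
by split=> //; [apply: ExecIfTrue | lia].
Qed.

Lemma halts_while e c s (Inv : state -> Prop) (mu : state -> nat) k :
  (forall s, Inv s -> eval s e != 0 -> [/\ fits c s, Inv (run c s) & mu (run c s) < mu s]) ->
  Inv s -> mu s <= k ->
  halts (While e c) s (cost (While e c) * k.+1) (fun s' => Inv s' /\ eval s' e = 0).
Proof.
move=> step; elim: k s => [|k IHk] s Is les; have [e0|e0] := eqVneq (eval s e) 0.
- exists (expr_cost e).+1, s; split=> //; last by rewrite muln1 /=; lia.
  exact: ExecWhileFalse.
- by have [_ _] := step s Is e0; lia.
- exists (expr_cost e).+1, s; split=> //; last by rewrite /=; nia.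
  exact: ExecWhileFalse.
have [fs Irun lt] := step s Is e0.
have [t1 [s1 [h1 l1 es1]]] := @halts_run c s (eq (run c s)) fs erefl; subst s1.
have [|t2 [s2 [h2 l2 Q2]]] := IHk (run c s) Irun; first by lia.
exists (expr_cost e + t1 + t2).+1, s2; split=> //; first exact: ExecWhileTrue h1 h2.
by move: l1 l2; rewrite [cost (While e c)]/=; nia.
Qed.

End LoopFree.

Section Codes.
Variable m : nat.
Implicit Types (d x : dart m).

Lemma dart_code_lt d : dart_code d < m + m.
Proof. by case: d => e b; rewrite /dart_code /=; have := ltn_ord e; case: b; lia. Qed.

Lemma dart_code_bit d : (dart_code d < m) = d.2.
Proof. by case: d => e b; rewrite /dart_code /=; have := ltn_ord e; case: b; lia. Qed.

Lemma dart_code_inj : injective (@dart_code m).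
Proof.
case=> e b [e' b'] h; have := dart_code_bit (e, b); have := dart_code_bit (e', b').
rewrite h => -> /= bb; move: h; rewrite -bb; case: b' {bb}; rewrite /dart_code /= => h.
  by congr (_, _); apply: val_inj.
by congr (_, _); apply: val_inj; apply/eqP; rewrite -(eqn_add2l m) h.
Qed.

Lemma dart_codeP i : i < m + m -> exists d, dart_code d = i.
Proof.
case: (ltnP i m) => [lt|le] lti; first by exists (Ordinal lt, true).
have lt : i - m < m by lia.
by exists (Ordinal lt, false); rewrite /dart_code /= subnKC.
Qed.

Lemma nth_darts d T (x0 : T) (f : dart m -> T) : nth x0 [seq f x | x <- darts m] (dart_code d) = f d.
Proof.
have sz b : size [seq (e, b) | e <- enum 'I_m] = m by rewrite size_map size_enum_ord.
rewrite (nth_map d) /darts ?size_cat ?sz ?dart_code_lt // nth_cat sz dart_code_bit.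
case: d => e [] /=; rewrite /dart_code /= ?addKn (nth_map e) ?size_enum_ord //;
by rewrite nth_ord_enum.
Qed.

End Codes.

(* Registers 6 to 12 are a loop counter, two scratch registers, the head and the
   tail of the queue, the dart under inspection and the answer.  Array 4 holds
   the marks, so that its first m entries are the pages, and arrays 5 to 8 hold
   the opposite dart, the decided faces, the queue and the spine successor. *)
Definition phi_expr (e : expr) : expr := Read 5 (Read 2 e).

Definition incr (x : nat) : cmd := Set_ x (Add (Reg x) (Const 1)).

Definition opp_body : cmd :=
  Seq (Write 5 (Reg 6) (Add (Reg 6) (Reg 1)))
  (Seq (Write 5 (Add (Reg 6) (Reg 1)) (Reg 6))
  (incr 6)).

Definition push (e : expr) : cmd := Seq (Write 4 e (Const 1)) (Seq (Write 7 (Reg 10) e) (incr 10)).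

Definition single_body : cmd :=
  Seq (Set_ 7 (phi_expr (Reg 6)))
  (Seq (Set_ 8 (phi_expr (Reg 7)))
  (Seq (If (Eq (Lt (Reg 6) (Reg 1)) (Lt (Reg 7) (Reg 1))) Skip
       (If (Eq (Lt (Reg 7) (Reg 1)) (Lt (Reg 8) (Reg 1))) Skip
       (If (Eq (Read 1 (Reg 7)) (Reg 3)) Skip
       (Seq (Write 6 (Read 1 (Reg 7)) (Const 1)) (push (Reg 7))))))
  (incr 6))).

Section Programs.
Variables (n m p : nat) (G : embedded_digraph n m p).
Notation orig := (orig G).
Notation face := (dart_face G).
Notation rot := (rot G).
Notation phi := (phi G).
Notation code := (@dart_code m).
Variable w : nat.
Hypotheses (w_n : n < w) (w_m : m + m < w) (w_p : p < w).
Hypothesis plane : plane_st_graph G.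
Hypothesis faceP : forall f : 'I_p, f <> outer G -> generalized_triangle G f \/ rhombus G f.

Record loaded (s : state) : Prop := Loaded {
  loaded_n : reg s 0 = n;
  loaded_m : reg s 1 = m;
  loaded_outer : reg s 3 = outer G;
  loaded_src : reg s 4 = src G;
  loaded_orig : forall d, arr s 0 (code d) = orig d;
  loaded_face : forall d, arr s 1 (code d) = face d;
  loaded_rot : forall d, arr s 2 (code d) = code (rot d) }.

Lemma input_loaded : loaded (input G).
Proof. by split=> // d; rewrite /input /= nth_darts. Qed.

Lemma loaded_frame s s' : loaded s ->
  reg s' 0 = reg s 0 -> reg s' 1 = reg s 1 -> reg s' 3 = reg s 3 -> reg s' 4 = reg s 4 ->
  arr s' 0 = arr s 0 -> arr s' 1 = arr s 1 -> arr s' 2 = arr s 2 -> loaded s'.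
Proof.
move=> [l1 l2 l3 l4 l5 l6 l7] r0 r1 r3 r4 a0 a1 a2.
by split; rewrite ?r0 ?r1 ?r3 ?r4 ?a0 ?a1 ?a2.
Qed.

Lemma code_eq (d d' : dart m) : (code d == code d') = (d == d').
Proof. exact/inj_eq/dart_code_inj. Qed.

Record opp_inv (s : state) : Prop := OppInv {
  opp_loaded : loaded s;
  opp_zero : [/\ forall j, arr s 4 j = 0, forall j, arr s 6 j = 0, reg s 9 = 0 & reg s 10 = 0];
  opp_le : reg s 6 <= m;
  opp_arr : forall d : dart m, d.1 < reg s 6 -> arr s 5 (code d) = code (opp d) }.

Lemma opp_step s : opp_inv s -> eval s (Lt (Reg 6) (Reg 1)) != 0 ->
  [/\ fits w opp_body s, opp_inv (run opp_body s) & m - reg (run opp_body s) 6 < m - reg s 6].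
Proof.
case=> ls [z1 z2 z3 z4] le ha; have l2 := loaded_m ls.
rewrite /= l2 => lt; have {}lt : reg s 6 < m by case: (reg s 6 < m) lt.
rewrite /upd /=; split; first by lia.
  split; [exact: loaded_frame ls _ _ _ _ _ _ _ | by [] | by rewrite /= /upd /=; lia |].
  move=> d; rewrite /= /upd /= => he.
  have -> : reg s 6 = code (Ordinal lt, true) by [].
  have -> : code (Ordinal lt, true) + m = code (Ordinal lt, false) by rewrite addnC.
  rewrite !code_eq; case: eqP => [-> //|ne1]; case: eqP => [-> //|ne2]; apply: ha.
  have [ed|] := eqVneq (d.1 : nat) (reg s 6); last by rewrite addn1 ltnS in he; rewrite ltn_neqAle he => ->.
  have ed' : d.1 = Ordinal lt by apply: val_inj.
  by case: d ed' ne1 ne2 {he ed} => e [] /= ->.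
by lia.
Qed.

Record ready (s : state) : Prop := Ready {
  ready_loaded : loaded s;
  ready_opp : forall d, arr s 5 (code d) = code (opp d) }.

Lemma ready_frame s s' : ready s ->
  reg s' 0 = reg s 0 -> reg s' 1 = reg s 1 -> reg s' 3 = reg s 3 -> reg s' 4 = reg s 4 ->
  arr s' 0 = arr s 0 -> arr s' 1 = arr s 1 -> arr s' 2 = arr s 2 -> arr s' 5 = arr s 5 -> ready s'.
Proof.
move=> [ls os] *; split; first exact: loaded_frame ls _ _ _ _ _ _ _.
by move=> d; rewrite -os; congr (_ _).
Qed.

Lemma ready_phi s d : ready s -> arr s 5 (arr s 2 (code d)) = code (phi d).
Proof. by move=> [ls os]; rewrite (loaded_rot ls) os. Qed.

Record queued (Q : seq (dart m)) (s : state) : Prop := Queued {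
  queued_size : reg s 10 = size Q;
  queued_nth : forall j, j < size Q -> arr s 7 j = nth 0 (map code Q) j;
  queued_mark : forall d, arr s 4 (code d) = (d \in Q) }.

Lemma queued_frame Q s s' : queued Q s -> reg s' 10 = reg s 10 ->
  arr s' 7 = arr s 7 -> arr s' 4 = arr s 4 -> queued Q s'.
Proof. by move=> [q1 q2 q3] r a1 a2; split; rewrite ?r ?a1 ?a2. Qed.

Lemma queued_push Q d s s' : queued Q s -> reg s' 10 = reg s 10 + 1 ->
  arr s' 7 = upd (arr s 7) (reg s 10) (code d) -> arr s' 4 = upd (arr s 4) (code d) 1 ->
  queued (rcons Q d) s'.
Proof.
move=> [q1 q2 q3] r a1 a2; split.
- by rewrite r q1 size_rcons addn1.
- move=> j; rewrite size_rcons a1 /upd q1 map_rcons nth_rcons size_map ltnS leq_eqVlt.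
  by case: ltngtP => //= lt _; rewrite q2.
by move=> x; rewrite a2 /upd code_eq mem_rcons inE q3; case: eqP.
Qed.

Definition first_assigned (Q : seq (dart m)) (f : 'I_p) : bool :=
  (f == outer G) || has (fun d => face d == f) Q.

Record single_inv (s : state) : Prop := SingleInv {
  single_ready : ready s;
  single_head : reg s 9 = 0;
  single_le : reg s 6 <= m + m;
  single_queue : exists Q, [/\ queued Q s, uniq Q,
    forall x, (phi x \in Q) = [&& code x < reg s 6, face x != outer G & single G (phi x)]
    & forall f : 'I_p, arr s 6 f = first_assigned Q f] }.

Lemma single_step s : single_inv s -> eval s (Lt (Reg 6) (Add (Reg 1) (Reg 1))) != 0 ->
  [/\ fits w single_body s, single_inv (run single_body s)
    & (m + m) - reg (run single_body s) 6 < (m + m) - reg s 6].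
Proof.
case=> rs h9 le [Q [qs uQ memQ as_]].
have ls := ready_loaded rs; have l2 := loaded_m ls.
rewrite /= l2 => lt; have {}lt : reg s 6 < m + m by case: (reg s 6 < m + m) lt.
have [x ex] := dart_codeP lt.
have y_lt := dart_code_lt (phi x); have z_lt := dart_code_lt (phi (phi x)).
have sizeQ : size Q <= m + m.
  by rewrite addnn -card_dart; apply: leq_trans (max_card (mem Q)); rewrite (card_uniqP uQ).
rewrite /upd /= -!ex !(ready_phi _ rs) l2 !dart_code_bit.
have lt_succ z : (code z < code x + 1) = (z == x) || (code z < code x).
  by rewrite addn1 ltnS leq_eqVlt code_eq.
have skip s' : [&& face x != outer G & single G (phi x)] = false ->
    ready s' -> reg s' 9 = 0 -> reg s' 6 = reg s 6 + 1 -> reg s' 10 = reg s 10 ->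
    arr s' 7 = arr s 7 -> arr s' 4 = arr s 4 -> arr s' 6 = arr s 6 -> single_inv s'.
  move=> nx rs' h9' h6' h10' a7' a4' a6'; split=> //; first by rewrite h6'; lia.
  exists Q; split=> //; [exact: queued_frame qs _ _ _ | | by rewrite a6'].
  by move=> z; rewrite memQ h6' -ex lt_succ; have [->|//] := eqVneq z x; rewrite ltnn /= nx.
have face_lt f : (f : 'I_p) <= w by have := ltn_ord f; lia.
have Ebit (b b' : bool) : ((b : nat) == b') = (b == b') by case: b b' => -[].
rewrite (loaded_face ls) (loaded_outer ls) val_eqE !Ebit !eqb0.
have hs : single G (phi x) = (x.2 != (phi x).2) && ((phi x).2 != (phi (phi x)).2).
  by rewrite single_phi // eq_sym [X in _ && ~~ X]eq_sym.
have i_lt : reg s 6 + 1 <= w by move: lt w_m; lia.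
have q10 := queued_size qs; rewrite -face_phi // in skip; rewrite ex in i_lt *.
have [b1|b1] := eqVneq x.2 (phi x).2; last first.
  have [b2|b2] := eqVneq (phi x).2 (phi (phi x)).2; last first.
    have [fx|fx] := eqVneq (face (phi x)) (outer G); last first.
      rewrite b1 b2 in hs; rewrite /= /upd /=.
      have pQ : phi x \notin Q by rewrite memQ ex ltnn.
      split; [by rewrite face_lt; move: y_lt z_lt sizeQ; lia | | by move: lt; lia].
      split; [exact: ready_frame rs _ _ _ _ _ _ _ _ | by [] | by rewrite /= /upd /=; move: lt; lia |].
      exists (rcons Q (phi x)); split.
      + exact: queued_push qs _ _ _.
      + by rewrite rcons_uniq pQ.
      + move=> z; rewrite mem_rcons inE memQ /= /upd /= -ex lt_succ (inj_eq (phi_inj plane)).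
        by have [->|//] := eqVneq z x; rewrite ltnn hs -(face_phi plane x) fx.
      move=> f; rewrite /= /upd /= as_ /first_assigned has_rcons (eq_sym (face (phi x))).
      by rewrite val_eqE; case: (f == face (phi x)); rewrite ?orbT.
    rewrite /= /upd /=; split; [by move: y_lt z_lt; lia | | by move: lt; lia].
    by apply: skip => //; [rewrite fx eqxx | apply: ready_frame rs _ _ _ _ _ _ _ _].
  rewrite b2 eqxx andbF in hs; rewrite /= /upd /=; split; [by move: y_lt z_lt; lia | | by move: lt; lia].
  by apply: skip => //; [rewrite hs andbF | apply: ready_frame rs _ _ _ _ _ _ _ _].
rewrite b1 eqxx in hs; rewrite /= /upd /=; split; [by move: y_lt z_lt; lia | | by move: lt; lia].
by apply: skip => //; [rewrite hs andbF | apply: ready_frame rs _ _ _ _ _ _ _ _].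
Qed.

End Programs.

Definition select_body : cmd :=
  If (Lt (Reg 9) (Reg 10)) (Seq (Set_ 11 (Read 5 (Read 7 (Reg 9)))) (incr 9))
    (Seq (Set_ 11 (Reg 6)) (incr 6)).

Definition decide_body : cmd :=
  If (Read 6 (Read 1 (Reg 11))) Skip
    (Seq (Write 6 (Read 1 (Reg 11)) (Const 1))
    (Seq (Set_ 7 (phi_expr (Reg 11)))
    (Seq (push (Reg 7))
    (Seq (Set_ 8 (phi_expr (phi_expr (Reg 7))))
    (push (Reg 8)))))).

Definition propagate_body : cmd := Seq select_body decide_body.

Definition propagate_test : expr := Add (Lt (Reg 9) (Reg 10)) (Lt (Reg 6) (Add (Reg 1) (Reg 1))).

Section Propagate.
Variables (n m p : nat) (G : embedded_digraph n m p).
Notation orig := (orig G).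
Notation face := (dart_face G).
Notation rot := (rot G).
Notation phi := (phi G).
Notation code := (@dart_code m).
Variable w : nat.
Hypotheses (w_n : n < w) (w_m : m + m < w) (w_p : p < w).
Hypothesis plane : plane_st_graph G.
Hypothesis faceP : forall f : 'I_p, f <> outer G -> generalized_triangle G f \/ rhombus G f.

Record deciding (A : pred 'I_p) (Q : seq (dart m)) (s : state) : Prop := Deciding {
  deciding_ready : ready G s;
  deciding_queued : queued Q s;
  deciding_decided : decided G A Q;
  deciding_assigned : forall f : 'I_p, arr s 6 f = A f }.

Lemma deciding_frame A Q s s' : deciding A Q s ->
  reg s' 0 = reg s 0 -> reg s' 1 = reg s 1 -> reg s' 3 = reg s 3 -> reg s' 4 = reg s 4 ->
  reg s' 10 = reg s 10 -> arr s' = arr s -> deciding A Q s'.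
Proof.
move=> [rs qs dec as_] ? ? ? ? ? ea; split; rewrite ?ea //.
- by apply: ready_frame rs _ _ _ _ _ _ _ _; rewrite ?ea.
- by apply: queued_frame qs _ _ _; rewrite ?ea.
Qed.

Lemma deciding_size A Q s : deciding A Q s -> size Q <= m + m.
Proof.
case=> _ _ [uQ _ _ _ _ _ _] _.
by rewrite addnn -card_dart; apply: leq_trans (max_card (mem Q)); rewrite (card_uniqP uQ).
Qed.

Lemma decide_step A Q s q : deciding A Q s -> reg s 11 = code q ->
  opp q \in Q \/ (forall d, d \in Q -> A (face (opp d))) ->
  [/\ fits w decide_body s, reg (run decide_body s) 6 = reg s 6, reg (run decide_body s) 9 = reg s 9
    & exists A' l, [/\ deciding A' (Q ++ l) (run decide_body s), A' (face q) & forall f, A f -> A' f]].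
Proof.
move=> ds eq_q hq; have [rs qs dec as_] := ds; have ls := ready_loaded rs.
rewrite /= eq_q (loaded_face ls) as_ eqb0.
have [Aq|Aq] := boolP (A (face q)).
  by split=> //=; exists A, [::]; rewrite cats0.
rewrite /= /upd /= !(ready_phi _ rs).
have dec' := decided_add plane faceP dec Aq hq.
have sz : size (Q ++ [:: phi q; phi (phi (phi q))]) <= m + m.
  have [uQ _ _ _ _ _ _] := dec'.
  by rewrite addnn -card_dart; apply: leq_trans (max_card (mem (Q ++ [:: phi q; phi (phi (phi q))]))); rewrite (card_uniqP uQ).
rewrite size_cat /= in sz; have q10 := queued_size qs.
have c1 := dart_code_lt (phi q); have c2 := dart_code_lt (phi (phi (phi q))).
split=> //.
  have sz' : reg s 10 + 2 <= m + m by rewrite q10; exact: sz.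
  by have := ltn_ord (face q); move: sz' c1 c2; lia.
exists [pred f | (f == face q) || A f], [:: phi q; phi (phi (phi q))].
split; [|by rewrite /= eqxx|by move=> f /= ->; rewrite orbT].
split=> //.
- exact: ready_frame rs _ _ _ _ _ _ _ _.
- rewrite -cat_rcons cats1.
  pose s1 := State (upd (reg s) 10 (reg s 10 + 1)) (upd (upd (arr s) 4 (upd (arr s 4) (code (phi q)) 1)) 7 (upd (arr s 7) (reg s 10) (code (phi q)))).
  have qs1 : queued (rcons Q (phi q)) s1 by apply: queued_push qs _ _ _.
  exact: queued_push qs1 _ _ _.
by move=> f; rewrite /= /upd /= val_eqE as_; case: (f == face q).
Qed.

Definition propagate_inv (s : state) : Prop :=
  exists A Q, [/\ deciding A Q s, reg s 9 <= size Q, reg s 6 <= m + m,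
    forall d, d \in take (reg s 9) Q -> A (face (opp d))
  & forall d, code d < reg s 6 -> A (face d)].

Lemma propagate_step s : propagate_inv s -> eval s propagate_test != 0 ->
  [/\ fits w propagate_body s, propagate_inv (run propagate_body s)
    & ((m + m) + (m + m)) - (reg (run propagate_body s) 9 + reg (run propagate_body s) 6)
      < ((m + m) + (m + m)) - (reg s 9 + reg s 6)].
Proof.
move=> [A [Q [ds h9 h6 popped scanned]]]; have [rs qs dec as_] := ds; have ls := ready_loaded rs.
have q10 := queued_size qs; have szQ := deciding_size ds.
move=> test.
have [q [fit1 ds1 eq_q hq [le9 [le6 lt96] new]]] : exists q, [/\ fits w select_body s,
    deciding A Q (run select_body s), reg (run select_body s) 11 = code q,
    opp q \in Q \/ (forall d, d \in Q -> A (face (opp d)))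
  & [/\ reg (run select_body s) 9 <= size Q, reg (run select_body s) 6 <= m + m /\
        reg (run select_body s) 9 + reg (run select_body s) 6 = (reg s 9 + reg s 6).+1
      & forall A' : pred 'I_p, (forall f, A f -> A' f) -> A' (face q) ->
        (forall d, d \in take (reg (run select_body s) 9) Q -> A' (face (opp d))) /\
        (forall d, code d < reg (run select_body s) 6 -> A' (face d))]].
  move: test; rewrite /= (loaded_m ls) q10; case: (ltngtP (reg s 9) (size Q)) h9 => //= [lt _ _|e _].
    have d0 : dart m by case: (Q) lt => //.
    have ed : nth 0 (map code Q) (reg s 9) = code (nth d0 Q (reg s 9)) by rewrite (nth_map d0).
    exists (opp (nth d0 Q (reg s 9))); rewrite /upd /= (queued_nth qs lt) ed (ready_opp rs) oppK.
    have cl := dart_code_lt (opp (nth d0 Q (reg s 9))); have lt' := leq_trans lt szQ.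
    split=> //; first by move: cl lt'; lia.
    - exact: deciding_frame ds _ _ _ _ _ _.
    - by left; rewrite mem_nth.
    split; [by rewrite addn1 | by split; lia |].
    move=> A' AA' A'q; split=> d; last by move/scanned/AA'.
    by rewrite addn1 (take_nth d0) // mem_rcons inE => /orP[/eqP -> //|/popped/AA'].
  case: (ltnP (reg s 6) (m + m)) => //= lt _.
  have [q eq_q] := dart_codeP lt; exists q; rewrite /upd /=.
  split=> //; first by lia.
  - exact: deciding_frame ds _ _ _ _ _ _.
  - by right=> d dQ; apply: popped; rewrite e take_size.
  split; [by lia | by split; lia |].
  move=> A' AA' A'q; split=> d; first by move/popped/AA'.
  by rewrite addn1 ltnS leq_eqVlt -eq_q code_eq => /orP[/eqP -> //|]; rewrite eq_q => /scanned/AA'.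
have [fit2 e6 e9 [A' [l [ds2 A'q AA']]]] := decide_step ds1 eq_q hq.
have [popped' scanned'] := new A' AA' A'q.
have -> : fits w propagate_body s = fits w select_body s && fits w decide_body (run select_body s).
  by [].
have -> : run propagate_body s = run decide_body (run select_body s) by [].
rewrite fit1 fit2 e6 e9; split=> //; last first.
  have := leq_trans le9 szQ; move: le6 lt96 => le6 lt96 le9'; rewrite lt96.
  by move: lt96 le6 le9'; lia.
exists A', (Q ++ l); rewrite e6 e9; split=> //; first by rewrite size_cat; lia.
by move=> d; rewrite takel_cat //; apply: popped'.
Qed.

End Propagate.

Definition check_body : cmd :=
  Seq (If (Read 4 (Reg 6)) (If (Read 4 (Add (Reg 6) (Reg 1))) (Set_ 12 (Const 0)) Skip) Skip)
    (incr 6).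

Definition edge_body : cmd :=
  Seq (If (Read 4 (Reg 6)) Skip (If (Read 4 (Add (Reg 6) (Reg 1))) Skip
        (Write 8 (Read 0 (Reg 6)) (Read 0 (Add (Reg 6) (Reg 1))))))
    (incr 6).

Definition diagonal_body : cmd :=
  Seq (Set_ 7 (phi_expr (Reg 6)))
  (Seq (Set_ 8 (phi_expr (Reg 7)))
  (Seq (If (Eq (Lt (Reg 6) (Reg 1)) (Lt (Reg 7) (Reg 1)))
         (If (Lt (Reg 6) (Reg 1))
           (If (Read 4 (Reg 6)) (Write 8 (Read 0 (Reg 6)) (Read 0 (Reg 8))) Skip)
           (If (Read 4 (Reg 7)) (Write 8 (Read 0 (Reg 6)) (Read 0 (Reg 8))) Skip)) Skip)
  (incr 6))).

Definition walk_body : cmd :=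
  Seq (incr 6)
  (Seq (Write 3 (Reg 7) (Reg 6))
  (If (Lt (Reg 6) (Reg 0)) (Set_ 7 (Read 8 (Reg 7))) Skip)).

Section Output.
Variables (n m p : nat) (G : embedded_digraph n m p).
Notation orig := (orig G).
Notation face := (dart_face G).
Notation rot := (rot G).
Notation phi := (phi G).
Notation code := (@dart_code m).
Variable w : nat.
Hypotheses (w_n : n < w) (w_m : m + m < w) (w_p : p < w).
Variable M : pred (dart m).

Definition marked (s : state) : Prop := forall d, arr s 4 (code d) = M d.

Definition unmarked_upto i : bool := [forall e : 'I_m, (e < i) ==> ~~ (M (e, true) && M (e, false))].

Record check_inv (s : state) : Prop := CheckInv {
  check_ready : ready G s;
  check_marked : marked s;
  check_le : reg s 6 <= m;
  check_answer : reg s 12 = unmarked_upto (reg s 6) }.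

Lemma upto_succ i (lt : i < m) (P : pred 'I_m) :
  [forall e : 'I_m, (e < i + 1) ==> P e] = [forall e : 'I_m, (e < i) ==> P e] && P (Ordinal lt).
Proof.
apply/forallP/andP => [h|[/forallP h Pi] e].
  split; last by apply: (implyP (h (Ordinal lt))); rewrite /= addn1.
  by apply/forallP=> e; apply/implyP=> ei; apply: (implyP (h e)); rewrite addn1 ltnS ltnW.
apply/implyP; rewrite addn1 ltnS leq_eqVlt => /orP[/eqP ei|]; last exact: (implyP (h e)).
by have -> : e = Ordinal lt by apply: val_inj.
Qed.

Lemma edge_code s i (lt : i < m) : marked s ->
  arr s 4 i = M (Ordinal lt, true) /\ arr s 4 (i + m) = M (Ordinal lt, false).
Proof. by move=> ms; rewrite -!ms /dart_code /= addnC. Qed.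

Lemma check_step s : check_inv s -> eval s (Lt (Reg 6) (Reg 1)) != 0 ->
  [/\ fits w check_body s, check_inv (run check_body s) & m - reg (run check_body s) 6 < m - reg s 6].
Proof.
case=> rs ms le an; have l2 := loaded_m (ready_loaded rs).
rewrite /= l2 => lt; have {}lt : reg s 6 < m by case: (reg s 6 < m) lt.
have [e1 e2] := edge_code lt ms; rewrite /upd /= e1 e2 !eqb0.
have keep s' : ready G s' -> marked s' -> reg s' 6 = reg s 6 + 1 ->
    reg s' 12 = (unmarked_upto (reg s 6) && ~~ (M (Ordinal lt, true) && M (Ordinal lt, false))) ->
    check_inv s'.
  move=> rs' ms' h6 h12; split=> //; first by rewrite h6 addn1.
  by rewrite h12 h6 /unmarked_upto (upto_succ lt).
case Mt: (M _) => /=; last first.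
  split; [by lia | | by lia].
  apply: keep => //; first exact: ready_frame rs _ _ _ _ _ _ _ _.
  by rewrite /= /upd /= Mt andbT an; case: unmarked_upto.
case Mf: (M _) => /=; rewrite /upd /=; split; try lia; apply: keep => //;
  try (exact: ready_frame rs _ _ _ _ _ _ _ _).
  by rewrite /= /upd /= Mt Mf andbF.
by rewrite /= /upd /= Mt Mf andbT an; case: unmarked_upto.
Qed.

Hypothesis plane : plane_st_graph G.
Hypothesis faceP : forall f : 'I_p, f <> outer G -> generalized_triangle G f \/ rhombus G f.
Hypothesis valid : valid_marking G M.

Definition linked (R : 'I_n -> 'I_n -> Prop) (s : state) : Prop :=
  forall u v, R u v -> spine_step G M u v /\ arr s 8 u = v.

Lemma linked_write (R R' : 'I_n -> 'I_n -> Prop) s s' u v : linked R s -> spine_step G M u v ->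
  arr s' 8 = upd (arr s 8) u v ->
  (forall u' v', R' u' v' -> R u' v' \/ u' = u /\ v' = v) -> linked R' s'.
Proof.
move=> ls uv a8 RR' u' v' /RR'[/ls[st av]|[-> ->]]; last by rewrite a8 /upd eqxx.
split=> //; rewrite a8 /upd val_eqE; case: eqP => // uu; congr val.
by apply: (spine_step_functional plane valid uv); rewrite -uu.
Qed.

Definition edge_link i (u v : 'I_n) : Prop :=
  exists2 e : 'I_m, e < i & [/\ tail G e = u, head G e = v, ~~ M (e, true) & ~~ M (e, false)].

Record edge_inv (s : state) : Prop := EdgeInv {
  edge_ready : ready G s;
  edge_marked : marked s;
  edge_le : reg s 6 <= m;
  edge_linked : linked (edge_link (reg s 6)) s }.

Lemma edge_step s : edge_inv s -> eval s (Lt (Reg 6) (Reg 1)) != 0 ->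
  [/\ fits w edge_body s, edge_inv (run edge_body s) & m - reg (run edge_body s) 6 < m - reg s 6].
Proof.
case=> rs ms le lk; have ls := ready_loaded rs; have l2 := loaded_m ls.
rewrite /= l2 => lt; have {}lt : reg s 6 < m by case: (reg s 6 < m) lt.
have [e1 e2] := edge_code lt ms; rewrite /upd /= e1 e2 !eqb0.
have o1 : arr s 0 (reg s 6) = tail G (Ordinal lt) by rewrite -[reg s 6]/(code (Ordinal lt, true)) (loaded_orig ls).
have o2 : arr s 0 (reg s 6 + m) = head G (Ordinal lt).
  by have := loaded_orig ls (Ordinal lt, false); rewrite /dart_code /= addnC.
have b1 := ltn_ord (tail G (Ordinal lt)); have b2 := ltn_ord (head G (Ordinal lt)).
have link_succ u v : edge_link (reg s 6 + 1) u v ->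
    edge_link (reg s 6) u v \/ [/\ u = tail G (Ordinal lt), v = head G (Ordinal lt),
      ~~ M (Ordinal lt, true) & ~~ M (Ordinal lt, false)].
  move=> [e le_e [te he Mt Mf]]; rewrite addn1 ltnS leq_eqVlt in le_e.
  case/orP: le_e => [/eqP ei|lt_e]; last by left; exists e.
  have ee : e = Ordinal lt by apply: val_inj.
  by right; rewrite -te -he -ee.
have skip s' : M (Ordinal lt, true) || M (Ordinal lt, false) -> ready G s' -> marked s' ->
    reg s' 6 = reg s 6 + 1 -> arr s' 8 = arr s 8 -> edge_inv s'.
  move=> Mb rs' ms' h6 a8; split=> //; first by rewrite h6 addn1.
  rewrite h6 => u v /link_succ[/lk[st av]|[_ _ Mt Mf]]; first by rewrite a8.
  by move: Mb; rewrite (negbTE Mt) (negbTE Mf).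
case Mt: (M _) => /=.
  split; [by lia | | by lia].
  apply: skip => //; [by rewrite Mt | exact: ready_frame rs _ _ _ _ _ _ _ _].
case Mf: (M _) => /=; rewrite /upd /=.
  split; [by lia | | by lia].
  apply: skip => //; [by rewrite Mf orbT | exact: ready_frame rs _ _ _ _ _ _ _ _].
rewrite o1 o2; split; [by move: b1 b2; lia | | by lia].
split=> //; [exact: ready_frame rs _ _ _ _ _ _ _ _ | by rewrite /= /upd /= addn1 |].
have st : spine_step G M (tail G (Ordinal lt)) (head G (Ordinal lt)).
  by apply/orP; left; apply/existsP; exists (Ordinal lt); rewrite Mt Mf !eqxx.
apply: (linked_write lk st) => // u v /link_succ[|[-> -> _ _]]; by [left | right].
Qed.

Definition diagonal_link i (u v : 'I_n) : Prop :=
  edge_link m u v \/ exists2 d, code d < i & [/\ diagonal_from G M d, orig d = u & orig (phi (phi d)) = v].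

Record diagonal_inv (s : state) : Prop := DiagonalInv {
  diagonal_ready : ready G s;
  diagonal_marked : marked s;
  diagonal_le : reg s 6 <= m + m;
  diagonal_linked : linked (diagonal_link (reg s 6)) s }.

Lemma diagonal_step s : diagonal_inv s -> eval s (Lt (Reg 6) (Add (Reg 1) (Reg 1))) != 0 ->
  [/\ fits w diagonal_body s, diagonal_inv (run diagonal_body s)
    & (m + m) - reg (run diagonal_body s) 6 < (m + m) - reg s 6].
Proof.
case=> rs ms le lk; have ls := ready_loaded rs; have l2 := loaded_m ls.
rewrite /= l2 => lt; have {}lt : reg s 6 < m + m by case: (reg s 6 < m + m) lt.
have [x ex] := dart_codeP lt.
have y_lt := dart_code_lt (phi x); have z_lt := dart_code_lt (phi (phi x)).
rewrite /upd /= -!ex !(ready_phi _ rs) l2 !dart_code_bit !(loaded_orig ls) !ms.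
have Ebit (b b' : bool) : ((b : nat) == b') = (b == b') by case: b b' => -[].
rewrite !Ebit !eqb0.
have b1 := ltn_ord (orig x); have b2 := ltn_ord (orig (phi (phi x))).
have i_lt : reg s 6 + 1 <= w by move: lt w_m; lia.
have link_succ u v : diagonal_link (code x + 1) u v ->
    diagonal_link (code x) u v \/ [/\ u = orig x, v = orig (phi (phi x)) & diagonal_from G M x].
  case=> [h|[d le_d [dd od od']]]; first by left; left.
  rewrite addn1 ltnS leq_eqVlt code_eq in le_d.
  case/orP: le_d => [/eqP dx|lt_d]; last by left; right; exists d.
  by right; rewrite -od -od' -dx.
rewrite -ex in lk.
have skip s' : ~~ diagonal_from G M x -> ready G s' -> marked s' ->
    reg s' 6 = reg s 6 + 1 -> arr s' 8 = arr s 8 -> diagonal_inv s'.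
  move=> Nd rs' ms' h6 a8; split=> //; first by rewrite h6 addn1.
  rewrite h6 -ex => u v /link_succ[/lk[st av]|[_ _ dx]]; first by rewrite a8.
  by rewrite dx in Nd.
have link s' : diagonal_from G M x -> ready G s' -> marked s' -> reg s' 6 = reg s 6 + 1 ->
    arr s' 8 = upd (arr s 8) (orig x) (orig (phi (phi x))) -> diagonal_inv s'.
  move=> dx rs' ms' h6 a8; split=> //; first by rewrite h6 addn1.
  have st : spine_step G M (orig x) (orig (phi (phi x))).
    by apply/orP; right; apply/existsP; exists x; rewrite dx !eqxx.
  rewrite h6 -ex; apply: (linked_write lk st a8) => u v /link_succ[|[-> -> _]]; by [left | right].
have dxE : diagonal_from G M x = ((phi x).2 == x.2) && M (if x.2 then x else phi x) by [].
have [bx|bx] := eqVneq x.2 (phi x).2; last first.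
  rewrite /= /upd /=; split; [by move: y_lt z_lt; lia | | by move: lt; lia].
  apply: skip => //; [by rewrite dxE eq_sym (negbTE bx) | exact: ready_frame rs _ _ _ _ _ _ _ _].
rewrite -bx eqxx /= in dxE.
have [xb|xb] := boolP x.2; rewrite ?xb ?(negbTE xb) in dxE;
  [have [Mx|Mx] := boolP (M x) | have [Mx|Mx] := boolP (M (phi x))];
  rewrite /= /upd /=; (split; [by move: y_lt z_lt; lia | | by move: lt; lia]).
- apply: link => //; [by rewrite dxE | exact: ready_frame rs _ _ _ _ _ _ _ _].
- apply: skip => //; [by rewrite dxE | exact: ready_frame rs _ _ _ _ _ _ _ _].
- apply: link => //; [by rewrite dxE | exact: ready_frame rs _ _ _ _ _ _ _ _].
- apply: skip => //; [by rewrite dxE | exact: ready_frame rs _ _ _ _ _ _ _ _].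
Qed.

Variable pi : {perm 'I_n}.
Hypothesis pi_step : forall u v, spine_step G M u v -> pi v = (pi u).+1 :> nat.

Lemma spine_successor (u : 'I_n) : (pi u).+1 < n -> exists v, spine_step G M u v.
Proof.
move=> lt; have out v : v != snk G -> exists v', spine_step G M v v'.
  by move=> /(out_edge plane)[e <-]; have [v' ?] := edge_spine_path plane faceP valid e; exists v'.
have [us|/out //] := eqVneq u (snk G).
have n0 : n.-1 < n by lia.
pose v := (pi^-1)%g (Ordinal n0); have pv : pi v = n.-1 :> nat by rewrite permKV.
have [vs|/out[v' /pi_step]] := eqVneq v (snk G).
  by move: lt; rewrite us -vs pv; lia.
by rewrite pv; have := ltn_ord (pi v'); lia.
Qed.

Record walk_inv (s : state) : Prop := WalkInv {
  walk_loaded : loaded G s;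
  walk_marked : marked s;
  walk_linked : linked (spine_step G M) s;
  walk_le : reg s 6 <= n;
  walk_at : reg s 6 < n -> exists2 v : 'I_n, reg s 7 = v & pi v = reg s 6 :> nat;
  walk_pos : forall v : 'I_n, pi v < reg s 6 -> arr s 3 v = (pi v).+1 }.

Lemma walk_step s : walk_inv s -> eval s (Lt (Reg 6) (Reg 0)) != 0 ->
  [/\ fits w walk_body s, walk_inv (run walk_body s) & n - reg (run walk_body s) 6 < n - reg s 6].
Proof.
case=> ls ms lk le at_ pos; have l1 := loaded_n ls.
rewrite /= l1 => lt; have {}lt : reg s 6 < n by case: (reg s 6 < n) lt.
have [v rv pv] := at_ lt; have lv := ltn_ord v.
have keep s' : loaded G s' -> marked s' -> arr s' 8 = arr s 8 -> reg s' 6 = reg s 6 + 1 ->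
    arr s' 3 = upd (arr s 3) v (reg s 6 + 1) ->
    (reg s 6 + 1 < n -> exists2 v : 'I_n, reg s' 7 = v & pi v = reg s 6 + 1 :> nat) -> walk_inv s'.
  move=> ls' ms' a8 h6 a3 at'; split=> //; rewrite ?h6 //; [by move=> u u' /lk; rewrite a8 | by lia |].
  move=> u; rewrite addn1 ltnS leq_eqVlt a3 /upd val_eqE => /orP[/eqP pu|lt_u].
    have -> : u = v by apply/(@perm_inj _ pi)/val_inj; rewrite /= pu pv.
    by rewrite eqxx pv addn1.
  by case: eqP => [uv|_]; [move: lt_u; rewrite uv pv ltnn | apply: pos].
rewrite /upd /= l1; case: (ltnP (reg s 6 + 1) n) => [lt1|ge1] /=; rewrite /upd /=; last first.
  split; [by move: lv; rewrite rv; lia | | by lia].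
  apply: keep => //; [exact: loaded_frame ls _ _ _ _ _ _ _ | by rewrite /= rv | by lia].
have [v' vv'] : exists v', spine_step G M v v'.
  by apply: spine_successor; rewrite pv; move: lt1; rewrite addn1.
have [_ av] := lk _ _ vv'; have lv' := ltn_ord v'.
split; [by move: lv lv'; rewrite rv av; lia | | by lia].
apply: keep => //; [exact: loaded_frame ls _ _ _ _ _ _ _ | by rewrite /= rv |].
by move=> _; exists v'; [rewrite /= /upd /= rv | rewrite (pi_step vv') pv addn1].
Qed.

End Output.

Definition opp_loop : cmd := While (Lt (Reg 6) (Reg 1)) opp_body.
Definition single_loop : cmd := While (Lt (Reg 6) (Add (Reg 1) (Reg 1))) single_body.
Definition propagate_loop : cmd := While propagate_test propagate_body.
Definition check_loop : cmd := While (Lt (Reg 6) (Reg 1)) check_body.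
Definition edge_loop : cmd := While (Lt (Reg 6) (Reg 1)) edge_body.
Definition diagonal_loop : cmd := While (Lt (Reg 6) (Add (Reg 1) (Reg 1))) diagonal_body.
Definition walk_loop : cmd := While (Lt (Reg 6) (Reg 0)) walk_body.

Definition reset : cmd := Set_ 6 (Const 0).

Definition mark_program : cmd :=
  Seq opp_loop
  (Seq (Seq (Write 6 (Reg 3) (Const 1)) reset)
  (Seq single_loop
  (Seq reset propagate_loop))).

Definition order_program : cmd :=
  Seq reset
  (Seq edge_loop
  (Seq reset
  (Seq diagonal_loop
  (Seq (Seq (Set_ 7 (Reg 4)) reset)
  walk_loop)))).

Definition program : cmd :=
  Seq mark_program
  (Seq (Seq (Set_ 12 (Const 1)) reset)
  (Seq check_loop
  (If (Reg 12) (Seq order_program (Set_ 0 (Const 1))) (Set_ 0 (Const 0))))).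

Section Scaled.
Variables w N : nat.
Hypothesis N0 : 0 < N.

Definition timed c s := halts w c s (cost c * N).

Lemma timed_run c s (Q : state -> Prop) : fits w c s -> Q (run c s) -> timed c s Q.
Proof. by move=> fc Qs; apply: halts_weaken (halts_run fc Qs) _ _ => //; apply: leq_pmulr. Qed.

Lemma timed_weaken c s (Q Q' : state -> Prop) : timed c s Q -> (forall s', Q s' -> Q' s') -> timed c s Q'.
Proof. by move=> h QQ'; apply: halts_weaken h (leqnn _) QQ'. Qed.

Lemma timed_seq c1 c2 s (P Q : state -> Prop) : timed c1 s P ->
  (forall s', P s' -> timed c2 s' Q) -> timed (Seq c1 c2) s Q.
Proof. by move=> h1 h2; rewrite /timed /= mulnDl; apply: halts_seq h1 h2. Qed.

Lemma timed_if e c1 c2 s (Q : state -> Prop) :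
  (eval s e != 0 -> timed c1 s Q) -> (eval s e = 0 -> timed c2 s Q) -> timed (If e c1 c2) s Q.
Proof.
move=> h1 h2; apply: (@halts_weaken _ _ _ (expr_cost e + (cost c1 + cost c2) * N).+1 _ Q) => //.
  apply: halts_if => [/h1|/h2] h; apply: halts_weaken h _ _ => //; rewrite leq_mul2r ?leq_addr ?leq_addl orbT //.
by rewrite /=; nia.
Qed.

Lemma timed_while e c s (Inv : state -> Prop) (mu : state -> nat) :
  (forall s, Inv s -> eval s e != 0 -> [/\ fits w c s, Inv (run c s) & mu (run c s) < mu s]) ->
  Inv s -> mu s < N -> timed (While e c) s (fun s' => Inv s' /\ eval s' e = 0).
Proof.
move=> step Is lt; apply: halts_weaken (halts_while step Is (leqnn _)) _ _ => //.
by rewrite leq_mul2l lt orbT.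
Qed.

End Scaled.

Section Correctness.
Variables (n m p : nat) (G : embedded_digraph n m p).
Notation orig := (orig G).
Notation face := (dart_face G).
Notation phi := (phi G).
Notation code := (@dart_code m).
Variables (w N : nat).
Hypotheses (w_n : n < w) (w_m : m + m < w) (w_p : p < w).
Hypotheses (N_n : n < N) (N_m : (m + m) + (m + m) < N).
Hypothesis plane : plane_st_graph G.
Hypothesis faceP : forall f : 'I_p, f <> outer G -> generalized_triangle G f \/ rhombus G f.

Let N0 : 0 < N := leq_ltn_trans (leq0n _) N_n.

Lemma lt_test_false (a b : nat) : nat_of_bool (a < b) = 0 -> b <= a.
Proof. by case: ltnP. Qed.

Lemma mark_program_correct : timed w N mark_program (input G)
  (fun s => exists A Q, deciding G A Q s /\ forall f, A f).
Proof.
apply: timed_seq.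
  apply: (@timed_while _ _ _ _ _ (opp_inv G) (fun s => m - reg s 6)).
  - by move=> s; apply: opp_step.
  - by split; [exact: input_loaded | by split | by [] | by []].
  - by move: N_m; lia.
move=> s [[ls [z4 z6 z9 z10] le oa] /=]; rewrite (loaded_m ls) => /lt_test_false ge.
have rs : ready G s by split=> // d; apply: oa; apply: leq_trans ge.
apply: (@timed_seq _ _ _ _ _ (single_inv G)).
  apply: (timed_run N0) => //.
    by rewrite /= (loaded_outer ls); have := ltn_ord (outer G); move: w_p; lia.
  split=> //; first exact: ready_frame rs _ _ _ _ _ _ _ _.
  exists [::]; split=> //.
  - by split=> // d; rewrite /= /upd /= z4.
  - by move=> f; rewrite /= /upd /= (loaded_outer ls) val_eqE z6 /first_assigned; case: (f == _).
move=> {ls rs ge oa z4 z6 z9 z10 le}s si; apply: timed_seq.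
  apply: (@timed_while _ _ _ _ _ (single_inv G) (fun s => (m + m) - reg s 6)) => //.
  - by move=> s'; apply: single_step.
  - by move: N_m; lia.
move=> {si}s [[rs h9 le [Q [qs uQ memQ as_]]] /=].
rewrite (loaded_m (ready_loaded rs)) => /lt_test_false ge.
have {}memQ d : (d \in Q) = (face d != outer G) && single G d.
  rewrite -[d](f_finv (phi_inj plane)) memQ face_phi // (leq_trans _ ge) //.
  exact: dart_code_lt.
have dec := decided_start uQ memQ.
apply: (@timed_seq _ _ _ _ _ (propagate_inv G)).
  apply: (timed_run N0) => //.
  exists [pred f | (f == outer G) || has_single G f], Q; rewrite /= /upd /= h9 take0; split=> //.
  split=> //; first exact: ready_frame rs _ _ _ _ _ _ _ _.
    exact: queued_frame qs _ _ _.
  move=> f; rewrite /= as_ /first_assigned; case: eqVneq => //= fo; congr nat_of_bool.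
  apply/hasP/existsP => [[d dQ fd]|[d /andP[/eqP fd sd]]].
    by exists d; rewrite fd; move: dQ; rewrite memQ => /andP[].
  by exists d; rewrite ?memQ fd ?fo.
move=> s0 pi0; apply: timed_weaken.
  apply: (@timed_while _ _ _ _ _ (propagate_inv G) (fun s => ((m + m) + (m + m)) - (reg s 9 + reg s 6))) pi0 _.
  - by move=> s1; apply: propagate_step.
  - by move: N_m; lia.
move=> s1 [[A [Q1 [ds h9' le' _ scanned]]] /= e0]; exists A, Q1; split=> // f.
have ls1 := ready_loaded (deciding_ready ds).
have /lt_test_false ge' : nat_of_bool (reg s1 6 < m + m) = 0.
  by move: e0; rewrite (loaded_m ls1); lia.
have [m0|m0] := posnP m; last first.
  by have [d <-] := face_dart plane m0 f; apply: scanned; apply: leq_trans ge'; apply: dart_code_lt.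
have -> : f = outer G.
  apply: val_inj; have euler : n + p = m + 2 by case: plane => _ _ _ [].
  have := ltn_ord f; have := ltn_ord (outer G); have := ltn_ord (src G); rewrite /=; lia.
exact: decided_outer (deciding_decided ds).
Qed.

Lemma order_program_correct (M : pred (dart m)) (pi : {perm 'I_n}) s :
  valid_marking G M -> pi (src G) = 0 :> nat ->
  (forall u v, spine_step G M u v -> pi v = (pi u).+1 :> nat) ->
  ready G s -> marked M s ->
  timed w N order_program s (fun s' => outputs s' pi (fun e => M (e, true))).
Proof.
move=> vM pi0 pi_step rs ms.
apply: (@timed_seq _ _ _ _ _ (edge_inv G M)).
  apply: (timed_run N0) => //; split=> //; first exact: ready_frame rs _ _ _ _ _ _ _ _.
  by move=> u v [e]; rewrite ltn0.
move=> {rs ms}s ei; apply: timed_seq.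
  apply: (@timed_while _ _ _ _ _ (edge_inv G M) (fun s => m - reg s 6)) => //.
  - by move=> s'; apply: edge_step.
  - by move: N_m; lia.
move=> {ei}s [[rs ms le lk] /=]; rewrite (loaded_m (ready_loaded rs)) => /lt_test_false ge.
apply: (@timed_seq _ _ _ _ _ (diagonal_inv G M)).
  apply: (timed_run N0) => //; split=> //; first exact: ready_frame rs _ _ _ _ _ _ _ _.
  move=> u v [[e le_e h]|[d]]; last by rewrite ltn0.
  by apply: lk; exists e => //; apply: leq_trans ge.
move=> {rs ms le lk ge}s di; apply: timed_seq.
  apply: (@timed_while _ _ _ _ _ (diagonal_inv G M) (fun s => (m + m) - reg s 6)) => //.
  - by move=> s'; apply: diagonal_step.
  - by move: N_m; lia.
move=> {di}s [[rs ms le lk] /=]; rewrite (loaded_m (ready_loaded rs)) => /lt_test_false ge.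
have ls := ready_loaded rs.
apply: (@timed_seq _ _ _ _ _ (walk_inv G M pi)).
  apply: (timed_run N0); first by rewrite /= (loaded_src ls); have := ltn_ord (src G); move: w_n; lia.
  split=> //; first exact: loaded_frame ls _ _ _ _ _ _ _.
    move=> u v uv; apply: lk; case/orP: uv => [/existsP[e /and4P[/eqP te /eqP he m1 m2]]|].
      by left; exists e; first exact: ltn_ord.
    case/existsP=> d /and3P[dd /eqP od /eqP od']; right; exists d => //.
    by apply: leq_trans ge; apply: dart_code_lt.
  by move=> _; exists (src G); rewrite /= /upd /= ?(loaded_src ls).
move=> {rs ms le lk ge ls}s wi.
apply: timed_weaken.
  apply: (@timed_while _ _ _ _ _ (walk_inv G M pi) (fun s => n - reg s 6)) wi _.
  - by move=> s'; apply: walk_step.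
  - by move: N_n; lia.
move=> s' [[ls' ms' _ _ _ pos] /=]; rewrite (loaded_n ls') => /lt_test_false ge; split=> [v|e].
  by apply: pos; apply: leq_trans (ltn_ord _) ge.
exact: (ms' (e, true)).
Qed.

Lemma program_correct : timed w N program (input G) (fun s =>
  (answer s = 1 /\ exists (pi : {perm 'I_n}) (sigma : 'I_m -> bool),
     is_2UBE G pi sigma /\ embedding_preserving G pi sigma /\ outputs s pi sigma)
  \/ (answer s = 0 /\ ~ exists (pi : {perm 'I_n}) (sigma : 'I_m -> bool),
     is_2UBE G pi sigma /\ embedding_preserving G pi sigma)).
Proof.
apply: timed_seq mark_program_correct _ => s [A [Q [[rs qs dec _] Aall]]].
pose M d := d \in Q; have ms : marked M s by move=> d; apply: queued_mark qs d.
apply: (@timed_seq _ _ _ _ _ (check_inv G M)).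
  apply: (timed_run N0); first by rewrite /=; move: w_n; lia.
  split=> //; first exact: ready_frame rs _ _ _ _ _ _ _ _.
  by rewrite /= /upd /= /unmarked_upto; case: forallP => // -[].
move=> {rs ms qs}s ci; apply: timed_seq.
  apply: (@timed_while _ _ _ _ _ (check_inv G M) (fun s => m - reg s 6)) => //.
  - by move=> s'; apply: check_step.
  - by move: N_m; lia.
move=> {ci}s [[rs ms le an] /=]; rewrite (loaded_m (ready_loaded rs)) => /lt_test_false ge.
have m6 : reg s 6 = m by apply/eqP; rewrite eqn_leq le ge.
have answerP : reflect (valid_marking G M) (unmarked_upto M (reg s 6)).
  rewrite m6; apply: (iffP forallP) => [h|vM e].
    split=> [|[e b] Md]; first exact: decided_face_marking dec Aall.
    have := h e; rewrite ltn_ord /=; move: Md; case: b; rewrite /opp /= => ->.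
      by [].
    by rewrite andbT.
  by apply/implyP => _; apply/negP => /andP[/vM.2 /= h1 h2]; move: h1; rewrite /opp /= h2.
have no_book : ~ valid_marking G M -> ~ exists (pi : {perm 'I_n}) (sigma : 'I_m -> bool),
    is_2UBE G pi sigma /\ embedding_preserving G pi sigma.
  move=> nv [pi [sigma [book embed]]]; apply: nv.
  exact: decided_valid dec Aall (book_valid_marking plane faceP book embed).
case: answerP an => [vM|nv] an.
  have [pi [pi0 pi_step]] := spine_permutation plane faceP vM.
  apply: (timed_if N0) => [_|]; last by rewrite /= an.
  apply: timed_seq; first exact: (order_program_correct vM pi0 pi_step rs ms).
  move=> s' out; apply: (timed_run N0); first by rewrite /=; move: w_n; lia.
  left; split=> //; exists pi, (fun e => M (e, true)).
  by split; [apply: spine_2UBE | split; first apply: spine_embedding].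
apply: (timed_if N0) => [|_]; first by rewrite /= an.
by apply: (timed_run N0) => //; right; split=> //; apply: no_book.
Qed.

End Correctness.

Theorem theorem5 :
  exists (P : cmd) (c : nat),
  forall (n m p : nat) (G : embedded_digraph n m p),
    plane_st_graph G ->
    (forall f : 'I_p, f <> outer G -> generalized_triangle G f \/ rhombus G f) ->
    exists (t : nat) (s : state),
      exec (c * n) P (input G) t s /\ t <= c * n /\
      ((answer s = 1 /\
        exists (pi : {perm 'I_n}) (sigma : 'I_m -> bool),
          is_2UBE G pi sigma /\ embedding_preserving G pi sigma /\
          outputs s pi sigma)
       \/
       (answer s = 0 /\
        ~ exists (pi : {perm 'I_n}) (sigma : 'I_m -> bool),
            is_2UBE G pi sigma /\ embedding_preserving G pi sigma)).
Proof.
exists program, (cost program * 12) => n m p G plane faceP.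
have n0 : 0 < n by apply: leq_ltn_trans (ltn_ord (src G)).
have mb := edge_bound plane; have pb := face_bound plane.
have c0 : 0 < cost program by [].
have [||||| t [s [h1 h2 h3]]] := @program_correct n m p G (cost program * 12 * n) (12 * n) _ _ _ _ _ plane faceP.
- by move: (cost program) c0 => c c0; nia.
- by move: (cost program) c0 => c c0; nia.
- by move: (cost program) c0 => c c0; nia.
- by lia.
- by lia.
by exists t, s; split=> //; split=> //; rewrite -mulnA.
Qed.
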